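(* Let $z\in\mathbb{C}$, $z\neq0$, $|\arg z|<\pi$, and let $\nu>0$ be real with $\nu\notin\mathbb{Z}$. Then $$\begin{aligned}\int_z^\infty\frac{J_\nu(t)Y_\nu(t)}{t}\,dt=-\frac1{\pi\nu}\Biggl[&\log\left(\frac2z\right)+\psi(\nu)+\frac1{2\nu}+\frac{\pi\cot(\pi\nu)\,(z/2)^{2\nu}}{2\,\Gamma^2(\nu+1)}\,{}_2F_3\left(\left.\begin{array}{c}\nu,\ \nu+\frac12\\ \nu+1,\ \nu+1,\ 2\nu+1\end{array}\right|-z^2\right)\\&+\frac{z^2}{4(1-\nu^2)}\,{}_3F_4\left(\left.\begin{array}{c}1,\ 1,\ \frac32\\ 2,\ 2,\ 2-\nu,\ 2+\nu\end{array}\right|-z^2\right)\Biggr].\end{aligned}$$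
   Context: Powers and logarithms take their principal values. $J_\nu(z)=(z/2)^\nu\sum_{k\ge0}\frac{(-1)^k(z/2)^{2k}}{k!\,\Gamma(\nu+k+1)}$ and, for $\nu\notin\mathbb{Z}$, $Y_\nu(z)=\frac{J_\nu(z)\cos\pi\nu-J_{-\nu}(z)}{\sin\pi\nu}$. $\psi=\Gamma'/\Gamma$ is the digamma function. ${}_pF_q\left(\left.\begin{array}{c}a_1,\dots,a_p\\ b_1,\dots,b_q\end{array}\right|x\right)=\sum_{k\ge0}\frac{(a_1)_k\cdots(a_p)_k}{(b_1)_k\cdots(b_q)_k}\frac{x^k}{k!}$ with $(\alpha)_k=\alpha(\alpha+1)\cdots(\alpha+k-1)$. The integral $\int_z^\infty$ is along a path in $\mathbb{C}\setminus(-\infty,0]$ from $z$ ending at $+\infty$ along the positive real axis. *)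

(* Defs.v *)
From Stdlib Require Import Reals Factorial List.
From Coquelicot Require Import Coquelicot.

Open Scope R_scope.

(* Principal argument, in (-PI, PI] for z <> 0. *)
Definition Carg (z : C) : R :=
  if Rle_dec 0 (Im z) then acos (Re z / Cmod z) else - acos (Re z / Cmod z).

Definition Cexp (z : C) : C :=
  (exp (Re z) * cos (Im z), exp (Re z) * sin (Im z)).

Definition Clog (z : C) : C := (ln (Cmod z), Carg z).

(* Principal value of w^a, for w <> 0. *)
Definition Cpower (w a : C) : C := Cexp (a * Clog w)%C.

(* Total operator, as Coquelicot's Series: meaningful for convergent series. *)
Definition CSeries (a : nat -> C) : C :=
  (Series (fun k => Re (a k)), Series (fun k => Im (a k))).

(* Euler's limit  lim n! n^x / (x (x+1) ... (x+n)),  valid for every real x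
   other than 0, -1, -2, ...; negative non-integer x occur in J_{-nu}. *)
Definition Gamma (x : R) : R :=
  real (Lim_seq (fun n =>
    INR (fact n) * Rpower (INR n) x / prod_f_R0 (fun k => x + INR k) n)).

Definition digamma (x : R) : R := Derive Gamma x / Gamma x.

Definition BesselJ (nu : R) (z : C) : C :=
  (Cpower (z / 2) nu *
   CSeries (fun k =>
     (-1) ^ k * (z / 2) ^ (2 * k)
     / (INR (fact k) * Gamma (nu + INR k + 1)%R)))%C.

(* Only for non-integer nu. *)
Definition BesselY (nu : R) (z : C) : C :=
  ((BesselJ nu z * cos (PI * nu) - BesselJ (- nu) z) / sin (PI * nu))%C.

Fixpoint Cpoch (a : C) (k : nat) : C :=
  match k with
  | O => 1%C
  | S j => (Cpoch a j * (a + INR j))%C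
  end.

Definition Cpoch_list (l : list C) (k : nat) : C :=
  fold_right (fun a p => Cpoch a k * p)%C 1%C l.

Definition pFq (a b : list C) (x : C) : C :=
  CSeries (fun k =>
    Cpoch_list a k / Cpoch_list b k * (x ^ k / INR (fact k)))%C.

Definition C1 (g : R -> C) : Prop :=
  forall t : R,
    ex_derive (fun s => Re (g s)) t /\ ex_derive (fun s => Im (g s)) t /\
    continuous (Derive (fun s => Re (g s))) t /\
    continuous (Derive (fun s => Im (g s))) t.

(* A curve is C^1 on a closed interval iff it is there the restriction of a
   C^1 curve defined on all of R; one-sided derivatives are thus avoided. *)
Definition piecewise_C1 (gamma : R -> C) : Prop :=
  exists sigma : nat -> R,
    sigma O = 0 /\
    (forall i, sigma i < sigma (S i)) /\
    is_lim_seq sigma p_infty /\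
    forall i, exists g : R -> C,
      C1 g /\ forall t, sigma i <= t <= sigma (S i) -> gamma t = g t.

(* A path, parametrized by [0, +oo), from z to +oo in the complex plane cut
   along (-oo, 0], which eventually stays on the positive real axis. *)
Definition path_to_infinity (z : C) (gamma : R -> C) : Prop :=
  gamma 0 = z /\
  piecewise_C1 gamma /\
  (forall t, 0 <= t -> ~ (Im (gamma t) = 0 /\ Re (gamma t) <= 0)) /\
  (exists T : R, forall t, T <= t -> Im (gamma t) = 0) /\
  is_lim (fun t => Re (gamma t)) p_infty p_infty.

Definition path_derive (gamma : R -> C) (t : R) : C :=
  (Derive (fun s => Re (gamma s)) t, Derive (fun s => Im (gamma s)) t).

(* The improper integral of f along gamma converges, with value l; the finitely
   many corners in each bounded interval do not affect it. *)
Definition is_path_integral (f : C -> C) (gamma : R -> C) (l : C) : Prop :=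
  is_RInt_gen (V := C_R_NormedModule)
    (fun t => (f (gamma t) * path_derive gamma t)%C)
    (at_point 0) (Rbar_locally p_infty) l.

(* Main.v *)
(** Put w = (z/2)^2.  Up to powers of z/2 and Gamma factors, J_nu^2 and J_nu J_{-nu} are explicit
    power series in w (Cauchy product and Vandermonde's identity), so that, by the reflection formula
    Gamma(1+nu) Gamma(1-nu) = pi nu / sin(pi nu), the right-hand side Phi(z) satisfies
    Phi' = - J_nu Y_nu / z along every C^1 curve in the cut plane.  It remains to see that Phi(x) tends
    to 0 as x -> +oo along the positive axis.

    An energy estimate for Bessel's equation gives J_{+-nu}(x) = O(x^(-1/2)), hence the two series in
    Phi (the second one corrected by a logarithm) have limits at +oo.  As the limits exist, they are
    also the limits, as y -> oo, of the averages int_0^oo e^(-t) f(y t) dt of these functions f of w,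
    and the averages can be computed termwise.  Since the coefficients are moments,
    (nu+1/2)_k / (2nu+1)_k of sin^2 for the weight (sin cos)^(2nu) and
    k! (1/2)_k / ((1-nu)_k (1+nu)_k) of sin^2 for the weight cos(2nu(pi/2 - x)),
    the averages become integrals over [0, pi/2] whose limits are elementary: 1/(2nu) for
    int_0^oo J_nu^2 dt/t, and gamma + K(nu) for the logarithmic part, where
    K(nu) = 1/sin(pi nu) int_0^(pi/2) (sin(pi nu - 2nu x) - sin(pi nu)) cot x dx.

    Finally K(nu) - K(nu+1) = (1/nu + 1/(nu+1))/2, and the Riemann-Lebesgue lemma compares K(nu+n) with
    its analogue for nu = 0; this yields
    - K(nu) = psi(nu) + 1/(2nu) + (pi/2) cot(pi nu) + gamma + log 2, so that Phi(x) -> 0. *)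

Require Import Defs.
From Stdlib Require Import Reals Factorial List Lra Lia Psatz ClassicalEpsilon.
From Coquelicot Require Import Coquelicot.
Import ListNotations.

(** The behaviour of Phi at +oo is invisible in its power series, whose large terms cancel. A
    Laplace average multiplies the k-th coefficient by k!, or by a Gamma value, and so removes one
    factorial from the denominator; with the trigonometric moments the series collapse to a lower
    incomplete Gamma function and to exponential integrals at 4 y sin^2 x, and as y -> oo this
    argument is large except near x = 0. An average only reveals a limit that already exists, hence
    the energy estimate.

    The constants must be matched with [Gamma] as Euler's limit: for positive arguments it is
    compared with Euler's integral, which supplies the Laplace moments; the moments of cos(2 nu
    (pi/2 - x)), compared with Wallis' integrals, yield the reflection formula; digamma comes from a
    second-order bound on the logarithms of Euler's terms that survives the limit.

    As [Phi] is an antiderivative on the whole cut plane, the integral telescopes along every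
    admissible path, and since the path ends on the positive axis only a real limit remains. *)

(** * Integrals and series of real-valued functions *)

Lemma is_RInt_Rplus {f g : R -> R} {a b lf lg : R} :
  is_RInt f a b lf -> is_RInt g a b lg -> is_RInt (fun x => f x + g x) a b (lf + lg).
Proof. apply (is_RInt_plus (V := R_NormedModule)). Qed.

Lemma is_RInt_Rminus {f g : R -> R} {a b lf lg : R} :
  is_RInt f a b lf -> is_RInt g a b lg -> is_RInt (fun x => f x - g x) a b (lf - lg).
Proof. apply (is_RInt_minus (V := R_NormedModule)). Qed.

Lemma is_RInt_Rscal {f : R -> R} {a b l : R} (k : R) :
  is_RInt f a b l -> is_RInt (fun x => k * f x) a b (k * l).
Proof. apply (is_RInt_scal (V := R_NormedModule)). Qed.

Lemma is_RInt_Runique (f : R -> R) (a b l : R) : is_RInt f a b l -> RInt f a b = l.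
Proof. apply (is_RInt_unique (V := R_CompleteNormedModule)). Qed.

Lemma ex_series_Rscal (c : R) (a : nat -> R) : ex_series a -> ex_series (fun k => c * a k).
Proof. apply (ex_series_scal_l (K := R_AbsRing) (V := R_NormedModule)). Qed.

(* Equalities stated in one of Coquelicot's canonical structures on [R] are out of reach of [ring]. *)
Ltac Rring := match goal with |- ?a = ?b => change (@eq R a b) end; ring.

(** * Entire power series with real coefficients *)

(** [CV_disk] is absolute convergence, so every domination argument below can start from this
    predicate directly. *)
Definition entire (a : nat -> R) : Prop := forall x, CV_disk a x.

Lemma entire_radius (a : nat -> R) (x : R) :
  entire a -> Rbar_lt (Rabs x) (CV_radius a).
Proof.
  intros Ha. unfold CV_radius. destruct (Lub_Rbar_correct (CV_disk a)) as [Hl _].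
  apply Rbar_lt_le_trans with (Finite (Rabs x + 1)); [simpl; lra|].
  apply Hl, Ha.
Qed.

Lemma radius_entire (a : nat -> R) : CV_radius a = p_infty -> entire a.
Proof. intros H x. apply CV_disk_inside. now rewrite H. Qed.

Lemma entire_ratio (a : nat -> R) :
  (forall n, a n <> 0) -> is_lim_seq (fun n => Rabs (a (S n) / a n)) 0 -> entire a.
Proof. intros H1 H2. apply radius_entire, CV_radius_infinite_DAlembert; assumption. Qed.

Lemma entire_le (a b : nat -> R) (C : R) :
  (forall n, Rabs (a n) <= C * Rabs (b n)) -> entire b -> entire a.
Proof.
  intros H Hb x.
  apply (@ex_series_le R_AbsRing R_CompleteNormedModule) with (b := fun n => C * Rabs (b n * x ^ n)).
  - intros n. change (Rabs (Rabs (a n * x ^ n)) <= C * Rabs (b n * x ^ n)).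
    rewrite Rabs_Rabsolu, !Rabs_mult, <- Rmult_assoc.
    apply Rmult_le_compat_r; [apply Rabs_pos|apply H].
  - apply (@ex_series_scal_l R_AbsRing R_NormedModule C (fun n => Rabs (b n * x ^ n))), Hb.
Qed.

Lemma entire_CV_radius (a : nat -> R) : entire a -> CV_radius a = p_infty.
Proof.
  intros Ha. destruct (CV_radius a) as [r| |] eqn:E.
  - exfalso. generalize (entire_radius a (Rabs r + 1) Ha). rewrite E. simpl.
    rewrite (Rabs_right (Rabs r + 1)); generalize (Rle_abs r) (Rabs_pos r); lra.
  - reflexivity.
  - exfalso. generalize (CV_radius_ge_0 a). now rewrite E.
Qed.

Lemma entire_derive (a : nat -> R) : entire a -> entire (PS_derive a).
Proof. intros H. apply radius_entire. rewrite CV_radius_derive. now apply entire_CV_radius. Qed.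

Lemma entire_Int (a : nat -> R) : entire a -> entire (PS_Int a).
Proof. intros H. apply radius_entire. rewrite CV_radius_Int. now apply entire_CV_radius. Qed.

Lemma is_derive_entire (a : nat -> R) (x : R) :
  entire a -> is_derive (PSeries a) x (PSeries (PS_derive a) x).
Proof. intros H. apply is_derive_PSeries, entire_radius, H. Qed.

Lemma continuous_entire (a : nat -> R) (x : R) : entire a -> continuous (PSeries a) x.
Proof.
  intros H. apply (ex_derive_continuous (PSeries a)).
  eexists. apply is_derive_entire, H.
Qed.

Lemma ex_series_entire (a : nat -> R) (x : R) : entire a -> ex_series (fun n => a n * x ^ n).
Proof. intros H. apply ex_series_Rabs, (H x). Qed.

(** * Dominated series and termwise integration *)

Lemma series_tail (a : nat -> R) (N : nat) :
  ex_series a -> Series a = sum_f_R0 a N + Series (fun k => a (S N + k)%nat).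
Proof. intros H. rewrite (Series_incr_n a (S N)); [reflexivity|lia|exact H]. Qed.

Lemma series_tail_lt (M : nat -> R) (eps : R) :
  ex_series M -> 0 < eps -> (forall n, 0 <= M n) ->
  exists N, forall n, (N <= n)%nat -> Series (fun k => M (S n + k)%nat) < eps.
Proof.
  intros H Heps HM. pose proof (Series_correct _ H) as Hs.
  assert (Hl : is_lim_seq (sum_n M) (Series M)) by exact Hs.
  apply is_lim_seq_spec in Hl.
  destruct (Hl (mkposreal eps Heps)) as [N HN]. exists N. intros n Hn.
  specialize (HN n Hn). simpl in HN. rewrite sum_n_Reals in HN.
  rewrite (series_tail M n H) in HN.
  apply Rabs_lt_between in HN. lra.
Qed.

Lemma sum_f_R0_filterlim {T : Type} (F : (T -> Prop) -> Prop) {FF : Filter F}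
  (a : nat -> T -> R) (l : nat -> R) (N : nat) :
  (forall n, filterlim (a n) F (locally (l n))) ->
  filterlim (fun t => sum_f_R0 (fun n => a n t) N) F (locally (sum_f_R0 l N)).
Proof.
  intros H. induction N as [|N IH]; simpl; [apply H|].
  eapply filterlim_comp_2; [exact IH|apply (H (S N))|].
  apply (filterlim_plus (K := R_AbsRing) (V := R_NormedModule)).
Qed.

(** Tannery's theorem. A partial sum converges termwise, and the tails of the series and of its
    limit are both bounded by the same tail of [M]; each of the three parts gets [eps / 3]. *)
Lemma series_dominated {T : Type} (F : (T -> Prop) -> Prop) {FF : ProperFilter F}
  (a : nat -> T -> R) (l M : nat -> R) :
  ex_series M -> F (fun t => forall n, Rabs (a n t) <= M n) ->
  (forall n, filterlim (a n) F (locally (l n))) ->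
  filterlim (fun t => Series (fun n => a n t)) F (locally (Series l)).
Proof.
  intros HM Hdom Hlim.
  assert (HM0 : forall n, 0 <= M n).
  { intros n. destruct (filter_ex _ Hdom) as [t Ht].
    eapply Rle_trans; [apply Rabs_pos|apply (Ht n)]. }
  (* The bound passes to the limits: since the filter is proper, some [t] satisfies both the bound
     and the approximation. *)
  assert (Hl : forall n, Rabs (l n) <= M n).
  { intros n. apply le_epsilon. intros e He.
    assert (H2 : F (fun t => Rabs (a n t - l n) < e)).
    { apply (proj1 (filterlim_locally (a n) (l n)) (Hlim n) (mkposreal e He)). }
    destruct (filter_ex _ (filter_and _ _ H2 Hdom)) as [t [Ht1 Ht2]].
    specialize (Ht2 n). replace (l n) with (a n t - (a n t - l n)) by ring.
    eapply Rle_trans; [apply Rabs_triang|]. rewrite Rabs_Ropp. lra. }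
  apply filterlim_locally. intros eps.
  assert (He : 0 < eps / 3) by (destruct eps; simpl; lra).
  destruct (series_tail_lt M (eps / 3) HM He HM0) as [N HN]. specialize (HN N (le_n N)).
  assert (H2 := proj1 (filterlim_locally _ _) (sum_f_R0_filterlim F a l N Hlim) (mkposreal _ He)).
  generalize (filter_and _ _ H2 Hdom). apply filter_imp. intros t [Ht1 Ht2].
  change (Rabs (Series (fun n => a n t) - Series l) < eps).
  assert (Habs : forall (b : nat -> R), (forall n, Rabs (b n) <= M n) ->
     ex_series b /\ Rabs (Series (fun k => b (S N + k)%nat)) <= Series (fun k => M (S N + k)%nat)).
  { intros b Hb.
    assert (Hb1 : ex_series (fun n => Rabs (b n))).
    { apply (@ex_series_le R_AbsRing R_CompleteNormedModule) with (b := M); [|exact HM].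
      intros n. change (Rabs (Rabs (b n)) <= M n). rewrite Rabs_Rabsolu. apply Hb. }
    split; [apply ex_series_Rabs, Hb1|].
    eapply Rle_trans; [apply Series_Rabs|].
    - apply (ex_series_incr_n (fun n => Rabs (b n)) (S N)), Hb1.
    - apply Series_le; [intros n; split; [apply Rabs_pos|apply Hb]|].
      apply (ex_series_incr_n M (S N)), HM. }
  destruct (Habs _ Ht2) as [E1 B1]. destruct (Habs _ Hl) as [E2 B2].
  rewrite (series_tail _ N E1), (series_tail _ N E2).
  change (Rabs (sum_f_R0 (fun n => a n t) N - sum_f_R0 l N) < eps / 3) in Ht1.
  apply Rabs_lt_between in Ht1. apply Rabs_le_between in B1. apply Rabs_le_between in B2.
  apply Rabs_lt_between. split; lra.
Qed.

Lemma continuous_bounded (f : R -> R) (a b : R) :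
  a <= b -> (forall x, a <= x <= b -> continuous f x) ->
  exists M, 0 <= M /\ forall x, a <= x <= b -> Rabs (f x) <= M.
Proof.
  intros Hab Hf.
  destruct (continuity_ab_maj (fun x => Rabs (f x)) a b Hab) as [c [Hc _]].
  - intros x Hx. apply continuity_pt_filterlim.
    apply (continuous_comp f Rabs); [apply Hf, Hx|apply (continuous_Rabs (f x))].
  - exists (Rabs (f c)). split; [apply Rabs_pos|exact Hc].
Qed.

Lemma abs_RInt_bound (f : R -> R) (a b M : R) :
  a <= b -> ex_RInt f a b -> (forall x, a <= x <= b -> Rabs (f x) <= M) ->
  Rabs (RInt f a b) <= (b - a) * M.
Proof. intros H1 H2 H3. apply abs_RInt_le_const; assumption. Qed.

Lemma ex_RInt_cont (f : R -> R) (a b : R) :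
  a <= b -> (forall x, a <= x <= b -> continuous f x) -> ex_RInt f a b.
Proof.
  intros Hab H. apply (ex_RInt_continuous f). intros x.
  rewrite Rmin_left, Rmax_right by assumption. apply H.
Qed.

Lemma continuous_Rmult (f g : R -> R) (x : R) :
  continuous f x -> continuous g x -> continuous (fun t => f t * g t) x.
Proof. intros Hf Hg. apply (continuous_mult f g); assumption. Qed.

Lemma continuous_Rplus (f g : R -> R) (x : R) :
  continuous f x -> continuous g x -> continuous (fun t => f t + g t) x.
Proof. intros Hf Hg. apply (continuous_plus f g); assumption. Qed.

Lemma continuous_Rminus (f g : R -> R) (x : R) :
  continuous f x -> continuous g x -> continuous (fun t => f t - g t) x.
Proof. intros Hf Hg. apply (continuous_minus f g); assumption. Qed.

Lemma continuous_pow (f : R -> R) (n : nat) (x : R) :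
  continuous f x -> continuous (fun t => f t ^ n) x.
Proof.
  intros Hf. induction n as [|n IH]; simpl.
  - apply continuous_const.
  - now apply continuous_Rmult.
Qed.

Lemma RInt_sum_f_R0 (f : nat -> R -> R) (a b : R) (N : nat) :
  (forall n, ex_RInt (f n) a b) ->
  is_RInt (fun x => sum_f_R0 (fun n => f n x) N) a b (sum_f_R0 (fun n => RInt (f n) a b) N).
Proof.
  intros H. induction N as [|N IH]; simpl.
  - apply (RInt_correct (f 0%nat)), H.
  - apply is_RInt_Rplus; [exact IH|]. apply (RInt_correct (f (S N))), H.
Qed.

(** On [a, b] the values of [s] stay below some [Ms], so the remainder of the series is uniformly at
    most the tail of the absolutely convergent series at [Ms]. *)
Lemma RInt_entire_comp (c : nat -> R) (h s : R -> R) (a b : R) :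
  a <= b -> entire c ->
  (forall x, a <= x <= b -> continuous h x) -> (forall x, a <= x <= b -> continuous s x) ->
  is_series (fun k => c k * RInt (fun x => h x * s x ^ k) a b)
    (RInt (fun x => h x * PSeries c (s x)) a b).
Proof.
  intros Hab Hc Hh Hs.
  destruct (continuous_bounded h a b Hab Hh) as [Mh [HMh0 HMh]].
  destruct (continuous_bounded s a b Hab Hs) as [Ms [HMs0 HMs]].
  assert (HI : forall k, ex_RInt (fun x => h x * s x ^ k) a b).
  { intros k. apply ex_RInt_cont; [assumption|]. intros x Hx.
    apply continuous_Rmult; [auto|]. apply continuous_pow; auto. }
  assert (HP : ex_RInt (fun x => h x * PSeries c (s x)) a b).
  { apply ex_RInt_cont; [assumption|]. intros x Hx. apply continuous_Rmult; [auto|].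
    apply (continuous_comp s (PSeries c)); [auto|]. apply continuous_entire, Hc. }
  assert (HcI : forall k, ex_RInt (fun x => c k * (h x * s x ^ k)) a b).
  { intros k. apply (ex_RInt_scal (V := R_NormedModule) _ a b (c k)), HI. }
  change (is_lim_seq (sum_n (fun k => c k * RInt (fun x => h x * s x ^ k) a b))
    (RInt (fun x => h x * PSeries c (s x)) a b)).
  apply is_lim_seq_spec. intros eps.
  (* The summand 1 keeps [A] positive when a = b or h = 0. *)
  set (A := (b - a) * Mh + 1).
  assert (HA : 0 < A). { unfold A. assert (0 <= (b - a) * Mh) by (apply Rmult_le_pos; lra). lra. }
  assert (He : 0 < eps / A) by (apply Rdiv_lt_0_compat; [apply eps|exact HA]).
  destruct (series_tail_lt (fun n => Rabs (c n * Ms ^ n)) (eps / A) (Hc Ms) He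
    (fun n => Rabs_pos _)) as [N HN].
  exists N. intros n Hn. specialize (HN n Hn).
  rewrite sum_n_Reals.
  assert (E : sum_f_R0 (fun k => c k * RInt (fun x => h x * s x ^ k) a b) n =
    RInt (fun x => sum_f_R0 (fun k => c k * (h x * s x ^ k)) n) a b).
  { rewrite (is_RInt_unique _ _ _ _ (RInt_sum_f_R0 (fun k x => c k * (h x * s x ^ k)) a b n HcI)).
    apply sum_eq. intros k _. symmetry.
    apply (RInt_scal (V := R_CompleteNormedModule) (fun x => h x * s x ^ k) a b (c k)), HI. }
  rewrite E, <- (RInt_minus (V := R_CompleteNormedModule)).
  2: { eexists; apply RInt_sum_f_R0, HcI. }
  2: exact HP.
  set (T := Series (fun k => Rabs (c (S n + k)%nat * Ms ^ (S n + k)%nat))) in *.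
  apply Rle_lt_trans with ((b - a) * (Mh * T)).
  - apply abs_RInt_bound; [assumption| |].
    + apply (ex_RInt_minus (V := R_NormedModule)); [eexists; apply RInt_sum_f_R0, HcI|exact HP].
    + intros x Hx.
      change (Rabs (sum_f_R0 (fun k => c k * (h x * s x ^ k)) n - h x * PSeries c (s x)) <= Mh * T).
      assert (E2 : sum_f_R0 (fun k => c k * (h x * s x ^ k)) n
         = h x * sum_f_R0 (fun k => c k * s x ^ k) n).
      { rewrite scal_sum. apply sum_eq. intros; ring. }
      rewrite E2. unfold PSeries at 1.
      rewrite (series_tail _ n (ex_series_entire c (s x) Hc)).
      replace (h x * sum_f_R0 (fun k => c k * s x ^ k) n -
        h x * (sum_f_R0 (fun n0 => c n0 * s x ^ n0) n +
         Series (fun k => c (S n + k)%nat * s x ^ (S n + k)))) with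
        (- (h x * Series (fun k => c (S n + k)%nat * s x ^ (S n + k)))) by ring.
      rewrite Rabs_Ropp, Rabs_mult. apply Rmult_le_compat; [apply Rabs_pos|apply Rabs_pos|auto|].
      eapply Rle_trans; [apply Series_Rabs|].
      * apply (ex_series_incr_n (fun k => Rabs (c k * s x ^ k)) (S n)), Hc.
      * apply Series_le.
        -- intros k. split; [apply Rabs_pos|]. rewrite !Rabs_mult.
           apply Rmult_le_compat_l; [apply Rabs_pos|]. rewrite <- !RPow_abs.
           apply pow_incr. split; [apply Rabs_pos|]. rewrite (Rabs_right Ms) by lra. auto.
        -- apply (ex_series_incr_n (fun k => Rabs (c k * Ms ^ k)) (S n)), Hc.
  - assert (HT : 0 <= T).
    { unfold T. replace 0 with (Series (fun _ : nat => 0 * 0)).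
      2: { rewrite Series_scal_l; ring. }
      apply Series_le; [intros k; rewrite Rmult_0_l; split; [lra|apply Rabs_pos]|].
      apply (ex_series_incr_n (fun k => Rabs (c k * Ms ^ k)) (S n)), Hc. }
    apply Rle_lt_trans with (A * T).
    + unfold A. nra.
    + replace (pos eps) with (A * (eps / A)) by (field; lra). apply Rmult_lt_compat_l; lra.
Qed.

(** * Real powers and Euler's integral *)

(* [Rpower t a] equals 1 at [t = 0] since [ln 0 = 0] in the library; [pw] repairs this. *)
Definition pw (a t : R) : R := if Rle_dec t 0 then 0 else Rpower t a.

Lemma pw_pos (a t : R) : 0 < t -> pw a t = Rpower t a.
Proof. intros H. unfold pw. destruct (Rle_dec t 0); [lra|reflexivity]. Qed.

Lemma pw_neg (a t : R) : t <= 0 -> pw a t = 0.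
Proof. intros H. unfold pw. destruct (Rle_dec t 0); [reflexivity|lra]. Qed.

Lemma pw_ge0 (a t : R) : 0 <= pw a t.
Proof.
  unfold pw. destruct (Rle_dec t 0); [lra|]. left. apply exp_pos.
Qed.

Lemma pw_gt0 (a t : R) : 0 < t -> 0 < pw a t.
Proof. intros H. rewrite pw_pos by assumption. apply exp_pos. Qed.

Lemma pw_plus (a b t : R) : pw (a + b) t = pw a t * pw b t.
Proof.
  unfold pw. destruct (Rle_dec t 0); [ring|]. apply Rpower_plus.
Qed.

Lemma pw_nat (a t : R) (k : nat) : 0 < a -> 0 <= t -> pw (a + INR k) t = pw a t * t ^ k.
Proof.
  intros Ha Ht. destruct (Req_dec t 0) as [->|H].
  - rewrite !pw_neg by lra. ring.
  - rewrite !pw_pos, Rpower_plus, Rpower_pow by lra. reflexivity.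
Qed.

Lemma pw_1 (t : R) : 0 <= t -> pw 1 t = t.
Proof.
  intros Ht. destruct (Req_dec t 0) as [->|H].
  - now rewrite pw_neg by lra.
  - rewrite pw_pos, Rpower_1 by lra. reflexivity.
Qed.

Lemma pw_mult (a s t : R) : 0 <= s -> 0 <= t -> pw a (s * t) = pw a s * pw a t.
Proof.
  intros Hs Ht. destruct (Req_dec s 0) as [->|H].
  { rewrite Rmult_0_l, (pw_neg a 0) by lra. ring. }
  destruct (Req_dec t 0) as [->|H'].
  { rewrite Rmult_0_r, (pw_neg a 0) by lra. ring. }
  rewrite !pw_pos by nra. symmetry. apply Rpower_mult_distr; lra.
Qed.

Lemma pw_lt_small (a eps : R) : 0 < a -> 0 < eps ->
  exists d, 0 < d /\ forall t, t < d -> pw a t < eps.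
Proof.
  intros Ha He. exists (Rpower eps (/ a)). split; [apply exp_pos|].
  intros t Ht. unfold pw. destruct (Rle_dec t 0); [assumption|].
  apply Rlt_le_trans with (Rpower (Rpower eps (/ a)) a).
  - apply Rlt_Rpower_l; lra.
  - rewrite Rpower_mult, Rinv_l, Rpower_1 by lra. lra.
Qed.

Lemma is_derive_pw_pos (a t : R) : 0 < t -> is_derive (pw a) t (a * pw (a - 1) t).
Proof.
  intros Ht. apply is_derive_ext_loc with (fun t => Rpower t a).
  - exists (mkposreal t Ht). intros u Hu. change (Rabs (u - t) < t) in Hu.
    apply Rabs_lt_between in Hu. rewrite pw_pos; [reflexivity|lra].
  - rewrite pw_pos by assumption. apply is_derive_Reals.
    apply derivable_pt_lim_power; assumption.
Qed.

Lemma continuous_pw (a t : R) : 0 < a -> continuous (pw a) t.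
Proof.
  intros Ha. destruct (Rtotal_order t 0) as [H|[->|H]].
  - apply continuous_ext_loc with (fun _ => 0); [|apply continuous_const].
    assert (H' : 0 < - t) by lra. exists (mkposreal _ H'). intros u Hu.
    change (Rabs (u - t) < - t) in Hu. apply Rabs_lt_between in Hu.
    rewrite pw_neg; [reflexivity|lra].
  - apply filterlim_locally. intros eps.
    destruct (pw_lt_small a eps Ha (cond_pos eps)) as [d [Hd Hd']].
    exists (mkposreal d Hd). intros u Hu. change (Rabs (u - 0) < d) in Hu.
    change (Rabs (pw a u - pw a 0) < eps).
    rewrite (pw_neg a 0), Rminus_0_r, Rabs_pos_eq by (try apply pw_ge0; lra).
    apply Hd'. apply Rabs_lt_between in Hu. lra.
  - apply (ex_derive_continuous (pw a)). eexists. apply is_derive_pw_pos, H.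
Qed.

(** An exponent above 1 gives differentiability at the junction 0 as well, the difference quotient
    there being [pw (a - 1) h]. The fundamental theorem can thus be applied on intervals that start
    at 0. *)
Lemma is_derive_pw (a t : R) : 1 < a -> is_derive (pw a) t (a * pw (a - 1) t).
Proof.
  intros Ha. destruct (Rtotal_order t 0) as [H|[->|H]].
  - apply is_derive_ext_loc with (fun _ => 0).
    + assert (H' : 0 < - t) by lra. exists (mkposreal _ H'). intros u Hu.
      change (Rabs (u - t) < - t) in Hu. apply Rabs_lt_between in Hu.
      rewrite pw_neg; [reflexivity|lra].
    + rewrite pw_neg, Rmult_0_r by lra. apply (is_derive_const (K := R_AbsRing) 0).
  - rewrite pw_neg, Rmult_0_r by lra. apply is_derive_Reals.
    intros eps Heps. destruct (pw_lt_small (a - 1) eps) as [d [Hd Hd']]; [lra|assumption|].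
    exists (mkposreal d Hd). simpl. intros h Hh Hhd.
    rewrite Rplus_0_l, (pw_neg a 0), !Rminus_0_r by lra.
    destruct (Rle_dec h 0) as [H|H].
    + rewrite pw_neg by assumption. unfold Rdiv. rewrite Rmult_0_l, Rabs_R0. assumption.
    + replace a with ((a - 1) + 1) by ring. rewrite pw_plus, pw_1 by lra.
      unfold Rdiv. rewrite Rmult_assoc, Rinv_r, Rmult_1_r by lra.
      rewrite Rabs_pos_eq by apply pw_ge0. apply Hd'.
      apply Rabs_lt_between in Hhd. lra.
  - apply is_derive_pw_pos, H.
Qed.

Lemma is_derive_replace (f : R -> R) (x l l' : R) : is_derive f x l -> l = l' -> is_derive f x l'.
Proof. intros H <-. exact H. Qed.

Lemma is_lim_monotone (f : R -> R) (x0 M : R) :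
  (forall x y, x0 <= x <= y -> f x <= f y) -> (forall x, x0 <= x -> f x <= M) ->
  exists l : R, is_lim f p_infty l /\ forall x, x0 <= x -> f x <= l.
Proof.
  intros Hm HM.
  destruct (completeness (fun y => exists x, x0 <= x /\ y = f x)) as [l [Hl1 Hl2]].
  - exists M. intros y [x [Hx ->]]. auto.
  - exists (f x0), x0. split; [lra|reflexivity].
  - exists l. assert (Hub : forall x, x0 <= x -> f x <= l).
    { intros x Hx. apply Hl1. now exists x. }
    split; [|exact Hub]. apply is_lim_spec. intros eps.
    destruct (excluded_middle_informative (exists x, x0 <= x /\ l - eps < f x)) as [[x [Hx Hfx]]|Hn].
    + exists x. intros y Hy. assert (f x <= f y) by (apply Hm; lra).
      assert (f y <= l) by (apply Hub; lra). apply Rabs_lt_between. destruct eps; simpl in *; lra.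
    + exfalso. assert (l <= l - eps); [|destruct eps; simpl in *; lra].
      apply Hl2. intros y [x [Hx ->]]. apply Rnot_lt_le. intros H. apply Hn. now exists x.
Qed.

(** The hypothesis makes both [F - C / x] and [- F - C / x] nondecreasing; the second fact bounds
    [F] by [F 1 + C], so that the first function converges. *)
Lemma is_lim_derive_bound (F f : R -> R) (C : R) :
  (forall x, 1 <= x -> is_derive F x (f x)) -> (forall x, 1 <= x -> Rabs (f x) <= C / x ^ 2) ->
  exists l : R, is_lim F p_infty l.
Proof.
  intros HF Hf.
  assert (HD : forall e x, 1 <= x -> is_derive (fun x => e * F x - C / x) x (e * f x + C / x ^ 2)).
  { intros e x Hx. eapply is_derive_replace.
    - apply (is_derive_minus (fun x => e * F x) (fun x => C / x)).
      + apply is_derive_scal, HF, Hx.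
      + auto_derive; [lra|reflexivity].
    - unfold minus, plus, opp; simpl. field. lra. }
  assert (HM : forall e, Rabs e = 1 -> forall x y, 1 <= x <= y -> e * F x - C / x <= e * F y - C / y).
  { intros e He x y Hxy. destruct (Req_dec x y) as [->|Hne]; [lra|].
    destruct (MVT_gen (fun x => e * F x - C / x) x y (fun x => e * f x + C / x ^ 2)) as [c [Hc1 Hc2]].
    - intros z Hz. apply HD. rewrite Rmin_left in Hz; lra.
    - intros z Hz. apply continuity_pt_filterlim.
      apply (ex_derive_continuous (fun x => e * F x - C / x)). eexists. apply HD.
      rewrite Rmin_left in Hz; lra.
    - rewrite Rmin_left, Rmax_right in Hc1 by lra.
      assert (0 <= e * f c + C / c ^ 2).
      { assert (H := Hf c ltac:(lra)). replace (Rabs (f c)) with (Rabs (e * f c)) in H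
          by (rewrite Rabs_mult, He; ring).
        apply Rabs_le_between in H. lra. }
      assert (0 <= (e * f c + C / c ^ 2) * (y - x)) by (apply Rmult_le_pos; lra). lra. }
  assert (HC : 0 <= C).
  { assert (H := Hf 1 (Rle_refl 1)). assert (H1 := Rabs_pos (f 1)). simpl in H. lra. }
  destruct (is_lim_monotone (fun x => 1 * F x - C / x) 1 (F 1 + C)) as [l [Hl _]].
  - intros x y Hxy. apply HM; [apply Rabs_R1|assumption].
  - intros x Hx. assert (H := HM (-1) ltac:(rewrite Rabs_left; lra) 1 x ltac:(lra)).
    assert (0 <= C / x) by (apply Rdiv_le_0_compat; lra). lra.
  - exists l. apply is_lim_ext with (fun x => (1 * F x - C / x) + C * / x).
    + intros x. unfold Rdiv. ring.
    + replace (Finite l) with (Finite (l + C * 0)) by (f_equal; ring).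
      apply is_lim_plus'; [assumption|]. apply (is_lim_scal_l Rinv C p_infty 0).
      apply (is_lim_inv (fun x => x) p_infty p_infty (is_lim_id p_infty)). discriminate.
Qed.

Lemma pow_diff_le (a b : R) (n : nat) : 0 <= b <= a ->
  0 <= a ^ S n - b ^ S n <= INR (S n) * (a - b) * a ^ n.
Proof.
  intros H. induction n as [|n IH].
  - simpl. lra.
  - replace (a ^ S (S n) - b ^ S (S n)) with (a * (a ^ S n - b ^ S n) + (a - b) * b ^ S n) by (simpl; ring).
    assert (Hb : 0 <= b ^ S n <= a ^ S n).
    { split; [apply pow_le; lra|apply pow_incr; lra]. }
    rewrite (S_INR (S n)). split.
    + apply Rplus_le_le_0_compat; apply Rmult_le_pos; lra.
    + replace ((INR (S n) + 1) * (a - b) * a ^ S n)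
        with (a * (INR (S n) * (a - b) * a ^ n) + (a - b) * a ^ S n) by (simpl; ring).
      apply Rplus_le_compat; apply Rmult_le_compat_l; lra.
Qed.

Lemma exp_mult_nat (x : R) (n : nat) : exp (INR n * x) = exp x ^ n.
Proof.
  induction n as [|n IH].
  - simpl. rewrite Rmult_0_l. apply exp_0.
  - rewrite S_INR, Rmult_plus_distr_r, exp_plus, IH, Rmult_1_l. simpl; ring.
Qed.

(** Apply [pow_diff_le] with exp(-s) - (1 - s) <= s^2. This leaves the power n - 1 of exp(-s), and
    the constant [exp 1] pays for the missing factor. Keeping the exponential in the bound makes its
    integral against a power a Gamma integral again. *)
Lemma exp_pow_diff (s : R) (n : nat) : 0 <= s <= 1 ->
  0 <= exp (- (INR n * s)) - (1 - s) ^ n <= exp 1 * (INR n * s ^ 2 * exp (- (INR n * s))).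
Proof.
  intros Hs. rewrite Ropp_mult_distr_r, exp_mult_nat.
  destruct n as [|n]; [simpl; lra|].
  assert (H1 : 1 - s <= exp (- s)) by (generalize (exp_ineq1_le (- s)); lra).
  assert (H2 : exp (- s) - (1 - s) <= s ^ 2).
  { rewrite exp_Ropp. assert (Hx := exp_ineq1_le s).
    assert (/ exp s <= / (1 + s)) by (apply Rinv_le_contravar; lra).
    assert (/ (1 + s) <= 1 - s + s ^ 2).
    { apply Rmult_le_reg_l with (1 + s); [lra|]. rewrite Rinv_r by lra. nra. }
    lra. }
  destruct (pow_diff_le (exp (- s)) (1 - s) n) as [H3 H4]; [lra|].
  split; [exact H3|]. eapply Rle_trans; [exact H4|].
  assert (Hp : 0 <= exp (- s) ^ n) by (apply pow_le; left; apply exp_pos).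
  assert (Hn := pos_INR (S n)).
  assert (He : 1 <= exp 1 * exp (- s)).
  { rewrite <- exp_plus. generalize (exp_ineq1_le (1 + - s)). lra. }
  apply Rle_trans with (INR (S n) * s ^ 2 * exp (- s) ^ n).
  - apply Rmult_le_compat_r; [assumption|]. apply Rmult_le_compat_l; assumption.
  - replace (exp 1 * (INR (S n) * s ^ 2 * exp (- s) ^ S n)) with
      (INR (S n) * s ^ 2 * exp (- s) ^ n * (exp 1 * exp (- s))) by (simpl; ring).
    rewrite <- (Rmult_1_r (INR (S n) * s ^ 2 * exp (- s) ^ n)) at 1.
    apply Rmult_le_compat_l; [|assumption].
    apply Rmult_le_pos; [|assumption]. apply Rmult_le_pos; [assumption|]. apply pow2_ge_0.
Qed.

(** Half of the exponential absorbs the power, by ln u <= u at u = t / (2 a). *)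
Lemma pw_exp_le (a t : R) : 0 < a -> 0 <= t -> pw a t * exp (- t) <= exp (a * ln (2 * a)) * exp (- (t / 2)).
Proof.
  intros Ha Ht. destruct (Req_dec t 0) as [->|H].
  - rewrite pw_neg, Rmult_0_l by lra. apply Rmult_le_pos; left; apply exp_pos.
  - rewrite pw_pos by lra. unfold Rpower. rewrite <- !exp_plus.
    assert (Hl : ln t <= t / (2 * a) + ln (2 * a)).
    { replace t with (t / (2 * a) * (2 * a)) at 1 by (field; lra).
      assert (0 < t / (2 * a)) by (apply Rdiv_lt_0_compat; lra).
      rewrite ln_mult by lra.
      assert (H1 : ln (t / (2 * a)) <= t / (2 * a)); [|lra].
      left. rewrite <- (ln_exp (t / (2 * a))) at 2. apply ln_increasing; [assumption|].
      generalize (exp_ineq1_le (t / (2 * a))). lra. }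
    assert (Hle : a * ln t + - t <= a * ln (2 * a) + - (t / 2)).
    { apply (Rmult_le_compat_l a) in Hl; [|lra].
      replace (a * (t / (2 * a) + ln (2 * a))) with (t / 2 + a * ln (2 * a)) in Hl by (field; lra). lra. }
    destruct Hle as [Hlt| ->]; [left; now apply exp_increasing|lra].
Qed.

Lemma is_lim_exp_neg (c : R) : 0 < c -> is_lim (fun t => exp (- (c * t))) p_infty 0.
Proof.
  intros Hc. apply is_lim_comp with m_infty.
  - apply is_lim_exp_m.
  - apply is_lim_ext with (fun t => (- c) * t); [intros; ring|].
    replace m_infty with (Rbar_mult (Finite (- c)) p_infty).
    + apply is_lim_scal_l, is_lim_id.
    + unfold Rbar_mult, Rbar_mult'. destruct (Rle_dec 0 (- c)); [exfalso; lra|reflexivity].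
  - exists 0. intros; discriminate.
Qed.

Lemma is_lim_squeeze0 (f g : R -> R) (x0 : R) :
  (forall x, x0 <= x -> Rabs (f x) <= g x) -> is_lim g p_infty 0 -> is_lim f p_infty 0.
Proof.
  intros H Hg. apply is_lim_le_le_loc with (fun x => - g x) g.
  - exists x0. intros x Hx. apply Rabs_le_between, H. lra.
  - replace (Finite 0) with (Rbar_opp (Finite 0)) by (simpl; f_equal; ring).
    now apply is_lim_opp.
  - exact Hg.
Qed.

Lemma pw_exp_lim (a : R) : 0 < a -> is_lim (fun t => pw a t * exp (- t)) p_infty 0.
Proof.
  intros Ha. apply is_lim_squeeze0 with (fun t => exp (a * ln (2 * a)) * exp (- (/ 2 * t))) 0.
  - intros t Ht. rewrite Rabs_pos_eq.
    + eapply Rle_trans; [apply pw_exp_le; assumption|]. right. do 2 f_equal. field.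
    + apply Rmult_le_pos; [apply pw_ge0|left; apply exp_pos].
  - replace (Finite 0) with (Rbar_mult (exp (a * ln (2 * a))) 0) by (simpl; f_equal; ring).
    apply is_lim_scal_l, is_lim_exp_neg. lra.
Qed.

Lemma continuous_exp_opp (t : R) : continuous (fun t => exp (- t)) t.
Proof. apply (ex_derive_continuous (fun t => exp (- t))). auto_derive. exact I. Qed.

Definition gint (a T : R) : R := RInt (fun t => pw a t * exp (- t)) 0 T.

Lemma continuous_pw_exp (a t : R) : 0 < a -> continuous (fun t => pw a t * exp (- t)) t.
Proof.
  intros Ha. apply continuous_Rmult; [now apply continuous_pw|apply continuous_exp_opp].
Qed.

Lemma ex_gint (a x y : R) : 0 < a -> ex_RInt (fun t => pw a t * exp (- t)) x y.
Proof. intros Ha. apply (ex_RInt_continuous (fun t => pw a t * exp (- t))). intros t _. now apply continuous_pw_exp. Qed.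

Lemma is_gint (a T : R) : 0 < a -> is_RInt (fun t => pw a t * exp (- t)) 0 T (gint a T).
Proof.
  intros Ha. apply (RInt_correct (V := R_CompleteNormedModule) (fun t => pw a t * exp (- t)) 0 T).
  now apply ex_gint.
Qed.

Lemma gint_mono (a x y : R) : 0 < a -> x <= y -> gint a x <= gint a y.
Proof.
  intros Ha Hxy. unfold gint.
  rewrite <- (RInt_Chasles (V := R_CompleteNormedModule) _ 0 x y) by now apply ex_gint.
  change (RInt (fun t => pw a t * exp (- t)) 0 x <=
   RInt (fun t => pw a t * exp (- t)) 0 x + RInt (fun t => pw a t * exp (- t)) x y).
  assert (0 <= RInt (fun t => pw a t * exp (- t)) x y); [|lra].
  apply RInt_ge_0; [assumption|now apply ex_gint|].
  intros t _. apply Rmult_le_pos; [apply pw_ge0|left; apply exp_pos].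
Qed.

Lemma gint_bounded (a x : R) : 0 < a -> 0 <= x -> gint a x <= exp (a * ln (2 * a)) * 2.
Proof.
  intros Ha Hx. set (C := exp (a * ln (2 * a))). unfold gint.
  assert (HD : is_RInt (fun t => C * exp (- (t / 2))) 0 x
    ((- C * 2 * exp (- (x / 2))) - (- C * 2 * exp (- (0 / 2))))).
  { apply (is_RInt_derive (V := R_CompleteNormedModule) (fun t => - C * 2 * exp (- (t / 2)))).
    - intros t _. auto_derive; [exact I|unfold Rdiv; field].
    - intros t _. apply (ex_derive_continuous (fun t => C * exp (- (t / 2)))). auto_derive. exact I. }
  apply Rle_trans with (RInt (fun t => C * exp (- (t / 2))) 0 x).
  - apply RInt_le; [assumption|now apply ex_gint|eexists; exact HD|].
    intros t Ht. apply pw_exp_le; lra.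
  - rewrite (is_RInt_unique _ _ _ _ HD).
    replace (- (0 / 2)) with 0 by field. rewrite exp_0.
    assert (0 < C) by apply exp_pos. assert (0 < exp (- (x / 2))) by apply exp_pos. nra.
Qed.

(* [GI a] is Euler's integral for Gamma (a + 1). *)
Definition GI (a : R) : R := real (Lim (gint a) p_infty).

Lemma GI_spec (a : R) : 0 < a ->
  is_lim (gint a) p_infty (GI a) /\ forall x, 0 <= x -> gint a x <= GI a.
Proof.
  intros Ha. destruct (is_lim_monotone (gint a) 0 (exp (a * ln (2 * a)) * 2)) as [l [Hl Hl']].
  - intros x y Hxy. apply gint_mono; lra.
  - intros x Hx. now apply gint_bounded.
  - unfold GI. rewrite (is_lim_unique _ _ _ Hl). split; assumption.
Qed.

Lemma GI_pos (a : R) : 0 < a -> 0 < GI a.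
Proof.
  intros Ha. apply Rlt_le_trans with (gint a 1); [|apply GI_spec; lra].
  unfold gint. apply RInt_gt_0; [lra| |].
  - intros t Ht. apply Rmult_lt_0_compat; [apply pw_gt0; lra|apply exp_pos].
  - intros t _. apply continuous_pw_exp, Ha.
Qed.

Lemma gint_S (a T : R) : 0 < a -> 0 <= T ->
  gint (a + 1) T = (a + 1) * gint a T - pw (a + 1) T * exp (- T).
Proof.
  intros Ha HT.
  assert (HD : is_RInt (fun t => (a + 1) * (pw a t * exp (- t)) - pw (a + 1) t * exp (- t)) 0 T
     (pw (a + 1) T * exp (- T) - pw (a + 1) 0 * exp (- 0))).
  { apply (is_RInt_derive (V := R_CompleteNormedModule) (fun t => pw (a + 1) t * exp (- t))).
    - intros t _. eapply is_derive_replace.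
      + apply (is_derive_mult (pw (a + 1)) (fun t => exp (- t))).
        * apply is_derive_pw. lra.
        * auto_derive; [exact I|reflexivity].
        * intros; apply Rmult_comm.
      + replace (a + 1 - 1) with a by ring. unfold plus, mult; simpl. ring.
    - intros t _. apply continuous_Rminus.
      + apply continuous_Rmult; [apply continuous_const|now apply continuous_pw_exp].
      + apply continuous_pw_exp. lra. }
  assert (HI : is_RInt (fun t => (a + 1) * (pw a t * exp (- t)) - pw (a + 1) t * exp (- t)) 0 T
     ((a + 1) * gint a T - gint (a + 1) T)).
  { apply is_RInt_Rminus.
    - apply is_RInt_Rscal, is_gint, Ha.
    - apply is_gint. lra. }
  assert (E := is_RInt_unique _ _ _ _ HD). rewrite (is_RInt_unique _ _ _ _ HI) in E.
  rewrite (pw_neg _ 0) in E by lra. lra.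
Qed.

Lemma GI_S (a : R) : 0 < a -> GI (a + 1) = (a + 1) * GI a.
Proof.
  intros Ha.
  assert (H1 : is_lim (gint (a + 1)) p_infty ((a + 1) * GI a - 0)).
  { apply is_lim_ext_loc with (fun T => (a + 1) * gint a T - pw (a + 1) T * exp (- T)).
    - exists 0. intros T HT. symmetry. apply gint_S; lra.
    - apply is_lim_minus'.
      + apply (is_lim_scal_l (gint a) (a + 1) p_infty (GI a)), GI_spec, Ha.
      + apply pw_exp_lim. lra. }
  destruct (GI_spec (a + 1)) as [H2 _]; [lra|].
  apply is_lim_unique in H1. apply is_lim_unique in H2. rewrite H1 in H2.
  injection H2. lra.
Qed.

(** * Euler's limit for Gamma *)

Lemma prod_f_R0_shift (f : nat -> R) (n : nat) :
  prod_f_R0 f (S n) = f 0%nat * prod_f_R0 (fun k => f (S k)) n.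
Proof.
  induction n as [|n IH]; [reflexivity|].
  change (prod_f_R0 f (S n) * f (S (S n)) = f 0%nat * (prod_f_R0 (fun k => f (S k)) n * f (S (S n)))).
  rewrite IH. ring.
Qed.

Lemma prod_f_R0_neq0 (f : nat -> R) (n : nat) : (forall k, f k <> 0) -> prod_f_R0 f n <> 0.
Proof.
  intros H. induction n as [|n IH]; simpl; [apply H|]. now apply Rmult_integral_contrapositive_currified.
Qed.

Lemma prod_f_R0_ext (f g : nat -> R) (n : nat) : (forall k, f k = g k) -> prod_f_R0 f n = prod_f_R0 g n.
Proof. intros H. induction n as [|n IH]; simpl; [apply H|]. now rewrite IH, H. Qed.

(** Integration by parts trades one factor 1 - s for one more power of s, so [a] has to vary in the
    induction. Up to the factor n^(a+1), the value is Euler's n-th term at a + 1. *)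
Lemma is_RInt_beta (n : nat) : forall a, 0 < a ->
  is_RInt (fun s => pw a s * (1 - s) ^ n) 0 1
    (INR (fact n) / prod_f_R0 (fun k => a + 1 + INR k) n).
Proof.
  assert (Hc : forall a m s, 0 < a -> continuous (fun s => pw a s * (1 - s) ^ m) s).
  { intros a m s Ha. apply continuous_Rmult; [now apply continuous_pw|].
    apply (ex_derive_continuous (fun s => (1 - s) ^ m)). auto_derive. exact I. }
  induction n as [|n IH]; intros a Ha.
  - assert (H : is_RInt (fun s => pw a s * (1 - s) ^ 0) 0 1
      (pw (a + 1) 1 / (a + 1) - pw (a + 1) 0 / (a + 1))).
    { apply (is_RInt_derive (V := R_CompleteNormedModule) (fun s => pw (a + 1) s / (a + 1))).
      - intros s _. eapply is_derive_replace.
        + apply (is_derive_scal_l (K := R_AbsRing) (V := R_NormedModule) (pw (a + 1)) s).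
          apply is_derive_pw. lra.
        + replace (a + 1 - 1) with a by ring. unfold scal; simpl; unfold mult; simpl. field. lra.
      - intros s _. now apply Hc. }
    rewrite (pw_neg _ 0), (pw_pos _ 1) in H by lra.
    unfold Rpower in H. rewrite ln_1, Rmult_0_r, exp_0 in H. simpl (prod_f_R0 _ _). simpl (fact 0).
    simpl (INR _).
    replace (1 / (a + 1 + 0)) with (1 / (a + 1) - 0 / (a + 1)) by (field; lra). exact H.
  - assert (H : is_RInt (fun s => (a + 1) * (pw a s * (1 - s) ^ S n) - INR (S n) * (pw (a + 1) s * (1 - s) ^ n)) 0 1
      (pw (a + 1) 1 * (1 - 1) ^ S n - pw (a + 1) 0 * (1 - 0) ^ S n)).
    { apply (is_RInt_derive (V := R_CompleteNormedModule) (fun s => pw (a + 1) s * (1 - s) ^ S n)).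
      - intros s _. eapply is_derive_replace.
        + apply (is_derive_mult (pw (a + 1)) (fun s => (1 - s) ^ S n)).
          * apply is_derive_pw. lra.
          * instantiate (1 := - (INR (S n) * (1 - s) ^ n)).
            auto_derive; [exact I|]. change (- (1) * (INR (S n) * (1 - s) ^ n) = - (INR (S n) * (1 - s) ^ n)). ring.
          * intros; apply Rmult_comm.
        + replace (a + 1 - 1) with a by ring.
          change ((a + 1) * pw a s * (1 - s) ^ S n + pw (a + 1) s * - (INR (S n) * (1 - s) ^ n) =
            (a + 1) * (pw a s * (1 - s) ^ S n) - INR (S n) * (pw (a + 1) s * (1 - s) ^ n)). ring.
      - intros s _. apply continuous_Rminus; apply continuous_Rmult;
          try apply continuous_const; apply Hc; lra. }
    rewrite (pw_neg _ 0) in H by lra.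
    assert (IH' := IH (a + 1) ltac:(lra)).
    apply (is_RInt_scal (V := R_NormedModule) _ _ _ (INR (S n))) in IH'.
    assert (H2 := is_RInt_Rplus H IH').
    apply (is_RInt_scal (V := R_NormedModule) _ _ _ (/ (a + 1))) in H2.
    eapply is_RInt_ext in H2; [eapply eq_ind; [exact H2|]|].
    + change (/ (a + 1) * ((pw (a + 1) 1 * (1 - 1) ^ S n - 0 * (1 - 0) ^ S n)
        + INR (S n) * (INR (fact n) / prod_f_R0 (fun k => a + 1 + 1 + INR k) n))
        = INR (fact (S n)) / prod_f_R0 (fun k => a + 1 + INR k) (S n)).
      rewrite (prod_f_R0_shift (fun k => a + 1 + INR k) n).
      rewrite (prod_f_R0_ext (fun k => a + 1 + INR (S k)) (fun k => a + 1 + 1 + INR k)).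
      2: { intros k. rewrite S_INR. ring. }
      rewrite fact_simpl, mult_INR, Rminus_diag, pow_ne_zero by lia.
      change (INR 0) with 0. field. split; [|lra].
      apply prod_f_R0_neq0. intros k. generalize (pos_INR k). lra.
    + intros s _. change (/ (a + 1) * ((a + 1) * (pw a s * (1 - s) ^ S n) - INR (S n) * (pw (a + 1) s * (1 - s) ^ n)
        + INR (S n) * (pw (a + 1) s * (1 - s) ^ n)) = pw a s * (1 - s) ^ S n). field. lra.
Qed.

Lemma is_RInt_pw_exp_scaled (b : R) (n : nat) : 0 < b -> (0 < n)%nat ->
  is_RInt (fun s => pw b s * exp (- (INR n * s))) 0 1 (gint b (INR n) / Rpower (INR n) (b + 1)).
Proof.
  intros Hb Hn. assert (Hn' : 0 < INR n) by now apply lt_0_INR.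
  assert (H : is_RInt (fun t => pw b t * exp (- t)) (INR n * 0 + 0) (INR n * 1 + 0) (gint b (INR n))).
  { replace (INR n * 0 + 0) with 0 by ring. replace (INR n * 1 + 0) with (INR n) by ring.
    now apply is_gint. }
  apply (is_RInt_comp_lin (V := R_NormedModule)) in H.
  apply (is_RInt_scal (V := R_NormedModule) _ _ _ (/ Rpower (INR n) (b + 1))) in H.
  eapply is_RInt_ext in H; [eapply eq_ind; [exact H|]|].
  - unfold scal; simpl; unfold mult; simpl. unfold Rdiv; ring.
  - intros s Hs. rewrite Rmin_left, Rmax_right in Hs by lra.
    unfold scal; simpl; unfold mult; simpl. rewrite Rplus_0_r, pw_mult by lra.
    rewrite (pw_pos b (INR n)), Rpower_plus, Rpower_1 by lra. field.
    split; [lra|]. apply Rgt_not_eq, exp_pos.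
Qed.

Definition euler (x : R) (n : nat) : R :=
  INR (fact n) * Rpower (INR n) x / prod_f_R0 (fun k => x + INR k) n.

Lemma Gamma_euler (x l : R) : is_lim_seq (euler x) l -> Gamma x = l.
Proof.
  intros H. unfold Gamma. change (real (Lim_seq (euler x)) = l).
  now rewrite (is_lim_seq_unique _ _ H).
Qed.

Lemma is_lim_seq_inv_INR : is_lim_seq (fun n => / INR n) 0.
Proof. apply (is_lim_seq_inv INR p_infty is_lim_seq_INR). discriminate. Qed.

(** Rescaled to [0, 1], Euler's term is n^(a+1) times the integral of s^a (1 - s)^n, and [gint a n]
    is the same with exp(-n s). By [exp_pow_diff] they differ by O(1/n); its factor s^2 is what
    produces [GI (a + 2)]. *)
Lemma euler_cv_GI (a : R) : 0 < a -> is_lim_seq (euler (a + 1)) (GI a).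
Proof.
  intros Ha.
  assert (Hg : is_lim_seq (fun n => gint a (INR n)) (GI a)).
  { apply (is_lim_comp_seq (gint a) INR p_infty (GI a)).
    - apply GI_spec, Ha.
    - exists 0%nat. intros; discriminate.
    - apply is_lim_seq_INR. }
  assert (He : is_lim_seq (fun n => exp 1 * GI (a + 2) * / INR n) 0).
  { replace (Finite 0) with (Rbar_mult (exp 1 * GI (a + 2)) 0) by (simpl; f_equal; ring).
    apply is_lim_seq_scal_l, is_lim_seq_inv_INR. }
  apply is_lim_seq_le_le_loc with (fun n => gint a (INR n) - exp 1 * GI (a + 2) * / INR n)
    (fun n => gint a (INR n)).
  - exists 1%nat. intros n Hn. assert (Hn' : 0 < INR n) by (apply lt_0_INR; lia).
    set (p := Rpower (INR n) (a + 1)).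
    assert (Hp : 0 < p) by apply exp_pos.
    assert (H1 := is_RInt_beta n a Ha).
    assert (H2 := is_RInt_pw_exp_scaled a n Ha ltac:(lia)).
    assert (H3 := is_RInt_pw_exp_scaled (a + 2) n ltac:(lra) ltac:(lia)).
    apply (is_RInt_scal (V := R_NormedModule) _ _ _ (exp 1 * INR n)) in H3.
    assert (H4 := is_RInt_Rminus H2 H1).
    assert (Hd : forall s, 0 <= s <= 1 ->
      0 <= pw a s * exp (- (INR n * s)) - pw a s * (1 - s) ^ n <=
      exp 1 * INR n * (pw (a + 2) s * exp (- (INR n * s)))).
    { intros s Hs. destruct (exp_pow_diff s n Hs) as [D1 D2]. assert (Hq := pw_ge0 a s).
      replace (a + 2) with (a + INR 2) by (simpl; ring). rewrite pw_nat by lra. split; nra. }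
    assert (L1 : 0 <= gint a (INR n) / p - INR (fact n) / prod_f_R0 (fun k => a + 1 + INR k) n).
    { rewrite <- (is_RInt_unique _ _ _ _ H4 : RInt _ 0 1 = gint a (INR n) / p - INR (fact n) / prod_f_R0 (fun k => a + 1 + INR k) n).
      apply RInt_ge_0; [lra|eexists; exact H4|]. intros s Hs. apply Hd; lra. }
    assert (L2 : gint a (INR n) / p - INR (fact n) / prod_f_R0 (fun k => a + 1 + INR k) n
       <= exp 1 * INR n * (gint (a + 2) (INR n) / Rpower (INR n) (a + 2 + 1))).
    { rewrite <- (is_RInt_unique _ _ _ _ H4 : RInt _ 0 1 = gint a (INR n) / p - INR (fact n) / prod_f_R0 (fun k => a + 1 + INR k) n).
      rewrite <- (is_RInt_unique _ _ _ _ H3 : RInt _ 0 1 = exp 1 * INR n * (gint (a + 2) (INR n) / Rpower (INR n) (a + 2 + 1))).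
      apply RInt_le; [lra|eexists; exact H4|eexists; exact H3|]. intros s Hs. apply Hd; lra. }
    replace (a + 2 + 1) with (a + 1 + INR 2) in L2 by (simpl; ring).
    rewrite Rpower_plus, Rpower_pow in L2 by lra. fold p in L2.
    assert (L3 : gint (a + 2) (INR n) <= GI (a + 2)) by (apply GI_spec; lra).
    unfold euler. fold p.
    set (e := INR (fact n) / prod_f_R0 (fun k => a + 1 + INR k) n) in *.
    replace (INR (fact n) * p / prod_f_R0 (fun k => a + 1 + INR k) n) with (p * e) by (unfold e, Rdiv; ring).
    replace (gint a (INR n)) with (p * (gint a (INR n) / p)) by (field; lra).
    apply (Rmult_le_compat_l p) in L2; [|lra]. apply (Rmult_le_compat_l p) in L1; [|lra].
    replace (p * (exp 1 * INR n * (gint (a + 2) (INR n) / (p * INR n ^ 2))))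
      with (exp 1 * / INR n * gint (a + 2) (INR n)) in L2 by (field; lra).
    assert (exp 1 * / INR n * gint (a + 2) (INR n) <= exp 1 * / INR n * GI (a + 2)).
    { apply Rmult_le_compat_l; [|assumption]. apply Rmult_le_pos; [left; apply exp_pos|].
      left; now apply Rinv_0_lt_compat. }
    split; lra.
  - replace (Finite (GI a)) with (Finite (GI a - 0)) by (f_equal; ring). apply is_lim_seq_minus'; assumption.
  - exact Hg.
Qed.

Lemma Gamma_GI (a : R) : 0 < a -> Gamma (a + 1) = GI a.
Proof. intros Ha. now apply Gamma_euler, euler_cv_GI. Qed.

(** The functional equation on the level of Euler's terms. It carries convergence one unit to the
    left, and thereby to negative non-integers. *)
Lemma euler_shift (x l : R) : (forall k, x + INR k <> 0) ->
  is_lim_seq (euler (x + 1)) l -> is_lim_seq (euler x) (l / x).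
Proof.
  intros Hx Hl.
  apply is_lim_seq_ext_loc with (fun n => euler (x + 1) n * ((x + 1) * / INR n + 1) * / x).
  - exists 1%nat. intros n Hn. assert (Hn' : 0 < INR n) by (apply lt_0_INR; lia).
    unfold euler.
    assert (E : prod_f_R0 (fun k => x + 1 + INR k) n * x = prod_f_R0 (fun k => x + INR k) n * (x + 1 + INR n)).
    { transitivity (prod_f_R0 (fun k => x + INR k) (S n)).
      - rewrite prod_f_R0_shift. simpl (INR 0). rewrite Rplus_0_r, Rmult_comm. f_equal.
        apply prod_f_R0_ext. intros k. rewrite S_INR. ring.
      - change (prod_f_R0 (fun k => x + INR k) n * (x + INR (S n)) = prod_f_R0 (fun k => x + INR k) n * (x + 1 + INR n)).
        rewrite S_INR. ring. }
    assert (Hx0 : x <> 0) by (generalize (Hx 0%nat); simpl; now rewrite Rplus_0_r).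
    assert (N1 := prod_f_R0_neq0 _ n Hx).
    assert (N2 : prod_f_R0 (fun k => x + 1 + INR k) n <> 0).
    { apply prod_f_R0_neq0. intros k. replace (x + 1 + INR k) with (x + INR (S k)) by (rewrite S_INR; ring). apply Hx. }
    rewrite Rpower_plus, Rpower_1 by assumption.
    apply (Rmult_eq_reg_r (prod_f_R0 (fun k => x + 1 + INR k) n * x)); [|now apply Rmult_integral_contrapositive_currified].
    rewrite E at 2. field. repeat split; try assumption; lra.
  - replace (Finite (l / x)) with (Finite (l * ((x + 1) * 0 + 1) * / x)) by (f_equal; unfold Rdiv; ring).
    apply is_lim_seq_mult'; [|apply is_lim_seq_const].
    apply is_lim_seq_mult'; [assumption|]. apply is_lim_seq_plus'; [|apply is_lim_seq_const].
    apply is_lim_seq_mult'; [apply is_lim_seq_const|apply is_lim_seq_inv_INR].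
Qed.

Lemma euler_cv (x : R) : (forall k, x + INR k <> 0) ->
  is_lim_seq (euler x) (Gamma x) /\ Gamma x <> 0.
Proof.
  intros Hx.
  (* Induction on the number of unit shifts that bring [x] to the half-line x > 1, where the limit
     is [GI (x - 1)]. *)
  assert (H : forall m x, 1 - INR m < x -> (forall k, x + INR k <> 0) ->
     exists l : R, is_lim_seq (euler x) l /\ l <> 0).
  { clear. induction m as [|m IH]; intros x Hm Hx.
    - exists (GI (x - 1)). simpl in Hm. split; [|apply Rgt_not_eq, GI_pos; lra].
      replace x with (x - 1 + 1) at 1 by ring. apply euler_cv_GI. lra.
    - rewrite S_INR in Hm. destruct (IH (x + 1)) as [l [Hl Hl0]]; [lra| |].
      + intros k. replace (x + 1 + INR k) with (x + INR (S k)) by (rewrite S_INR; ring). apply Hx.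
      + exists (l / x). split; [now apply euler_shift|].
        assert (Hx0 : x <> 0) by (generalize (Hx 0%nat); simpl; now rewrite Rplus_0_r).
        apply Rmult_integral_contrapositive_currified; [assumption|now apply Rinv_neq_0_compat]. }
  destruct (nfloor_ex (Rabs (1 - x)) (Rabs_pos _)) as [m [_ Hm]].
  destruct (H (S m) x) as [l [Hl Hl0]].
  - rewrite S_INR. generalize (Rle_abs (1 - x)). lra.
  - assumption.
  - now rewrite (Gamma_euler _ _ Hl).
Qed.

Lemma Gamma_S (x : R) : (forall k, x + INR k <> 0) -> Gamma (x + 1) = x * Gamma x.
Proof.
  intros Hx. destruct (euler_cv (x + 1)) as [H _].
  - intros k. replace (x + 1 + INR k) with (x + INR (S k)) by (rewrite S_INR; ring). apply Hx.
  - rewrite (Gamma_euler _ _ (euler_shift _ _ Hx H)). field.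
    generalize (Hx 0%nat); simpl; now rewrite Rplus_0_r.
Qed.

Lemma Gamma_pos (x : R) : 0 < x -> 0 < Gamma x.
Proof.
  intros Hx. assert (H : forall k, x + INR k <> 0) by (intros k; generalize (pos_INR k); lra).
  assert (E := Gamma_S x H). rewrite Gamma_GI in E by assumption.
  assert (HG := GI_pos x Hx). apply Rmult_lt_reg_l with x; lra.
Qed.

(** * The entire exponential integral and Euler's constant *)

Definition expc (k : nat) : R := (-1) ^ k / INR (fact k).

Lemma Rabs_m1_pow (k : nat) : Rabs ((-1) ^ k) = 1.
Proof. rewrite <- RPow_abs. replace (Rabs (-1)) with 1 by (rewrite Rabs_left; lra). apply pow1. Qed.

Lemma entire_exp : entire (fun k => / INR (fact k)).
Proof.
  apply entire_ratio.
  - intros n. apply Rinv_neq_0_compat, INR_fact_neq_0.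
  - apply is_lim_seq_ext with (fun n => / INR (S n)).
    + intros n. rewrite fact_simpl, mult_INR, Rabs_pos_eq.
      * field. split; [apply INR_fact_neq_0|apply not_0_INR; lia].
      * assert (0 < INR (fact n)) by apply INR_fact_lt_0.
        assert (0 < INR (S n)) by (apply lt_0_INR; lia).
        apply Rdiv_le_0_compat; [left; apply Rinv_0_lt_compat; nra|now apply Rinv_0_lt_compat].
    + apply (is_lim_seq_incr_1 (fun n => / INR n)), is_lim_seq_inv_INR.
Qed.

Lemma entire_expc : entire expc.
Proof.
  apply entire_le with (fun k => / INR (fact k)) 1; [|apply entire_exp].
  intros n. unfold expc, Rdiv. rewrite Rabs_mult, Rabs_m1_pow. lra.
Qed.

Lemma PSeries_expc (t : R) : PSeries expc t = exp (- t).
Proof.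
  rewrite exp_Reals. apply Series_ext. intros n. unfold expc.
  replace (- t) with (-1 * t) by ring. rewrite Rpow_mult_distr. unfold Rdiv; ring.
Qed.

(** Coefficients of (1 - exp(-t)) / t, so that [Ein] below is its integral from 0. *)
Definition e1c (k : nat) : R := - expc (S k).

Lemma entire_e1c : entire e1c.
Proof.
  apply entire_le with (fun k => / INR (fact k)) 1; [|apply entire_exp].
  intros n. unfold e1c, expc, Rdiv. rewrite Rabs_Ropp, Rabs_mult, Rabs_m1_pow.
  rewrite !Rmult_1_l. assert (0 < INR (fact n)) by apply INR_fact_lt_0.
  rewrite !Rabs_pos_eq by (left; apply Rinv_0_lt_compat, INR_fact_lt_0).
  apply Rinv_le_contravar; [assumption|]. apply le_INR, fact_le. lia.
Qed.

Lemma e1c_mult (t : R) : t * PSeries e1c t = 1 - exp (- t).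
Proof.
  rewrite <- PSeries_expc.
  rewrite (PSeries_decr_1 expc) by apply CV_disk_correct, entire_expc.
  replace (PSeries e1c t) with (- PSeries (PS_decr_1 expc) t).
  - replace (expc 0%nat) with 1 by (unfold expc; simpl; field). ring.
  - unfold PSeries. rewrite <- Series_opp. apply Series_ext. intros n. unfold e1c, PS_decr_1. ring.
Qed.

Lemma e1c_0 : PSeries e1c 0 = 1.
Proof. rewrite PSeries_0. unfold e1c, expc. simpl. field. Qed.

Definition Ein (t : R) : R := PSeries (PS_Int e1c) t.

Lemma Ein_0 : Ein 0 = 0.
Proof. unfold Ein. now rewrite PSeries_0. Qed.

Lemma is_derive_Ein (t : R) : is_derive Ein t (PSeries e1c t).
Proof.
  eapply is_derive_replace; [apply is_derive_entire, entire_Int, entire_e1c|].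
  apply Series_ext. intros n. unfold PS_derive, PS_Int. f_equal. field. apply not_0_INR. lia.
Qed.

Lemma continuous_Ein (t : R) : continuous Ein t.
Proof. apply (ex_derive_continuous Ein). eexists. apply is_derive_Ein. Qed.

(** The derivative of Ein w - ln w is - exp(-w) / w, and exp(-w) <= 1 / w. *)
Lemma ex_lim_Ein : exists l : R, is_lim (fun w => Ein w - ln w) p_infty l.
Proof.
  apply is_lim_derive_bound with (fun w => PSeries e1c w - / w) 1.
  - intros x Hx. apply (is_derive_minus Ein ln); [apply is_derive_Ein|].
    apply is_derive_Reals, derivable_pt_lim_ln. lra.
  - intros x Hx. replace (PSeries e1c x) with ((1 - exp (- x)) / x).
    2: { rewrite <- e1c_mult. field. lra. }
    replace ((1 - exp (- x)) / x - / x) with (- (exp (- x) / x)) by (field; lra).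
    rewrite Rabs_Ropp, Rabs_pos_eq.
    2: { apply Rdiv_le_0_compat; [left; apply exp_pos|lra]. }
    rewrite exp_Ropp. assert (H := exp_ineq1_le x).
    replace (1 / x ^ 2) with (/ x / x) by (field; lra).
    apply Rmult_le_compat_r; [left; apply Rinv_0_lt_compat; lra|]. apply Rinv_le_contravar; lra.
Qed.

(** Euler's constant, introduced through the growth of [Ein] because this is how the Laplace average
    delivers it; [harm_lim] recovers the usual description. *)
Definition egamma : R := real (Lim (fun w => Ein w - ln w) p_infty).

Lemma egamma_spec : is_lim (fun w => Ein w - ln w) p_infty egamma.
Proof.
  destruct ex_lim_Ein as [l Hl]. unfold egamma. rewrite (is_lim_unique _ _ _ Hl). exact Hl.
Qed.

(** The harmonic number of index m + 1, since [sum_f_R0] includes both ends. *)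
Definition harm (m : nat) : R := sum_f_R0 (fun j => / INR (S j)) m.

Lemma is_RInt_harm (m : nat) : is_RInt (fun s => sum_f_R0 (fun j => (1 - s) ^ j) m) 0 1 (harm m).
Proof.
  assert (H : forall j, is_RInt (fun s => (1 - s) ^ j) 0 1 (/ INR (S j))).
  { intros j. assert (Hj : INR (S j) <> 0) by (apply not_0_INR; lia).
    replace (/ INR (S j)) with (- (1 - 1) ^ S j / INR (S j) - - (1 - 0) ^ S j / INR (S j)).
    2: { rewrite Rminus_diag, Rminus_0_r, pow1, pow_ne_zero by lia. field; assumption. }
    apply (is_RInt_derive (V := R_CompleteNormedModule) (fun s => - (1 - s) ^ S j / INR (S j))).
    - intros s _. auto_derive; [exact I|].
      change (- (- (1) * (INR (S j) * (1 - s) ^ j)) * / INR (S j) = (1 - s) ^ j). field; assumption.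
    - intros s _. apply (ex_derive_continuous (fun s => (1 - s) ^ j)). auto_derive. exact I. }
  unfold harm. induction m as [|m IH]; simpl sum_f_R0; [apply (H 0%nat)|].
  apply is_RInt_Rplus; [exact IH|apply (H (S m))].
Qed.

Lemma geom_sum_mult (s : R) (m : nat) : s * sum_f_R0 (fun j => (1 - s) ^ j) m = 1 - (1 - s) ^ S m.
Proof.
  induction m as [|m IH]; [simpl; ring|].
  change (sum_f_R0 (fun j => (1 - s) ^ j) (S m)) with (sum_f_R0 (fun j => (1 - s) ^ j) m + (1 - s) ^ S m).
  rewrite Rmult_plus_distr_l, IH. simpl. ring.
Qed.

(** With n = m + 1, both quantities are integrals over [0, 1]: of (1 - (1 - s)^n) / s for [harm m]
    and of (1 - exp(-n s)) / s for [Ein n]. Dividing the estimate of [exp_pow_diff] by s leaves a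
    Gamma integral of size O(1/n). *)
Lemma harm_Ein (m : nat) : Rabs (harm m - Ein (INR (S m))) <= exp 1 * GI 1 * / INR (S m).
Proof.
  set (n := INR (S m)). assert (Hn : 0 < n) by (apply lt_0_INR; lia).
  assert (HE : is_RInt (fun s => n * PSeries e1c (n * s + 0)) 0 1 (Ein n - 0)).
  { replace (Ein n - 0) with (Ein (n * 1 + 0) - Ein (n * 0 + 0)).
    2: { rewrite Rmult_0_r, Rmult_1_r, !Rplus_0_r, Ein_0. reflexivity. }
    apply (is_RInt_derive (V := R_CompleteNormedModule) (fun s => Ein (n * s + 0))).
    - intros s _. eapply is_derive_replace.
      + apply (is_derive_comp Ein (fun s => n * s + 0)); [apply is_derive_Ein|].
        auto_derive; [exact I|reflexivity].
      + change (n * 1 * PSeries e1c (n * s + 0) = n * PSeries e1c (n * s + 0)). ring.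
    - intros s _. apply continuous_Rmult; [apply continuous_const|].
      apply (continuous_comp (fun s => n * s + 0) (PSeries e1c)).
      + apply (ex_derive_continuous (fun s => n * s + 0)). auto_derive. exact I.
      + apply continuous_entire, entire_e1c. }
  assert (HD := is_RInt_Rminus (is_RInt_harm m) HE).
  assert (HB := is_RInt_pw_exp_scaled 1 (S m) ltac:(lra) ltac:(lia)). fold n in HB.
  apply (is_RInt_scal (V := R_NormedModule) _ _ _ (exp 1 * n)) in HB.
  assert (Hd : forall s, 0 < s < 1 ->
    Rabs (sum_f_R0 (fun j => (1 - s) ^ j) m - n * PSeries e1c (n * s + 0)) <= exp 1 * n * (pw 1 s * exp (- (n * s)))).
  { intros s Hs. rewrite pw_1 by lra. apply Rmult_le_reg_l with s; [lra|].
    rewrite <- (Rabs_pos_eq s) at 1 by lra. rewrite <- Rabs_mult, Rmult_minus_distr_l, geom_sum_mult, Rplus_0_r.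
    replace (s * (n * PSeries e1c (n * s))) with (n * s * PSeries e1c (n * s)) by ring.
    rewrite e1c_mult. destruct (exp_pow_diff s (S m)) as [D1 D2]; [lra|]. fold n in D1, D2.
    replace (1 - (1 - s) ^ S m - (1 - exp (- (n * s)))) with (exp (- (n * s)) - (1 - s) ^ S m) by ring.
    rewrite Rabs_pos_eq by assumption. eapply Rle_trans; [exact D2|]. right. ring. }
  apply Rle_trans with (exp 1 * n * (gint 1 n / Rpower n (1 + 1))).
  - replace (harm m - Ein n) with (harm m - (Ein n - 0)) by ring.
    rewrite <- (is_RInt_unique _ _ _ _ HD : RInt _ 0 1 = harm m - (Ein n - 0)).
    rewrite <- (is_RInt_unique _ _ _ _ HB : RInt _ 0 1 = exp 1 * n * (gint 1 n / Rpower n (1 + 1))).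
    apply Rabs_le_between. split.
    + rewrite <- (RInt_opp (V := R_CompleteNormedModule)) by (eexists; exact HB).
      apply RInt_le; [lra| |eexists; exact HD|].
      * apply (ex_RInt_opp (V := R_NormedModule)). eexists; exact HB.
      * intros s Hs. specialize (Hd s Hs). apply Rabs_le_between in Hd. apply Hd.
    + apply RInt_le; [lra|eexists; exact HD|eexists; exact HB|].
      intros s Hs. specialize (Hd s Hs). apply Rabs_le_between in Hd. apply Hd.
  - rewrite Rpower_plus, Rpower_1 by assumption.
    replace (exp 1 * n * (gint 1 n / (n * n))) with (exp 1 * gint 1 n * / n) by (field; lra).
    apply Rmult_le_compat_r; [left; now apply Rinv_0_lt_compat|].
    apply Rmult_le_compat_l; [left; apply exp_pos|]. apply GI_spec; lra.
Qed.

Lemma harm_lim : is_lim_seq (fun m => harm m - ln (INR (S m))) egamma.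
Proof.
  assert (H1 : is_lim_seq (fun m => Ein (INR (S m)) - ln (INR (S m))) egamma).
  { apply (is_lim_seq_incr_1 (fun m => Ein (INR m) - ln (INR m))).
    apply (is_lim_comp_seq (fun w => Ein w - ln w) INR p_infty egamma).
    - apply egamma_spec.
    - exists 0%nat. intros; discriminate.
    - apply is_lim_seq_INR. }
  assert (H2 : is_lim_seq (fun m => exp 1 * GI 1 * / INR (S m)) 0).
  { replace (Finite 0) with (Rbar_mult (exp 1 * GI 1) 0) by (simpl; f_equal; ring).
    apply is_lim_seq_scal_l. apply (is_lim_seq_incr_1 (fun m => / INR m)), is_lim_seq_inv_INR. }
  apply is_lim_seq_le_le with
    (fun m => Ein (INR (S m)) - ln (INR (S m)) - exp 1 * GI 1 * / INR (S m))
    (fun m => Ein (INR (S m)) - ln (INR (S m)) + exp 1 * GI 1 * / INR (S m)).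
  - intros m. assert (H := harm_Ein m). apply Rabs_le_between in H. lra.
  - replace (Finite egamma) with (Finite (egamma - 0)) by (f_equal; ring). now apply is_lim_seq_minus'.
  - replace (Finite egamma) with (Finite (egamma + 0)) by (f_equal; ring). now apply is_lim_seq_plus'.
Qed.

Lemma is_lim_scale (f : R -> R) (c : R) (l : Rbar) : 0 < c ->
  is_lim f p_infty l -> is_lim (fun x => f (c * x)) p_infty l.
Proof.
  intros Hc Hf. apply (is_lim_comp f (fun x => c * x) p_infty l p_infty); [assumption| |].
  - replace p_infty with (Rbar_mult (Finite c) p_infty) at 2.
    + apply is_lim_scal_l, is_lim_id.
    + unfold Rbar_mult, Rbar_mult'. destruct (Rle_dec 0 c) as [H|H]; [|exfalso; lra].
      destruct (Rle_lt_or_eq_dec 0 c H); [reflexivity|exfalso; lra].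
  - exists 0. intros; discriminate.
Qed.

(** Integration by parts gives the explicit antiderivative in [HI]. Its boundary term with exp(-T)
    vanishes at infinity, and the Frullani difference Ein((1 + y) T) - Ein T tends to ln(1 + y), the
    two constants [egamma] cancelling. *)
Lemma Ein_laplace (y : R) : 0 < y ->
  is_lim (fun T => RInt (fun t => exp (- t) * Ein (y * t)) 0 T) p_infty (ln (1 + y)).
Proof.
  intros Hy.
  assert (HI : forall T, 0 <= T -> RInt (fun t => exp (- t) * Ein (y * t)) 0 T =
    - exp (- T) * Ein (y * T) + Ein ((1 + y) * T) - Ein T).
  { intros T HT. apply is_RInt_unique.
    replace (- exp (- T) * Ein (y * T) + Ein ((1 + y) * T) - Ein T) with
      ((- exp (- T) * Ein (y * T) + Ein ((1 + y) * T) - Ein T) -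
       (- exp (- 0) * Ein (y * 0) + Ein ((1 + y) * 0) - Ein 0)).
    2: { rewrite !Rmult_0_r, Ein_0. ring. }
    assert (Hlin : forall c t, is_derive (fun t => Ein (c * t)) t (c * PSeries e1c (c * t))).
    { intros c t. eapply is_derive_replace.
      - apply (is_derive_comp Ein (fun s => c * s)); [apply is_derive_Ein|].
        auto_derive; [exact I|reflexivity].
      - change (c * 1 * PSeries e1c (c * t) = c * PSeries e1c (c * t)). ring. }
    apply (is_RInt_derive (V := R_CompleteNormedModule)
      (fun T => - exp (- T) * Ein (y * T) + Ein ((1 + y) * T) - Ein T)).
    - intros t _. eapply is_derive_replace.
      + apply (is_derive_minus (fun T => - exp (- T) * Ein (y * T) + Ein ((1 + y) * T)) Ein).
        * apply (is_derive_plus (fun T => - exp (- T) * Ein (y * T)) (fun T => Ein ((1 + y) * T))).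
          -- apply (is_derive_mult (fun T => - exp (- T)) (fun T => Ein (y * T))); [|apply Hlin|intros; apply Rmult_comm].
             instantiate (1 := exp (- t)). auto_derive; [exact I|ring].
          -- apply Hlin.
        * apply is_derive_Ein.
      + change (exp (- t) * Ein (y * t) + - exp (- t) * (y * PSeries e1c (y * t)) +
          (1 + y) * PSeries e1c ((1 + y) * t) - PSeries e1c t = exp (- t) * Ein (y * t)).
        assert (E : exp (- t) * (y * PSeries e1c (y * t)) = (1 + y) * PSeries e1c ((1 + y) * t) - PSeries e1c t).
        { destruct (Req_dec t 0) as [->|Ht].
          - rewrite !Rmult_0_r, e1c_0, Ropp_0, exp_0. ring.
          - apply (Rmult_eq_reg_l t); [|assumption].
            replace (t * (exp (- t) * (y * PSeries e1c (y * t)))) with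
              (exp (- t) * (y * t * PSeries e1c (y * t))) by ring.
            replace (t * ((1 + y) * PSeries e1c ((1 + y) * t) - PSeries e1c t)) with
              ((1 + y) * t * PSeries e1c ((1 + y) * t) - t * PSeries e1c t) by ring.
            rewrite !e1c_mult. replace (- ((1 + y) * t)) with (- t + - (y * t)) by ring.
            rewrite exp_plus. ring. }
        lra.
    - intros t _. apply continuous_Rmult; [apply continuous_exp_opp|].
      apply (ex_derive_continuous (fun t => Ein (y * t))). eexists. apply Hlin. }
  apply is_lim_ext_loc with (fun T => - (exp (- T) * Ein (y * T)) +
     ((Ein ((1 + y) * T) - ln ((1 + y) * T)) - (Ein T - ln T) + ln (1 + y))).
  { exists 0. intros T HT. rewrite HI by lra. rewrite ln_mult by lra. ring. }
  replace (Finite (ln (1 + y))) with (Finite (- 0 + ((egamma - egamma) + ln (1 + y)))) by (f_equal; ring).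
  apply is_lim_plus'.
  - apply (is_lim_opp (fun T => exp (- T) * Ein (y * T)) p_infty 0).
    apply is_lim_squeeze0 with (fun T => y * (pw 1 T * exp (- T))) 0.
    + intros T HT. rewrite pw_1 by assumption.
      assert (HE : 0 <= Ein (y * T) <= y * T).
      { assert (HT' : 0 <= y * T) by nra.
        destruct (MVT_gen Ein 0 (y * T) (PSeries e1c)) as [c [Hc1 Hc2]].
        - intros x _. apply is_derive_Ein.
        - intros x _. apply continuity_pt_filterlim, continuous_Ein.
        - rewrite Ein_0, !Rminus_0_r in Hc2. rewrite Rmin_left, Rmax_right in Hc1 by assumption.
          assert (Hc : 0 <= PSeries e1c c <= 1).
          { destruct (Req_dec c 0) as [->|Hc0]; [rewrite e1c_0; lra|].
            assert (E := e1c_mult c). assert (Hx := exp_ineq1_le (- c)).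
            assert (exp (- c) <= 1).
            { rewrite <- exp_0. left. apply exp_increasing. lra. }
            split; apply Rmult_le_reg_l with c; lra. }
          rewrite Hc2. nra. }
      assert (0 < exp (- T)) by apply exp_pos. rewrite Rabs_pos_eq by nra. nra.
    + replace (Finite 0) with (Rbar_mult y 0) by (simpl; f_equal; ring).
      apply is_lim_scal_l, pw_exp_lim. lra.
  - apply is_lim_plus'; [|apply is_lim_const]. apply is_lim_minus'; [|apply egamma_spec].
    apply (is_lim_scale (fun w => Ein w - ln w)); [lra|apply egamma_spec].
Qed.

(** * Trigonometric moments and the reflection formula *)

Fixpoint poch (a : R) (k : nat) : R :=
  match k with
  | O => 1
  | S j => poch a j * (a + INR j)
  end.

Lemma is_RInt_Rderive (F f : R -> R) (a b : R) :
  (forall x, is_derive F x (f x)) -> (forall x, continuous f x) -> is_RInt f a b (F b - F a).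
Proof.
  intros H1 H2. apply (is_RInt_derive (V := R_CompleteNormedModule) F f); intros x _; auto.
Qed.

Lemma is_RInt_replace (f : R -> R) (a b l l' : R) : is_RInt f a b l -> l = l' -> is_RInt f a b l'.
Proof. intros H <-. exact H. Qed.

Ltac solve_continuous := match goal with |- continuous ?f _ => apply (ex_derive_continuous f); auto_derive; repeat split; auto end.

(** For b = 2 nu these are the moments attached to J_nu J_{-nu}; for b = 0 they are Wallis'
    integrals, which serve as the term of comparison. *)
Definition trigI (b : R) (k : nat) : R :=
  RInt (fun p => sin p ^ (2 * k) * cos (b * (PI / 2 - p))) 0 (PI / 2).

Lemma is_trigI (b : R) (k : nat) :
  is_RInt (fun p => sin p ^ (2 * k) * cos (b * (PI / 2 - p))) 0 (PI / 2) (trigI b k).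
Proof.
  apply (RInt_correct (V := R_CompleteNormedModule)).
  apply (ex_RInt_continuous (V := R_CompleteNormedModule)). intros x _. solve_continuous.
Qed.

Lemma trigI_0 (b : R) : b <> 0 -> trigI b 0 = sin (b * (PI / 2)) / b.
Proof.
  intros Hb. apply is_RInt_unique.
  replace (sin (b * (PI / 2)) / b) with (- sin (b * (PI / 2 - PI / 2)) / b - - sin (b * (PI / 2 - 0)) / b).
  2: { rewrite Rminus_diag, Rmult_0_r, sin_0, Rminus_0_r. field. assumption. }
  apply (is_RInt_Rderive (fun p => - sin (b * (PI / 2 - p)) / b)).
  - intros x. auto_derive; [exact I|]. simpl. unfold Rminus, Rdiv. field. assumption.
  - intros x. solve_continuous.
Qed.

Lemma trigI_00 : trigI 0 0 = PI / 2.
Proof.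
  apply is_RInt_unique. apply (is_RInt_replace _ _ _ (PI / 2 - 0)); [|ring].
  apply (is_RInt_Rderive (fun p => p)).
  - intros x. auto_derive; [exact I|]. rewrite Rmult_0_l, cos_0. simpl. ring.
  - intros x. solve_continuous.
Qed.

Lemma trigI_S (b : R) (k : nat) :
  (INR (S k) ^ 2 - b ^ 2 / 4) * trigI b (S k) = INR (S k) * (INR k + 1 / 2) * trigI b k.
Proof.
  set (n := INR (S k)).
  (* The boundary terms of two integrations by parts, merged into one antiderivative. It vanishes at
     0 because of the sines, and at PI / 2 because both cos p and sin(b (PI / 2 - p)) do. *)
  set (F := fun p => 2 * n * (sin p ^ (2 * k + 1) * cos p * cos (b * (PI / 2 - p)))
     - b * (sin p ^ (2 * k + 2) * sin (b * (PI / 2 - p)))).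
  assert (HS : forall m p, is_derive (fun p => sin p ^ m) p (INR m * (cos p * sin p ^ (pred m)))).
  { intros m p. auto_derive; [exact I|ring]. }
  assert (H : is_RInt (fun p => 2 * n * (2 * INR k + 1) * (sin p ^ (2 * k) * cos (b * (PI / 2 - p)))
     - (4 * n ^ 2 - b ^ 2) * (sin p ^ (2 * S k) * cos (b * (PI / 2 - p)))) 0 (PI / 2) (F (PI / 2) - F 0)).
  { apply is_RInt_Rderive.
    - intros p. unfold F. eapply is_derive_replace.
      + apply (is_derive_minus
          (fun p => 2 * n * (sin p ^ (2 * k + 1) * cos p * cos (b * (PI / 2 - p))))
          (fun p => b * (sin p ^ (2 * k + 2) * sin (b * (PI / 2 - p))))).
        * apply is_derive_scal.
          apply (is_derive_mult (fun p => sin p ^ (2 * k + 1) * cos p) (fun p => cos (b * (PI / 2 - p)))).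
          -- apply (is_derive_mult (fun p => sin p ^ (2 * k + 1)) cos); [apply HS| |intros; apply Rmult_comm].
             instantiate (1 := - sin p). apply is_derive_cos.
          -- instantiate (1 := b * sin (b * (PI / 2 - p))). auto_derive; [exact I|]. unfold Rminus; ring.
          -- intros; apply Rmult_comm.
        * apply is_derive_scal.
          apply (is_derive_mult (fun p => sin p ^ (2 * k + 2)) (fun p => sin (b * (PI / 2 - p)))); [apply HS| |intros; apply Rmult_comm].
          instantiate (1 := - b * cos (b * (PI / 2 - p))). auto_derive; [exact I|]. unfold Rminus; ring.
      + replace (2 * k + 1)%nat with (S (2 * k)) by lia. replace (2 * k + 2)%nat with (S (S (2 * k))) by lia.
        replace (2 * S k)%nat with (S (S (2 * k))) by lia.
        replace n with (INR k + 1) by (unfold n; rewrite S_INR; reflexivity).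
        rewrite !S_INR, mult_INR. change (INR 2) with 2. simpl pred.
        set (s := sin p). set (c := cos p). set (C := cos (b * (PI / 2 - p))). set (S' := sin (b * (PI / 2 - p))).
        change (2 * (INR k + 1) * (((2 * INR k + 1) * (c * s ^ (2 * k)) * c + s ^ S (2 * k) * - s) * C
           + s ^ S (2 * k) * c * (b * S')) - b * ((2 * INR k + 1 + 1) * (c * s ^ S (2 * k)) * S' + s ^ S (S (2 * k)) * (- b * C))
           = 2 * (INR k + 1) * (2 * INR k + 1) * (s ^ (2 * k) * C) - (4 * (INR k + 1) ^ 2 - b ^ 2) * (s ^ S (S (2 * k)) * C)).
        rewrite <- !tech_pow_Rmult.
        assert (Hc : c * c = 1 - s * s) by (generalize (sin2_cos2 p); unfold Rsqr; fold s c; lra).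
        replace ((2 * INR k + 1) * (c * s ^ (2 * k)) * c) with ((2 * INR k + 1) * s ^ (2 * k) * (c * c)) by ring.
        rewrite Hc. ring.
    - intros p. solve_continuous. }
  assert (H1 := is_RInt_Rscal (2 * n * (2 * INR k + 1)) (is_trigI b k)).
  assert (H2 := is_RInt_Rscal (4 * n ^ 2 - b ^ 2) (is_trigI b (S k))).
  assert (H3 := is_RInt_Rminus H1 H2).
  apply is_RInt_Runique in H.
  apply is_RInt_Runique in H3.
  assert (E : F (PI / 2) - F 0 = 2 * n * (2 * INR k + 1) * trigI b k - (4 * n ^ 2 - b ^ 2) * trigI b (S k)).
  { rewrite <- H. exact H3. }
  replace (F (PI / 2) - F 0) with 0 in E; [lra|].
  unfold F. replace (b * (PI / 2 - PI / 2)) with 0 by ring.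
  rewrite cos_PI2, sin_0, !pow_ne_zero by lia. ring.
Qed.

Lemma sin_PI_neq0 (nu : R) : (forall m : Z, nu <> IZR m) -> sin (PI * nu) <> 0.
Proof.
  intros H E. destruct (sin_eq_0_0 _ E) as [m Hm]. apply (H m).
  apply (Rmult_eq_reg_l PI); [|apply PI_neq0]. rewrite Hm. ring.
Qed.

Lemma trigI_poch (nu : R) (k : nat) : (forall m : Z, nu <> IZR m) ->
  trigI (2 * nu) k * (poch (1 - nu) k * poch (1 + nu) k) =
  sin (PI * nu) / (2 * nu) * (INR (fact k) * poch (1 / 2) k).
Proof.
  intros Hnu. assert (Hnu0 := Hnu 0%Z).
  induction k as [|k IH].
  - rewrite trigI_0 by lra. simpl. replace (2 * nu * (PI / 2)) with (PI * nu) by field. field. lra.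
  - assert (E := trigI_S (2 * nu) k).
    replace (INR (S k) ^ 2 - (2 * nu) ^ 2 / 4) with ((1 - nu + INR k) * (1 + nu + INR k)) in E
      by (rewrite S_INR; field).
    rewrite fact_simpl, mult_INR. simpl poch.
    transitivity (INR (S k) * (INR k + 1 / 2) * (trigI (2 * nu) k * (poch (1 - nu) k * poch (1 + nu) k))).
    + replace (INR (S k) * (INR k + 1 / 2) * (trigI (2 * nu) k * (poch (1 - nu) k * poch (1 + nu) k)))
        with (INR (S k) * (INR k + 1 / 2) * trigI (2 * nu) k * (poch (1 - nu) k * poch (1 + nu) k)) by ring.
      rewrite <- E. ring.
    + rewrite IH. ring.
Qed.

Lemma x_cos_le_sin (x : R) : 0 <= x <= PI / 2 -> 0 <= x * cos x <= sin x.
Proof.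
  intros Hx. assert (HP := PI_RGT_0). split.
  - apply Rmult_le_pos; [lra|]. apply cos_ge_0; lra.
  - destruct (MVT_gen (fun x => sin x - x * cos x) 0 x (fun x => x * sin x)) as [c [Hc1 Hc2]].
    + intros y _. auto_derive; [exact I|ring].
    + intros y _. apply continuity_pt_filterlim. change (continuous (fun x => sin x - x * cos x) y). solve_continuous.
    + rewrite Rmin_left, Rmax_right in Hc1 by lra. rewrite sin_0, cos_0 in Hc2.
      assert (0 <= sin c) by (apply sin_ge_0; lra).
      assert (0 <= c * sin c * (x - 0)) by (apply Rmult_le_pos; [apply Rmult_le_pos|]; lra). lra.
Qed.

Lemma one_minus_cos_le (x : R) : 0 <= 1 - cos x <= x ^ 2 / 2.
Proof.
  assert (Hs : forall y, 0 <= y -> sin y ^ 2 <= y ^ 2).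
  { intros y Hy. destruct (Rle_dec y 1) as [H|H].
    - rewrite <- !Rsqr_pow2. apply Rsqr_incr_1; [|apply sin_ge_0; generalize PI2_1; lra|assumption].
      destruct Hy as [Hy| <-]; [left; now apply sin_lt_x|rewrite sin_0; lra].
    - assert (H1 := SIN_bound y). nra. }
  assert (E : 1 - cos x = 2 * sin (x / 2) ^ 2).
  { replace x with (2 * (x / 2)) at 1 by field. rewrite cos_2a_sin. ring. }
  rewrite E. split; [nra|].
  destruct (Rle_dec 0 x) as [H|H].
  - specialize (Hs (x / 2) ltac:(lra)). nra.
  - specialize (Hs (- (x / 2)) ltac:(lra)). rewrite sin_neg in Hs. nra.
Qed.

Lemma trigI_0_pos (k : nat) : 0 < trigI 0 k.
Proof.
  assert (HP := PI_RGT_0).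
  induction k as [|k IH]; [rewrite trigI_00; lra|].
  assert (E := trigI_S 0 k). assert (Hk := pos_INR k). rewrite S_INR in E.
  assert (0 < (INR k + 1) * (INR k + 1 / 2) * trigI 0 k).
  { apply Rmult_lt_0_compat; [nra|assumption]. }
  apply Rmult_lt_reg_l with ((INR k + 1) ^ 2 - 0 ^ 2 / 4); [nra|]. rewrite E. lra.
Qed.

(* [sin^(2k)] concentrates at PI/2, where the cosine equals 1. *)
Lemma trigI_ratio (b : R) : is_lim_seq (fun k => trigI b k / trigI 0 k) 1.
Proof.
  assert (HP := PI_RGT_0). apply is_lim_seq_incr_1.
  apply is_lim_seq_le_le with (fun k => 1 - b ^ 2 / 2 * / INR (S k)) (fun k => 1).
  - intros k. assert (Hw := trigI_0_pos (S k)).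
    assert (H1 := is_RInt_Rminus (is_trigI 0 (S k)) (is_trigI b (S k))).
    assert (H2 := is_RInt_Rscal (b ^ 2 / 2)
      (is_RInt_Rminus (is_trigI 0 k) (is_trigI 0 (S k)))).
    (* With q = PI / 2 - p one has 1 - cos(b q) <= (b q)^2 / 2, and (q sin p)^2 <= cos(p)^2 by q <=
       tan q. Taking sin(p)^2 out of the power thus bounds the error by the difference of two
       consecutive Wallis integrals, which is a fraction 1 / (2 k + 1) of the later one. *)
    assert (Hd : forall p, 0 < p < PI / 2 ->
      0 <= sin p ^ (2 * S k) * cos (0 * (PI / 2 - p)) - sin p ^ (2 * S k) * cos (b * (PI / 2 - p)) <=
      b ^ 2 / 2 * (sin p ^ (2 * k) * cos (0 * (PI / 2 - p)) - sin p ^ (2 * S k) * cos (0 * (PI / 2 - p)))).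
    { intros p Hp. rewrite Rmult_0_l, cos_0.
      destruct (one_minus_cos_le (b * (PI / 2 - p))) as [D1 D2].
      assert (Hs : 0 <= sin p) by (apply sin_ge_0; lra).
      assert (Hs2 : 0 <= sin p ^ (2 * k)) by (now apply pow_le).
      replace (2 * S k)%nat with (2 + 2 * k)%nat by lia. rewrite pow_add.
      destruct (x_cos_le_sin (PI / 2 - p)) as [X1 X2]; [lra|]. rewrite cos_shift, sin_shift in *.
      assert (Hc : cos p ^ 2 = 1 - sin p ^ 2) by (generalize (sin2_cos2 p); unfold Rsqr; lra).
      assert (X3 : ((PI / 2 - p) * sin p) ^ 2 <= 1 - sin p ^ 2) by (rewrite <- Hc; apply pow_incr; lra).
      assert (X4 : sin p ^ 2 * (1 - cos (b * (PI / 2 - p))) <= b ^ 2 / 2 * (1 - sin p ^ 2)).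
      { apply Rle_trans with (sin p ^ 2 * ((b * (PI / 2 - p)) ^ 2 / 2)).
        - apply Rmult_le_compat_l; [apply pow2_ge_0|assumption].
        - replace (sin p ^ 2 * ((b * (PI / 2 - p)) ^ 2 / 2)) with (b ^ 2 / 2 * ((PI / 2 - p) * sin p) ^ 2) by field.
          apply Rmult_le_compat_l; [generalize (pow2_ge_0 b); lra|assumption]. }
      split.
      - replace (sin p ^ 2 * sin p ^ (2 * k) * 1 - sin p ^ 2 * sin p ^ (2 * k) * cos (b * (PI / 2 - p)))
          with (sin p ^ (2 * k) * (sin p ^ 2 * (1 - cos (b * (PI / 2 - p))))) by ring.
        apply Rmult_le_pos; [assumption|]. apply Rmult_le_pos; [apply pow2_ge_0|assumption].
      - apply (Rmult_le_compat_l _ _ _ Hs2) in X4. lra. }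
    assert (L1 : 0 <= trigI 0 (S k) - trigI b (S k)).
    { rewrite <- (is_RInt_unique _ _ _ _ H1 : RInt _ 0 (PI / 2) = trigI 0 (S k) - trigI b (S k)).
      apply RInt_ge_0; [lra|eexists; exact H1|]. intros s Hs. apply Hd; lra. }
    assert (L2 : trigI 0 (S k) - trigI b (S k) <= b ^ 2 / 2 * (trigI 0 k - trigI 0 (S k))).
    { rewrite <- (is_RInt_unique _ _ _ _ H1 : RInt _ 0 (PI / 2) = trigI 0 (S k) - trigI b (S k)).
      rewrite <- (is_RInt_unique _ _ _ _ H2 : RInt _ 0 (PI / 2) = b ^ 2 / 2 * (trigI 0 k - trigI 0 (S k))).
      apply RInt_le; [lra|eexists; exact H1|eexists; exact H2|]. intros s Hs. apply Hd; lra. }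
    assert (E := trigI_S 0 k). assert (Hk := pos_INR k). rewrite S_INR in *.
    set (w := trigI 0 (S k)) in *. set (w0 := trigI 0 k) in *. set (i := trigI b (S k)) in *.
    assert (E2 : w0 - w = w * ((1 / 2) / (INR k + 1 / 2))).
    { assert (w0 = w * ((INR k + 1) / (INR k + 1 / 2))); [|rewrite H; field; lra].
      apply (Rmult_eq_reg_l ((INR k + 1) * (INR k + 1 / 2))); [|apply Rgt_not_eq; nra].
      rewrite <- E. field. lra. }
    assert (E3 : (1 / 2) / (INR k + 1 / 2) <= / (INR k + 1)).
    { apply Rmult_le_reg_r with ((INR k + 1) * (INR k + 1 / 2)); [nra|]. field_simplify; nra. }
    split.
    + apply Rmult_le_reg_r with w; [assumption|]. replace (i / w * w) with i by (field; lra).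
      assert (b ^ 2 / 2 * (w0 - w) <= b ^ 2 / 2 * (w * / (INR k + 1))).
      { rewrite E2. apply Rmult_le_compat_l; [generalize (pow2_ge_0 b); lra|].
        apply Rmult_le_compat_l; [lra|assumption]. }
      lra.
    + apply Rmult_le_reg_r with w; [assumption|]. replace (i / w * w) with i by (field; lra). lra.
  - replace (Finite 1) with (Finite (1 - b ^ 2 / 2 * 0)) by (f_equal; ring).
    apply is_lim_seq_minus'; [apply is_lim_seq_const|].
    apply is_lim_seq_mult'; [apply is_lim_seq_const|].
    apply (is_lim_seq_incr_1 (fun n => / INR n)), is_lim_seq_inv_INR.
  - apply is_lim_seq_const.
Qed.

Lemma nonint_INR (nu : R) : (forall m : Z, nu <> IZR m) -> forall k, nu + INR k <> 0.
Proof.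
  intros H k E. apply (H (- Z.of_nat k)%Z). rewrite opp_IZR, <- INR_IZR_INZ. lra.
Qed.

(** By [trigI_S] the quotient [trigI (2 nu) k / trigI 0 k] telescopes into the product of the
    denominators of Euler's terms at 1 + nu and 1 - nu, starting from the value that contains sin(PI
    nu). Since the quotient tends to 1, Euler's product for the sine results. *)
Lemma Gamma_reflection (nu : R) : (forall m : Z, nu <> IZR m) ->
  Gamma (1 + nu) * Gamma (1 - nu) = PI * nu / sin (PI * nu).
Proof.
  intros Hnu. assert (Hs := sin_PI_neq0 nu Hnu). assert (HP := PI_RGT_0).
  assert (Hp : forall k, 1 + nu + INR k <> 0).
  { intros k. replace (1 + nu + INR k) with (nu + INR (S k)) by (rewrite S_INR; ring). now apply nonint_INR. }
  assert (Hm : forall k, 1 - nu + INR k <> 0).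
  { intros k E. apply (Hnu (Z.of_nat (S k))). rewrite <- INR_IZR_INZ, S_INR. lra. }
  destruct (euler_cv _ Hp) as [H1 _]. destruct (euler_cv _ Hm) as [H2 _].
  assert (Hnu0 := Hnu 0%Z).
  assert (E : forall n, (trigI (2 * nu) (S n) / trigI 0 (S n)) * (PI * nu) *
       (prod_f_R0 (fun k => 1 + nu + INR k) n * prod_f_R0 (fun k => 1 - nu + INR k) n)
       = sin (PI * nu) * INR (fact (S n)) ^ 2).
  { assert (Hr : forall n, trigI (2 * nu) (S n) / trigI 0 (S n) * ((1 + nu + INR n) * (1 - nu + INR n)) =
       trigI (2 * nu) n / trigI 0 n * INR (S n) ^ 2).
    { intros n. assert (E1 := trigI_S (2 * nu) n). assert (E2 := trigI_S 0 n).
      assert (W1 := trigI_0_pos n). assert (W2 := trigI_0_pos (S n)). assert (Hn := pos_INR n).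
      rewrite S_INR in *.
      apply (Rmult_eq_reg_r (trigI 0 n * trigI 0 (S n) * (INR n + 1 / 2))); [|apply Rgt_not_eq; repeat apply Rmult_lt_0_compat; lra].
      transitivity (((INR n + 1) ^ 2 - (2 * nu) ^ 2 / 4) * trigI (2 * nu) (S n) * (trigI 0 n * (INR n + 1 / 2))).
      { field. lra. }
      rewrite E1. transitivity (trigI (2 * nu) n * (INR n + 1 / 2) * (((INR n + 1) ^ 2 - 0 ^ 2 / 4) * trigI 0 (S n))).
      { rewrite E2. ring. } field. lra. }
    induction n as [|n IH].
    - assert (E0 := Hr 0%nat). rewrite trigI_00, (trigI_0 (2 * nu)) in E0 by lra.
      replace (2 * nu * (PI / 2)) with (PI * nu) in E0 by field.
      change (trigI (2 * nu) 1 / trigI 0 1 * (PI * nu) * ((1 + nu + INR 0) * (1 - nu + INR 0)) = sin (PI * nu) * INR (fact 1) ^ 2).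
      transitivity (trigI (2 * nu) 1 / trigI 0 1 * ((1 + nu + INR 0) * (1 - nu + INR 0)) * (PI * nu)); [ring|].
      rewrite E0. simpl. field. lra.
    - assert (E0 := Hr (S n)). rewrite fact_simpl, mult_INR.
      change (trigI (2 * nu) (S (S n)) / trigI 0 (S (S n)) * (PI * nu) *
        (prod_f_R0 (fun k => 1 + nu + INR k) n * (1 + nu + INR (S n)) *
        (prod_f_R0 (fun k => 1 - nu + INR k) n * (1 - nu + INR (S n)))) =
        sin (PI * nu) * (INR (S (S n)) * INR (fact (S n))) ^ 2).
      transitivity (trigI (2 * nu) (S (S n)) / trigI 0 (S (S n)) * ((1 + nu + INR (S n)) * (1 - nu + INR (S n)))
        * (PI * nu * (prod_f_R0 (fun k => 1 + nu + INR k) n * prod_f_R0 (fun k => 1 - nu + INR k) n))); [ring|].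
      rewrite E0.
      transitivity (INR (S (S n)) ^ 2 * (trigI (2 * nu) (S n) / trigI 0 (S n) * (PI * nu) *
       (prod_f_R0 (fun k => 1 + nu + INR k) n * prod_f_R0 (fun k => 1 - nu + INR k) n))); [ring|].
      rewrite IH. ring. }
  assert (HL : is_lim_seq (fun n => (PI * nu / sin (PI * nu)) * (trigI (2 * nu) (S n) / trigI 0 (S n)))
     (PI * nu / sin (PI * nu) * 1)).
  { apply (is_lim_seq_scal_l (fun n => trigI (2 * nu) (S n) / trigI 0 (S n)) (PI * nu / sin (PI * nu)) 1).
    apply (is_lim_seq_incr_1 (fun n => trigI (2 * nu) n / trigI 0 n)), trigI_ratio. }
  (* The factors 1 + 1/n reconcile the factorial of n + 1 in [E] with that of n in [euler]. *)
  assert (HR : is_lim_seq (fun n => (1 + / INR n) * (1 + / INR n) * (euler (1 + nu) n * euler (1 - nu) n))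
     ((1 + 0) * (1 + 0) * (Gamma (1 + nu) * Gamma (1 - nu)))).
  { assert (H0 : is_lim_seq (fun n => 1 + / INR n) (1 + 0)).
    { apply is_lim_seq_plus'; [apply is_lim_seq_const|apply is_lim_seq_inv_INR]. }
    apply is_lim_seq_mult'; apply is_lim_seq_mult'; assumption. }
  apply (is_lim_seq_ext_loc _ (fun n => (PI * nu / sin (PI * nu)) * (trigI (2 * nu) (S n) / trigI 0 (S n)))) in HR.
  - apply is_lim_seq_unique in HL. apply is_lim_seq_unique in HR. rewrite HL in HR. injection HR. lra.
  - exists 1%nat. intros n Hn. assert (Hn' : 0 < INR n) by (apply lt_0_INR; lia).
    specialize (E n). unfold euler.
    assert (N1 := prod_f_R0_neq0 _ n Hp). assert (N2 := prod_f_R0_neq0 _ n Hm).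
    assert (EP : Rpower (INR n) (1 + nu) * Rpower (INR n) (1 - nu) = INR n ^ 2).
    { rewrite <- Rpower_plus. replace (1 + nu + (1 - nu)) with (INR 2) by (simpl; ring).
      now apply Rpower_pow. }
    rewrite fact_simpl, mult_INR, S_INR in E.
    transitivity ((1 + / INR n) ^ 2 * INR (fact n) ^ 2 * (Rpower (INR n) (1 + nu) * Rpower (INR n) (1 - nu)) /
      (prod_f_R0 (fun k => 1 + nu + INR k) n * prod_f_R0 (fun k => 1 - nu + INR k) n)); [field; repeat split; try assumption; lra|].
    rewrite EP.
    transitivity ((sin (PI * nu) * ((INR n + 1) * INR (fact n)) ^ 2) /
      (sin (PI * nu) * (prod_f_R0 (fun k => 1 + nu + INR k) n * prod_f_R0 (fun k => 1 - nu + INR k) n))); [field; repeat split; try assumption; lra|].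
    rewrite <- E. field. repeat split; try assumption. apply Rgt_not_eq, trigI_0_pos.
Qed.

(** * The integral K(nu) and the digamma function *)

Lemma ex_RInt_cont_all (f : R -> R) (a b : R) : (forall x, continuous f x) -> ex_RInt f a b.
Proof. intros H. apply (ex_RInt_continuous (V := R_CompleteNormedModule)). auto. Qed.

Lemma RInt_cont_correct (f : R -> R) (a b : R) :
  (forall x, continuous f x) -> is_RInt f a b (RInt f a b).
Proof. intros H. apply (RInt_correct (V := R_CompleteNormedModule)), ex_RInt_cont_all, H. Qed.

Lemma sin_neq0 (x : R) : 0 < x < PI / 2 -> sin x <> 0.
Proof. intros H. apply Rgt_not_eq, sin_gt_0; generalize PI_RGT_0; lra. Qed.

(* The translation by PI/n changes the sign of the cosine but hardly changes [h]. *)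
Lemma Riemann_Lebesgue (h : R -> R) (a b : R) : a <= b -> (forall x, continuous h x) ->
  forall beta, is_lim_seq (fun n => RInt (fun x => h x * cos (INR n * x + beta)) a b) 0.
Proof.
  intros Hab Hh beta. assert (HP := PI_RGT_0).
  (* The margin 4 covers every shift c = PI / n, as PI <= 4. *)
  destruct (continuous_bounded h (a - 4) (b + 4)) as [M [HM0 HM]]; [lra|auto|].
  apply is_lim_seq_spec. intros eps.
  set (e := eps / (2 * (b - a + 1))).
  assert (He : 0 < e) by (apply Rdiv_lt_0_compat; [apply eps|lra]).
  destruct (unifcont_normed_1d h (a - 4) (b + 4) (fun x _ => Hh x) (mkposreal e He)) as [d Hd].
  destruct (nfloor_ex (PI / d) ltac:(left; apply Rdiv_lt_0_compat; [assumption|apply d])) as [N1 [_ HN1]].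
  destruct (nfloor_ex ((4 * PI * M) / eps) ltac:(apply Rdiv_le_0_compat; [nra|apply eps])) as [N2 [_ HN2]].
  exists (S (N1 + N2)). intros n Hn.
  assert (Hn1 : INR N1 + 1 <= INR n) by (rewrite <- S_INR; apply le_INR; lia).
  assert (Hn2 : INR N2 + 1 <= INR n) by (rewrite <- S_INR; apply le_INR; lia).
  assert (Hn3 : 1 <= INR n) by (change 1 with (INR 1); apply le_INR; lia).
  set (c := PI / INR n).
  assert (Hc : 0 < c) by (apply Rdiv_lt_0_compat; lra).
  assert (Hc4 : c <= 4).
  { unfold c. apply Rmult_le_reg_r with (INR n); [lra|]. field_simplify; [|lra]. generalize PI_4; lra. }
  assert (Hcd : c < d).
  { unfold c. apply Rmult_lt_reg_r with (INR n); [lra|]. field_simplify; [|lra].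
    assert (Hdp := cond_pos d).
    apply Rlt_le_trans with (d * (INR N1 + 1)); [|nra].
    apply Rmult_lt_reg_r with (/ d); [now apply Rinv_0_lt_compat|]. field_simplify; lra. }
  assert (HcM : 2 * (2 * (c * M)) < eps).
  { unfold c. apply Rmult_lt_reg_r with (INR n); [lra|].
    replace (2 * (2 * (PI / INR n * M)) * INR n) with (4 * PI * M) by (field; lra).
    assert (Hep := cond_pos eps).
    apply Rlt_le_trans with (eps * (INR N2 + 1)); [|nra].
    apply Rmult_lt_reg_r with (/ eps); [now apply Rinv_0_lt_compat|]. field_simplify; lra. }
  set (f := fun x => h x * cos (INR n * x + beta)).
  set (g := fun x => h (x + c) * cos (INR n * x + beta)).
  assert (Hf : forall x, continuous f x).
  { intros x. apply continuous_Rmult; [apply Hh|]. solve_continuous. }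
  assert (Hg : forall x, continuous g x).
  { intros x. apply continuous_Rmult.
    - apply (continuous_comp (fun x => x + c) h); [|apply Hh]. solve_continuous.
    - solve_continuous. }
  assert (E1 : RInt f a b = - RInt g (a - c) (b - c)).
  { assert (H := RInt_comp_lin (V := R_CompleteNormedModule) f 1 c (a - c) (b - c)).
    replace (1 * (a - c) + c) with a in H by ring. replace (1 * (b - c) + c) with b in H by ring.
    rewrite <- H by now apply ex_RInt_cont_all.
    rewrite <- (RInt_opp (V := R_CompleteNormedModule) g) by now apply ex_RInt_cont_all.
    apply RInt_ext. intros x _. unfold f, g.
    change (1 * (h (1 * x + c) * cos (INR n * (1 * x + c) + beta)) = - (h (x + c) * cos (INR n * x + beta))).
    replace (INR n * (1 * x + c) + beta) with (INR n * x + beta + PI) by (unfold c; field; lra).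
    rewrite neg_cos, Rmult_1_l. replace (1 * x + c) with (x + c) by ring. ring. }
  (* Together with [E1], twice the integral of f is the integral of f - g plus two end pieces of
     length c; [B2] and [B1] bound these parts. *)
  assert (E2 : RInt g (a - c) (b - c) = RInt g (a - c) a + RInt g a b - RInt g (b - c) b).
  { assert (H1 := RInt_Chasles (V := R_CompleteNormedModule) g (a - c) a b
      (ex_RInt_cont_all g _ _ Hg) (ex_RInt_cont_all g _ _ Hg)).
    assert (H2 := RInt_Chasles (V := R_CompleteNormedModule) g (a - c) (b - c) b
      (ex_RInt_cont_all g _ _ Hg) (ex_RInt_cont_all g _ _ Hg)).
    change (RInt g (a - c) a + RInt g a b = RInt g (a - c) b) in H1.
    change (RInt g (a - c) (b - c) + RInt g (b - c) b = RInt g (a - c) b) in H2. lra. }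
  assert (Hcos : forall x, Rabs (cos x) <= 1).
  { intros x. apply Rabs_le, COS_bound. }
  assert (B1 : forall u, a - c <= u <= b - c -> Rabs (RInt g u (u + c)) <= c * M).
  { intros u Hu. replace (c * M) with ((u + c - u) * M) by ring. apply abs_RInt_bound; [lra|now apply ex_RInt_cont_all|].
    intros x Hx. unfold g. rewrite Rabs_mult.
    apply Rle_trans with (M * 1); [|lra]. apply Rmult_le_compat; try apply Rabs_pos; [|apply Hcos].
    apply HM. lra. }
  assert (B2 : Rabs (RInt f a b - RInt g a b) <= (b - a) * e).
  { change (RInt f a b - RInt g a b) with (minus (RInt f a b) (RInt g a b)).
    rewrite <- (RInt_minus (V := R_CompleteNormedModule)) by now apply ex_RInt_cont_all.
    apply abs_RInt_bound; [assumption| |].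
    - apply ex_RInt_cont_all. intros x. apply continuous_Rminus; auto.
    - intros x Hx. unfold f, g.
      change (Rabs (h x * cos (INR n * x + beta) - h (x + c) * cos (INR n * x + beta)) <= e).
      rewrite <- Rmult_minus_distr_r, Rabs_mult. apply Rle_trans with (e * 1); [|lra].
      apply Rmult_le_compat; try apply Rabs_pos; [|apply Hcos].
      assert (Hb : Rabs (h (x + c) - h x) < e).
      { apply (Hd x (x + c)); try lra. change (Rabs (x + c - x) < d).
        replace (x + c - x) with c by ring. rewrite Rabs_pos_eq; lra. }
      rewrite Rabs_minus_sym. lra. }
  rewrite Rminus_0_r. change (Rabs (RInt f a b) < eps).
  assert (C1 := B1 (a - c) ltac:(lra)). assert (C2 := B1 (b - c) ltac:(lra)).
  replace (a - c + c) with a in C1 by ring. replace (b - c + c) with b in C2 by ring.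
  assert (HE : (b - a) * e <= eps / 2).
  { unfold e. apply Rmult_le_reg_r with (b - a + 1); [lra|]. field_simplify; [|lra].
    assert (Hep := cond_pos eps). nra. }
  apply Rabs_le_between in C1. apply Rabs_le_between in C2. apply Rabs_le_between in B2.
  apply Rabs_lt_between. lra.
Qed.

(* The continuous extension of [sin (b x) / x]. *)
Definition sinc (b x : R) : R := if Req_EM_T x 0 then b else sin (b * x) / x.

Lemma continuous_sinc (b x : R) : continuous (sinc b) x.
Proof.
  destruct (Req_dec x 0) as [->|Hx].
  - assert (HD : derivable_pt_lim (fun x => sin (b * x)) 0 b).
    { apply is_derive_Reals. auto_derive; [exact I|]. rewrite Rmult_0_r, cos_0. ring. }
    apply filterlim_locally. intros eps.
    destruct (HD eps (cond_pos eps)) as [d Hd]. exists d. intros y Hy.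
    change (Rabs (y - 0) < d) in Hy. change (Rabs (sinc b y - sinc b 0) < eps).
    unfold sinc. destruct (Req_EM_T 0 0) as [_|H]; [|now contradiction H].
    destruct (Req_EM_T y 0) as [->|Hy0].
    + rewrite Rminus_diag, Rabs_R0. apply eps.
    + rewrite Rminus_0_r in Hy. specialize (Hd y Hy0 Hy).
      rewrite Rplus_0_l, Rmult_0_r, sin_0, Rminus_0_r in Hd. exact Hd.
  - apply continuous_ext_loc with (fun x => sin (b * x) / x).
    + assert (H : 0 < Rabs x) by now apply Rabs_pos_lt.
      exists (mkposreal _ H). intros y Hy. change (Rabs (y - x) < Rabs x) in Hy.
      unfold sinc. destruct (Req_EM_T y 0) as [->|Hy0]; [|reflexivity].
      rewrite Rminus_0_l, Rabs_Ropp in Hy. lra.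
    + solve_continuous.
Qed.

(** Projection onto [0, PI / 2]: beyond this interval the sine has further zeros, and freezing the
    argument makes [dirichlet] continuous everywhere. *)
Definition clamp (x : R) : R := Rmax 0 (Rmin x (PI / 2)).

Lemma clamp_range (x : R) : 0 <= clamp x <= PI / 2.
Proof.
  assert (HP := PI_RGT_0). unfold clamp. split; [apply Rmax_l|].
  apply Rmax_lub; [lra|apply Rmin_r].
Qed.

Lemma clamp_id (x : R) : 0 <= x <= PI / 2 -> clamp x = x.
Proof. intros H. unfold clamp. rewrite Rmin_left, Rmax_right; lra. Qed.

Lemma continuous_clamp (x : R) : continuous clamp x.
Proof.
  unfold clamp. apply continuous_ext with (fun x => (0 + (x + PI / 2 - Rabs (x - PI / 2)) / 2 +
     Rabs (0 - (x + PI / 2 - Rabs (x - PI / 2)) / 2)) / 2).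
  - intros y0. set (y := y0 : R). change y0 with y. clearbody y. unfold Rmax, Rmin.
    destruct (Rle_dec y (PI / 2)) as [H|H].
    + rewrite (Rabs_left1 (y - PI / 2)) by lra. replace ((y + PI / 2 - - (y - PI / 2)) / 2) with y by field.
      destruct (Rle_dec 0 y); [rewrite Rabs_left1 by lra|rewrite Rabs_pos_eq by lra]; lra.
    + rewrite (Rabs_pos_eq (y - PI / 2)) by lra. replace ((y + PI / 2 - (y - PI / 2)) / 2) with (PI / 2) by field.
      destruct (Rle_dec 0 (PI / 2)); [rewrite Rabs_left1 by lra|rewrite Rabs_pos_eq by lra]; lra.
  - assert (Hu : continuous (fun x => (x + PI / 2 - Rabs (x - PI / 2)) / 2) x).
    { apply (continuous_scal_l (K := R_AbsRing) (V := R_NormedModule) (fun x => x + PI / 2 - Rabs (x - PI / 2)) (/ 2)).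
      apply continuous_Rminus; [solve_continuous|]. apply (continuous_comp (fun x => x - PI / 2) Rabs); [solve_continuous|].
      apply (continuous_Rabs (x - PI / 2)). }
    apply (continuous_scal_l (K := R_AbsRing) (V := R_NormedModule)
      (fun x => 0 + (x + PI / 2 - Rabs (x - PI / 2)) / 2 + Rabs (0 - (x + PI / 2 - Rabs (x - PI / 2)) / 2)) (/ 2)).
    apply continuous_Rplus.
    + apply continuous_Rplus; [apply continuous_const|exact Hu].
    + apply (continuous_comp (fun x => 0 - (x + PI / 2 - Rabs (x - PI / 2)) / 2) Rabs); [|apply (continuous_Rabs (0 - (x + PI / 2 - Rabs (x - PI / 2)) / 2))].
      apply continuous_Rminus; [apply continuous_const|exact Hu].
Qed.

(* [sin (b x) / sin x] on [(0, PI/2]], extended to a continuous function on the whole line. *)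
Definition dirichlet (b x : R) : R := sinc b (clamp x) / sinc 1 (clamp x).

Lemma sinc_1_neq0 (x : R) : 0 <= x <= PI / 2 -> sinc 1 x <> 0.
Proof.
  intros Hx. assert (HP := PI_RGT_0). unfold sinc. destruct (Req_EM_T x 0); [lra|].
  rewrite Rmult_1_l. apply Rgt_not_eq. apply Rdiv_lt_0_compat; [apply sin_gt_0; lra|lra].
Qed.

Lemma continuous_dirichlet (b x : R) : continuous (dirichlet b) x.
Proof.
  assert (H : forall b, continuous (fun x => sinc b (clamp x)) x).
  { intros b'. apply (continuous_comp clamp (sinc b')); [apply continuous_clamp|apply continuous_sinc]. }
  unfold dirichlet. apply continuous_Rmult; [apply H|].
  apply (continuous_comp (fun x => sinc 1 (clamp x)) Rinv); [apply H|].
  apply continuous_Rinv, sinc_1_neq0, clamp_range.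
Qed.

Lemma dirichlet_eq (b x : R) : 0 < x <= PI / 2 -> dirichlet b x = sin (b * x) / sin x.
Proof.
  intros Hx. unfold dirichlet. rewrite clamp_id by lra. unfold sinc.
  destruct (Req_EM_T x 0); [lra|]. rewrite Rmult_1_l. field. split; [|assumption].
  apply Rgt_not_eq, sin_gt_0; generalize PI_RGT_0; lra.
Qed.

(* The continuous extension of [(sin (PI nu - 2 nu x) - sin (PI nu)) cot x]. *)
Definition kern (nu x : R) : R := -2 * cos (PI * nu - nu * x) * cos x * dirichlet nu x.

Lemma continuous_kern (nu x : R) : continuous (kern nu) x.
Proof.
  unfold kern. apply continuous_Rmult; [|apply continuous_dirichlet]. solve_continuous.
Qed.

Lemma kern_eq (nu x : R) : 0 < x <= PI / 2 ->
  kern nu x = (sin (PI * nu - 2 * nu * x) - sin (PI * nu)) * cos x / sin x.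
Proof.
  intros Hx. unfold kern. rewrite dirichlet_eq by assumption.
  rewrite form4. replace ((PI * nu - 2 * nu * x - PI * nu) / 2) with (- (nu * x)) by field.
  replace ((PI * nu - 2 * nu * x + PI * nu) / 2) with (PI * nu - nu * x) by field.
  rewrite sin_neg. unfold Rdiv. ring.
Qed.

(** This is sin(PI nu) K(nu) in the notation of the overview. As the sine changes sign under nu ->
    nu + 1, the difference of two values of K becomes a sum of two values of [Kint]. *)
Definition Kint (nu : R) : R := RInt (kern nu) 0 (PI / 2).

Lemma is_Kint (nu : R) : is_RInt (kern nu) 0 (PI / 2) (Kint nu).
Proof. apply RInt_cont_correct, continuous_kern. Qed.

Lemma is_RInt_ext_PI2 (f g : R -> R) (l : R) :
  (forall x, 0 < x < PI / 2 -> f x = g x) -> is_RInt f 0 (PI / 2) l -> is_RInt g 0 (PI / 2) l.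
Proof.
  intros H. apply is_RInt_ext. rewrite Rmin_left, Rmax_right by (generalize PI_RGT_0; lra). exact H.
Qed.

Lemma RInt_cos_nu (nu : R) : nu <> 0 ->
  is_RInt (fun x => cos (PI * nu - 2 * nu * x)) 0 (PI / 2) (sin (PI * nu) / (2 * nu)).
Proof.
  intros H. eapply is_RInt_replace.
  - apply (is_RInt_Rderive (fun x => - sin (PI * nu - 2 * nu * x) / (2 * nu))).
    + intros x. auto_derive; [exact I|]. unfold Rminus. field. assumption.
    + intros x. solve_continuous.
  - simpl. replace (PI * nu - 2 * nu * (PI / 2)) with 0 by field.
    replace (PI * nu - 2 * nu * 0) with (PI * nu) by ring. rewrite sin_0. field. assumption.
Qed.

(** The cotangent singularities cancel: the two kernels add up to cos(PI nu - 2 nu x) minus the same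
    cosine at nu + 1, and both have elementary integrals. *)
Lemma Kint_S (nu : R) : 0 < nu ->
  Kint nu + Kint (nu + 1) = sin (PI * nu) * (/ (2 * nu) + / (2 * (nu + 1))).
Proof.
  intros Hnu.
  assert (H1 := is_RInt_Rplus (is_Kint nu) (is_Kint (nu + 1))).
  assert (H2 := is_RInt_Rminus
    (RInt_cos_nu nu ltac:(lra)) (RInt_cos_nu (nu + 1) ltac:(lra))).
  eapply is_RInt_ext_PI2 in H1.
  - apply is_RInt_Runique in H1.
    apply is_RInt_Runique in H2.
    transitivity (sin (PI * nu) / (2 * nu) - sin (PI * (nu + 1)) / (2 * (nu + 1))).
    + etransitivity; [|exact H2]. symmetry. exact H1.
    + replace (PI * (nu + 1)) with (PI * nu + PI) by ring. rewrite neg_sin. field. lra.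
  - intros x Hx. change (kern nu x + kern (nu + 1) x = cos (PI * nu - 2 * nu * x) - cos (PI * (nu + 1) - 2 * (nu + 1) * x)).
    rewrite !kern_eq by lra.
    assert (Hs : sin x <> 0) by (now apply sin_neq0).
    replace (PI * (nu + 1) - 2 * (nu + 1) * x) with (PI * nu - 2 * nu * x - 2 * x + PI) by ring.
    replace (PI * (nu + 1)) with (PI * nu + PI) by ring. rewrite !neg_sin, neg_cos.
    set (u := PI * nu - 2 * nu * x). rewrite sin_minus, cos_minus, sin_2a, cos_2a.
    assert (Hc : cos x * cos x = 1 - sin x * sin x) by (generalize (sin2_cos2 x); unfold Rsqr; lra).
    apply (Rmult_eq_reg_r (sin x)); [|assumption]. field_simplify; [|assumption].
    replace (cos x ^ 3) with (cos x * (cos x * cos x)) by ring.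
    replace (cos x ^ 2) with (cos x * cos x) by ring. rewrite Hc. ring.
Qed.

Definition dsum (nu : R) (n : nat) : R := sum_f_R0 (fun k => / (nu + INR k)) n.

(** Each application of [Kint_S] contributes half of two neighbouring reciprocals, so the sum
    appears with its two end terms halved, as in the trapezoidal rule. The alternating signs are
    absorbed by sin(PI (nu + k)). *)
Lemma Kint_iter (nu : R) (n : nat) : 0 < nu ->
  Kint nu = (-1) ^ n * Kint (nu + INR n) + sin (PI * nu) * (dsum nu n - / (2 * nu) - / (2 * (nu + INR n))).
Proof.
  intros Hnu. induction n as [|n IH].
  - unfold dsum. simpl. rewrite Rplus_0_r. field. lra.
  - assert (Hn := pos_INR n).
    assert (E := Kint_S (nu + INR n) ltac:(lra)).
    assert (Es : sin (PI * (nu + INR n)) = (-1) ^ n * sin (PI * nu)).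
    { clear. induction n as [|n IH]; [simpl; rewrite Rplus_0_r; ring|].
      rewrite S_INR. replace (PI * (nu + (INR n + 1))) with (PI * (nu + INR n) + PI) by ring.
      rewrite neg_sin, IH. simpl. ring. }
    assert (Hsq : (-1) ^ n * (-1) ^ n = 1).
    { rewrite <- Rpow_mult_distr. replace (-1 * -1) with 1 by ring. apply pow1. }
    replace (Kint (nu + INR n)) with (sin (PI * (nu + INR n)) * (/ (2 * (nu + INR n)) + / (2 * (nu + INR n + 1)))
       - Kint (nu + INR n + 1)) in IH by lra.
    rewrite IH, Es.
    change (dsum nu (S n)) with (dsum nu n + / (nu + INR (S n))). rewrite !S_INR.
    replace (nu + (INR n + 1)) with (nu + INR n + 1) by ring.
    rewrite <- tech_pow_Rmult.
    transitivity (-1 * (-1) ^ n * Kint (nu + INR n + 1) + sin (PI * nu) *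
      (((-1) ^ n * (-1) ^ n) * (/ (2 * (nu + INR n)) + / (2 * (nu + INR n + 1))) + dsum nu n - / (2 * nu) - / (2 * (nu + INR n)))); [ring|].
    rewrite Hsq. replace (/ (nu + INR n + 1)) with (2 * / (2 * (nu + INR n + 1))) by (field; lra). ring.
Qed.

(** The integrand is sin(2 n x) cot x with n = m + 1. Raising n by one adds two cosines of even
    frequency, whose integrals over [0, PI / 2] vanish. *)
Lemma RInt_dirichlet_even (m : nat) :
  is_RInt (fun x => dirichlet (2 * INR (S m)) x * cos x) 0 (PI / 2) (PI / 2).
Proof.
  induction m as [|m IH].
  - apply is_RInt_ext_PI2 with (fun x => 1 + cos (2 * x)).
    + intros x Hx. rewrite dirichlet_eq by lra. simpl. rewrite Rmult_1_r, sin_2a, cos_2a.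
      assert (Hs : sin x <> 0) by (now apply sin_neq0).
      field_simplify; [|assumption]. generalize (sin2_cos2 x); unfold Rsqr; lra.
    + eapply is_RInt_replace.
      * apply (is_RInt_Rderive (fun x => x + sin (2 * x) / 2)).
        -- intros x. auto_derive; [exact I|field].
        -- intros x. solve_continuous.
      * simpl. replace (2 * (PI / 2)) with PI by field. rewrite sin_PI, Rmult_0_r, sin_0. field.
  - set (a := 2 * INR (S m)) in *. assert (Ha : 0 < a) by (unfold a; rewrite S_INR; generalize (pos_INR m); lra).
    replace (2 * INR (S (S m))) with (a + 2) by (unfold a; rewrite (S_INR (S m)); ring).
    assert (Hs0 : sin (a * (PI / 2)) = 0 /\ sin ((a + 2) * (PI / 2)) = 0).
    { assert (H : forall k, sin (2 * INR k * (PI / 2)) = 0).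
      { intros k. replace (2 * INR k * (PI / 2)) with (IZR (Z.of_nat k) * PI) by (rewrite <- INR_IZR_INZ; field).
        apply sin_eq_0_1. now exists (Z.of_nat k). }
      split; [apply H|]. rewrite <- (H (S (S m))), (S_INR (S m)). f_equal. unfold a. ring. }
    assert (H : is_RInt (fun x => cos ((a + 2) * x) + cos (a * x)) 0 (PI / 2) 0).
    { eapply is_RInt_replace.
      - apply (is_RInt_Rderive (fun x => sin ((a + 2) * x) / (a + 2) + sin (a * x) / a)).
        + intros x. auto_derive; [exact I|field; lra].
        + intros x. solve_continuous.
      - simpl. rewrite !Rmult_0_r, sin_0. destruct Hs0 as [-> ->]. field. lra. }
    assert (H2 := is_RInt_Rplus IH H).
    eapply is_RInt_replace; [eapply is_RInt_ext_PI2; [|exact H2]|change (PI / 2 + 0 = PI / 2); ring].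
    intros x Hx. change (dirichlet a x * cos x + (cos ((a + 2) * x) + cos (a * x)) = dirichlet (a + 2) x * cos x).
    rewrite !dirichlet_eq by lra.
    assert (Hs : sin x <> 0) by (now apply sin_neq0).
    rewrite (Rmult_plus_distr_r a 2 x), sin_plus, cos_plus, sin_2a, cos_2a.
    assert (Hc : cos x * cos x = 1 - sin x * sin x) by (generalize (sin2_cos2 x); unfold Rsqr; lra).
    apply (Rmult_eq_reg_r (sin x)); [|assumption]. field_simplify; [|assumption|assumption].
    replace (cos x ^ 3) with (cos x * (cos x * cos x)) by ring.
    replace (cos x ^ 2) with (cos x * cos x) by ring. rewrite Hc. ring.
Qed.

(** The integral of sin(b x)^2 cot x. For an integer b = n, twice its opposite is the nu = 0
    analogue of [Kint (nu + n)] after division by sin(PI nu). *)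
Definition sinsq_int (b : R) : R := RInt (fun x => sin (b * x) * dirichlet b x * cos x) 0 (PI / 2).

Lemma is_sinsq_int (b : R) :
  is_RInt (fun x => sin (b * x) * dirichlet b x * cos x) 0 (PI / 2) (sinsq_int b).
Proof.
  apply RInt_cont_correct. intros x.
  apply continuous_Rmult; [|solve_continuous]. apply continuous_Rmult; [solve_continuous|apply continuous_dirichlet].
Qed.

(** The integral is 1 + 1/3 + ... + 1/(2 m + 1): raising b from a to a + 2 adds 1 / (a + 1). It is
    written with harmonic numbers so that [harm_lim] applies. *)
Lemma sinsq_int_harm (m : nat) :
  2 * sinsq_int (2 * INR (S m)) = 2 * harm (2 * m + 1) - harm m.
Proof.
  induction m as [|m IH].
  - replace (sinsq_int (2 * INR 1)) with 1.
    { unfold harm. simpl. field. }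
    symmetry. apply is_RInt_Runique.
    apply is_RInt_ext_PI2 with (fun x => 4 * sin x * cos x ^ 3).
    + intros x Hx. rewrite dirichlet_eq by lra. simpl INR. rewrite Rmult_1_r, sin_2a. field.
      apply Rgt_not_eq, sin_gt_0; generalize PI_RGT_0; lra.
    + eapply is_RInt_replace.
      * apply (is_RInt_Rderive (fun x => - cos x ^ 4)).
        -- intros x. auto_derive; [exact I|]. simpl. ring.
        -- intros x. solve_continuous.
      * simpl. rewrite cos_PI2, cos_0. ring.
  - set (a := 2 * INR (S m)) in *.
    assert (Ha : 0 < a) by (unfold a; rewrite S_INR; generalize (pos_INR m); lra).
    replace (2 * INR (S (S m))) with (a + 2) by (unfold a; rewrite (S_INR (S m)); ring).
    assert (H : is_RInt (fun x => sin ((2 * a + 2) * x) + / 2 * sin ((2 * a + 4) * x) + / 2 * sin (2 * a * x))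
      0 (PI / 2) (/ (a + 1))).
    { eapply is_RInt_replace.
      - apply (is_RInt_Rderive (fun x => - cos ((2 * a + 2) * x) / (2 * a + 2)
          - cos ((2 * a + 4) * x) / (2 * (2 * a + 4)) - cos (2 * a * x) / (4 * a))).
        + intros x. auto_derive; [exact I|]. field. lra.
        + intros x. solve_continuous.
      - simpl. replace ((2 * a + 2) * (PI / 2)) with (PI + 2 * INR (S m) * PI) by (unfold a; field).
        replace (2 * a * (PI / 2)) with (0 + 2 * INR (S m) * PI) by (unfold a; field).
        replace ((2 * a + 4) * (PI / 2)) with (0 + 2 * INR (S (S m)) * PI) by (unfold a; rewrite (S_INR (S m)); field).
        rewrite !cos_period, cos_PI, !Rmult_0_r, cos_0. field. lra. }
    assert (H2 := is_RInt_Rplus (is_sinsq_int a) H).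
    assert (E : sinsq_int (a + 2) = sinsq_int a + / (a + 1)).
    { apply is_RInt_Runique. eapply is_RInt_ext_PI2; [|exact H2].
      intros x Hx. change (sin (a * x) * dirichlet a x * cos x +
        (sin ((2 * a + 2) * x) + / 2 * sin ((2 * a + 4) * x) + / 2 * sin (2 * a * x)) =
        sin ((a + 2) * x) * dirichlet (a + 2) x * cos x).
      rewrite !dirichlet_eq by lra.
      assert (Hs : sin x <> 0) by (now apply sin_neq0).
      assert (E1 : sin ((2 * a + 4) * x) + sin (2 * a * x) = 2 * sin ((2 * a + 2) * x) * cos (2 * x)).
      { replace ((2 * a + 4) * x) with ((2 * a + 2) * x + 2 * x) by ring.
        replace (2 * a * x) with ((2 * a + 2) * x - 2 * x) by ring.
        rewrite sin_plus, sin_minus. ring. }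
      assert (E2 : sin ((a + 2) * x) * sin ((a + 2) * x) - sin (a * x) * sin (a * x) = sin ((2 * a + 2) * x) * sin (2 * x)).
      { replace ((2 * a + 2) * x) with ((a + 2) * x + a * x) by ring.
        replace (2 * x) with ((a + 2) * x - a * x) by ring.
        rewrite sin_plus, sin_minus.
        assert (H1 := sin2_cos2 ((a + 2) * x)). assert (H3 := sin2_cos2 (a * x)). unfold Rsqr in *.
        set (s1 := sin ((a + 2) * x)) in *. set (c1 := cos ((a + 2) * x)) in *.
        set (s2 := sin (a * x)) in *. set (c2 := cos (a * x)) in *.
        replace ((s1 * c2 + c1 * s2) * (s1 * c2 - c1 * s2)) with (s1 * s1 * (c2 * c2) - c1 * c1 * (s2 * s2)) by ring.
        replace (c2 * c2) with (1 - s2 * s2) by lra. replace (c1 * c1) with (1 - s1 * s1) by lra. ring. }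
      replace (sin ((2 * a + 2) * x) + / 2 * sin ((2 * a + 4) * x) + / 2 * sin (2 * a * x))
        with (sin ((2 * a + 2) * x) + / 2 * (sin ((2 * a + 4) * x) + sin (2 * a * x))) by ring.
      rewrite E1. apply (Rmult_eq_reg_r (sin x)); [|assumption].
      transitivity (sin (a * x) * sin (a * x) * cos x + sin ((2 * a + 2) * x) * (1 + cos (2 * x)) * sin x); [field; assumption|].
      transitivity (sin ((a + 2) * x) * sin ((a + 2) * x) * cos x); [|field; assumption].
      replace (sin ((a + 2) * x) * sin ((a + 2) * x)) with (sin (a * x) * sin (a * x) + sin ((2 * a + 2) * x) * sin (2 * x)) by lra.
      rewrite cos_2a, sin_2a.
      assert (Hc : cos x * cos x = 1 - sin x * sin x) by (generalize (sin2_cos2 x); unfold Rsqr; lra).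
      replace (2 * sin x * cos x) with (2 * cos x * sin x) by ring.
      transitivity (sin (a * x) * sin (a * x) * cos x + sin ((2 * a + 2) * x) * 2 * (cos x * cos x) * sin x); [rewrite Hc; ring|ring]. }
    rewrite E, Rmult_plus_distr_l, IH. unfold harm.
    replace (2 * S m + 1)%nat with (S (S (2 * m + 1))) by lia. rewrite !tech5.
    replace (INR (S (S (2 * m + 1)))) with (2 * INR m + 3).
    2: { rewrite !S_INR, plus_INR, mult_INR. simpl. ring. }
    replace (INR (S (S (S (2 * m + 1))))) with (2 * INR m + 4).
    2: { rewrite !S_INR, plus_INR, mult_INR. simpl. ring. }
    replace (INR (S (S m))) with (INR m + 2) by (rewrite !S_INR; ring).
    unfold a. rewrite S_INR. assert (Hm := pos_INR m). field. lra.
Qed.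

Lemma sinsq_int_lim :
  is_lim_seq (fun m => 2 * sinsq_int (2 * INR (S m)) - ln (2 * INR (S m))) (egamma + ln 2).
Proof.
  assert (H1 : is_lim_seq (fun m => harm (2 * m + 1) - ln (INR (S (2 * m + 1)))) egamma).
  { apply (is_lim_seq_subseq (fun m => harm m - ln (INR (S m))) egamma (fun m => (2 * m + 1)%nat)).
    - apply eventually_subseq. intros n. lia.
    - apply harm_lim. }
  apply is_lim_seq_ext with (fun m => 2 * (harm (2 * m + 1) - ln (INR (S (2 * m + 1)))) - (harm m - ln (INR (S m))) + ln 2).
  - intros m. rewrite sinsq_int_harm.
    replace (INR (S (2 * m + 1))) with (2 * INR (S m)) by (rewrite !S_INR, plus_INR, mult_INR; simpl; ring).
    rewrite ln_mult; [ring|lra|apply lt_0_INR; lia].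
  - replace (Finite (egamma + ln 2)) with (Finite (2 * egamma - egamma + ln 2)) by (f_equal; ring).
    apply is_lim_seq_plus'; [|apply is_lim_seq_const]. apply is_lim_seq_minus'; [|apply harm_lim].
    apply (is_lim_seq_scal_l _ 2 egamma), H1.
Qed.

(* Up to a Riemann-Lebesgue error, [kern (nu + n)] integrates like [(sin (PI nu - 2 n x) - sin (PI nu)) cot x]. *)
Lemma Kint_even_lim (nu : R) :
  is_lim_seq (fun m => Kint (nu + 2 * INR (S m)) + sin (PI * nu) * (2 * sinsq_int (2 * INR (S m))) + cos (PI * nu) * (PI / 2)) 0.
Proof.
  assert (HP := PI_RGT_0).
  (* With n = 2 (m + 1), the combined integrand is -2 sin(nu x) cos(PI nu - nu x - 2 n x) cot x. The
     addition theorem splits it into amplitudes [h1] and [h2], free of n, times cos(2 n x) and sin(2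
     n x). *)
  set (h1 := fun x => -2 * cos x * dirichlet nu x * cos (PI * nu - nu * x)).
  set (h2 := fun x => -2 * cos x * dirichlet nu x * sin (PI * nu - nu * x)).
  assert (Hh1 : forall x, continuous h1 x).
  { intros x. apply continuous_Rmult; [|solve_continuous]. apply continuous_Rmult; [solve_continuous|apply continuous_dirichlet]. }
  assert (Hh2 : forall x, continuous h2 x).
  { intros x. apply continuous_Rmult; [|solve_continuous]. apply continuous_Rmult; [solve_continuous|apply continuous_dirichlet]. }
  assert (L : forall h beta, (forall x, continuous h x) -> is_lim_seq (fun m => RInt (fun x => h x * cos (4 * INR (S m) * x + beta)) 0 (PI / 2)) 0).
  { intros h beta Hh. apply is_lim_seq_ext with (fun m => RInt (fun x => h x * cos (INR (4 * S m) * x + beta)) 0 (PI / 2)).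
    - intros m. rewrite mult_INR. replace (INR 4) with 4 by (simpl; ring). reflexivity.
    - apply (is_lim_seq_subseq (fun n => RInt (fun x => h x * cos (INR n * x + beta)) 0 (PI / 2)) 0 (fun m => (4 * S m)%nat)).
      + apply eventually_subseq. intros n. lia.
      + apply Riemann_Lebesgue; [lra|assumption]. }
  apply is_lim_seq_ext with (fun m => RInt (fun x => h1 x * cos (4 * INR (S m) * x + 0)) 0 (PI / 2)
     + RInt (fun x => h2 x * cos (4 * INR (S m) * x + - (PI / 2))) 0 (PI / 2)).
  2: { replace (Finite 0) with (Finite (0 + 0)) by (f_equal; ring). apply is_lim_seq_plus'; now apply L. }
  intros m. set (n := 2 * INR (S m)). assert (Hn : 0 < n) by (unfold n; rewrite S_INR; generalize (pos_INR m); lra).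
  assert (I1 : forall h beta, (forall x, continuous h x) -> is_RInt (fun x => h x * cos (4 * INR (S m) * x + beta)) 0 (PI / 2)
      (RInt (fun x => h x * cos (4 * INR (S m) * x + beta)) 0 (PI / 2))).
  { intros h beta Hh. apply RInt_cont_correct. intros x.
    apply continuous_Rmult; [apply Hh|solve_continuous]. }
  assert (HL := is_RInt_Rplus (I1 h1 0 Hh1) (I1 h2 (- (PI / 2)) Hh2)).
  assert (HD := RInt_dirichlet_even (2 * m + 1)).
  replace (2 * INR (S (2 * m + 1))) with (2 * n) in HD by (unfold n; rewrite !S_INR, plus_INR, mult_INR; simpl; ring).
  assert (HR := is_RInt_Rplus
    (is_RInt_Rplus (is_Kint (nu + n))
      (is_RInt_Rscal (2 * sin (PI * nu)) (is_sinsq_int n)))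
    (is_RInt_Rscal (cos (PI * nu)) HD)).
  apply is_RInt_Runique in HL.
  etransitivity; [symmetry; exact HL|].
  transitivity (Kint (nu + n) + 2 * sin (PI * nu) * sinsq_int n + cos (PI * nu) * (PI / 2)); [|ring].
  apply is_RInt_Runique. eapply is_RInt_ext_PI2; [|exact HR].
  intros x Hx. change (kern (nu + n) x + 2 * sin (PI * nu) * (sin (n * x) * dirichlet n x * cos x) +
    cos (PI * nu) * (dirichlet (2 * n) x * cos x) =
    h1 x * cos (4 * INR (S m) * x + 0) + h2 x * cos (4 * INR (S m) * x + - (PI / 2))).
  unfold h1, h2. rewrite kern_eq, !dirichlet_eq by lra.
  assert (Hs : sin x <> 0) by (now apply sin_neq0).
  replace (4 * INR (S m) * x + 0) with (2 * (n * x)) by (unfold n; ring).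
  replace (cos (4 * INR (S m) * x + - (PI / 2))) with (sin (2 * (n * x))).
  2: { rewrite <- cos_shift, <- cos_neg. f_equal. unfold n. ring. }
  replace (PI * (nu + n)) with (PI * nu + 2 * INR (S m) * PI) by (unfold n; ring).
  replace (PI * nu + 2 * INR (S m) * PI - 2 * (nu + n) * x) with ((PI * nu - 2 * nu * x - 2 * (n * x)) + 2 * INR (S m) * PI) by ring.
  rewrite !sin_period.
  replace (2 * n * x) with (2 * (n * x)) by ring. set (y := n * x).
  assert (E1 : 2 * sin y * sin y = 1 - cos (2 * y)) by (rewrite cos_2a_sin; ring).
  transitivity ((sin (PI * nu - 2 * nu * x - 2 * y) - sin (PI * nu) + sin (PI * nu) * (2 * sin y * sin y) + cos (PI * nu) * sin (2 * y)) * cos x / sin x); [field; assumption|].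
  rewrite E1.
  transitivity ((-2 * sin (nu * x) * cos (PI * nu - nu * x - 2 * y)) * cos x / sin x).
  - f_equal. f_equal.
    replace (sin (PI * nu - 2 * nu * x - 2 * y) - sin (PI * nu) + sin (PI * nu) * (1 - cos (2 * y)) + cos (PI * nu) * sin (2 * y))
      with (sin (PI * nu - 2 * nu * x - 2 * y) - sin (PI * nu - 2 * y)) by (rewrite (sin_minus (PI * nu) (2 * y)); ring).
    rewrite form4. replace ((PI * nu - 2 * nu * x - 2 * y - (PI * nu - 2 * y)) / 2) with (- (nu * x)) by field.
    replace ((PI * nu - 2 * nu * x - 2 * y + (PI * nu - 2 * y)) / 2) with (PI * nu - nu * x - 2 * y) by field.
    rewrite sin_neg. ring.
  - rewrite (cos_minus (PI * nu - nu * x) (2 * y)). field. assumption.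
Qed.

(** [Kint_iter] solved for [dsum] at even indices, where the sign is 1 and [Kint_even_lim] controls
    the remaining [Kint]; the logarithm comes from [sinsq_int_lim]. *)
Lemma dsum_lim (nu : R) : 0 < nu -> sin (PI * nu) <> 0 ->
  is_lim_seq (fun m => ln (INR (2 * S m)) - dsum nu (2 * S m))
    (- (Kint nu / sin (PI * nu)) - / (2 * nu) - PI / 2 * (cos (PI * nu) / sin (PI * nu)) - egamma - ln 2).
Proof.
  intros Hnu Hs.
  apply is_lim_seq_ext with (fun m =>
    (Kint (nu + 2 * INR (S m)) + sin (PI * nu) * (2 * sinsq_int (2 * INR (S m))) + cos (PI * nu) * (PI / 2)) * / sin (PI * nu)
    - (2 * sinsq_int (2 * INR (S m)) - ln (2 * INR (S m)))
    - / 2 * / (nu + 2 * INR (S m))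
    + (- (Kint nu / sin (PI * nu)) - / (2 * nu) - PI / 2 * (cos (PI * nu) / sin (PI * nu)))).
  - intros m. assert (E := Kint_iter nu (2 * S m) Hnu). rewrite pow_1_even, Rmult_1_l in E.
    replace (INR (2 * S m)) with (2 * INR (S m)) in * by (rewrite mult_INR; simpl; ring).
    assert (Hn : 0 < INR (S m)) by (apply lt_0_INR; lia).
    replace (dsum nu (2 * S m)) with ((Kint nu - Kint (nu + 2 * INR (S m))) / sin (PI * nu) + / (2 * nu) + / (2 * (nu + 2 * INR (S m)))).
    2: { rewrite E at 1. field. repeat split; try assumption; lra. }
    field. repeat split; try assumption; lra.
  - replace (Finite (- (Kint nu / sin (PI * nu)) - / (2 * nu) - PI / 2 * (cos (PI * nu) / sin (PI * nu)) - egamma - ln 2))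
      with (Finite (0 * / sin (PI * nu) - (egamma + ln 2) - / 2 * 0 + (- (Kint nu / sin (PI * nu)) - / (2 * nu) - PI / 2 * (cos (PI * nu) / sin (PI * nu))))) by (f_equal; ring).
    apply is_lim_seq_plus'; [|apply is_lim_seq_const].
    apply is_lim_seq_minus'; [apply is_lim_seq_minus'|].
    + apply is_lim_seq_mult'; [apply Kint_even_lim|apply is_lim_seq_const].
    + apply sinsq_int_lim.
    + apply is_lim_seq_mult'; [apply is_lim_seq_const|].
      apply is_lim_seq_le_le with (fun m => 0) (fun m => / INR (S m)).
      * intros m. assert (Hn : 0 < INR (S m)) by (apply lt_0_INR; lia). split.
        -- left. apply Rinv_0_lt_compat. lra.
        -- apply Rinv_le_contravar; lra.
      * apply is_lim_seq_const.
      * apply (is_lim_seq_incr_1 (fun n => / INR n)), is_lim_seq_inv_INR.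
Qed.

(** * Logarithmic derivative of Euler's limit *)

Lemma ln_1_taylor (x : R) : Rabs x <= 1 / 2 -> Rabs (ln (1 + x) - x) <= 2 * x ^ 2.
Proof.
  intros Hx. apply Rabs_le_between in Hx.
  assert (Hup : forall y, 0 < y -> ln y <= y - 1).
  { intros y Hy. rewrite <- (ln_exp (y - 1)). apply ln_le; [assumption|].
    generalize (exp_ineq1_le (y - 1)). lra. }
  assert (H1 := Hup (1 + x) ltac:(lra)).
  assert (H2 := Hup (/ (1 + x)) ltac:(apply Rinv_0_lt_compat; lra)).
  rewrite ln_Rinv in H2 by lra.
  assert (H3 : / (1 + x) - 1 + x <= 2 * x ^ 2).
  { apply Rmult_le_reg_r with (1 + x); [lra|]. field_simplify; [|lra]. nra. }
  apply Rabs_le_between. nra.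
Qed.

(** A pointwise limit cannot be differentiated termwise. Instead ln(euler(nu + h)) is expanded to
    first order in h with an error at most a constant times h^2, uniformly in n; this bound survives
    the limit and says that ln Gamma has derivative L at nu. *)
Lemma digamma_lim (nu L : R) : 0 < nu ->
  is_lim_seq (fun m => ln (INR (2 * S m)) - dsum nu (2 * S m)) L -> digamma nu = L.
Proof.
  intros Hnu HL.
  assert (Hpos : forall x, 0 < x -> forall k, x + INR k <> 0).
  { intros x Hx k. generalize (pos_INR k). lra. }
  assert (Hsub : forall x, 0 < x -> is_lim_seq (fun m => euler x (2 * S m)) (Gamma x)).
  { intros x Hx. apply (is_lim_seq_subseq (euler x) (Gamma x) (fun m => (2 * S m)%nat)).
    - apply eventually_subseq. intros n. lia.
    - apply euler_cv, Hpos, Hx. }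
  assert (Hln : forall x, 0 < x -> is_lim_seq (fun m => ln (euler x (2 * S m))) (ln (Gamma x))).
  { intros x Hx. apply (is_lim_seq_continuous ln (fun m => euler x (2 * S m)) (Gamma x)); [|now apply Hsub].
    apply continuity_pt_filterlim, continuous_ln, Gamma_pos, Hx. }
  assert (Heq : forall x n, 0 < x -> ln (euler x n) = ln (INR (fact n)) + x * ln (INR n) - sum_f_R0 (fun k => ln (x + INR k)) n).
  { intros x n Hx. assert (HP : forall n, 0 < prod_f_R0 (fun k => x + INR k) n /\ ln (prod_f_R0 (fun k => x + INR k) n) = sum_f_R0 (fun k => ln (x + INR k)) n).
    { induction n0 as [|k [IH1 IH2]]; [split; [simpl; lra|reflexivity]|].
      assert (0 < x + INR (S k)) by (generalize (pos_INR (S k)); lra).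
      change (prod_f_R0 (fun k => x + INR k) (S k)) with (prod_f_R0 (fun k => x + INR k) k * (x + INR (S k))).
      split; [now apply Rmult_lt_0_compat|]. rewrite ln_mult, IH2 by assumption. reflexivity. }
    destruct (HP n) as [P1 P2]. unfold euler.
    assert (0 < INR (fact n)) by apply INR_fact_lt_0. assert (0 < Rpower (INR n) x) by apply exp_pos.
    unfold Rdiv. rewrite ln_mult, ln_mult, ln_Rinv, P2; try assumption.
    - unfold Rpower. rewrite ln_exp. ring.
    - now apply Rmult_lt_0_compat.
    - now apply Rinv_0_lt_compat. }
  (* A bound for the sums of 1 / (nu + k)^2, by telescoping 1 / (nu + k) - 1 / (nu + k + 1); it is
     the constant in the quadratic error. *)
  assert (HS : exists S, 0 <= S /\ forall n, sum_f_R0 (fun k => / (nu + INR k) ^ 2) n <= S).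
  { exists (/ nu ^ 2 + / nu). split.
    - generalize (Rinv_0_lt_compat nu Hnu) (Rinv_0_lt_compat (nu ^ 2) (pow_lt nu 2 Hnu)). lra.
    - intros n. assert (H : sum_f_R0 (fun k => / (nu + INR k) ^ 2) n <= / nu ^ 2 + / nu - / (nu + INR n)).
      { induction n as [|n IH].
        - change (/ (nu + INR 0) ^ 2 <= / nu ^ 2 + / nu - / (nu + INR 0)).
          change (INR 0) with 0. rewrite !Rplus_0_r. lra.
        - rewrite tech5, S_INR. assert (Hn := pos_INR n).
          assert (/ (nu + (INR n + 1)) ^ 2 <= / (nu + INR n) - / (nu + (INR n + 1))); [|lra].
          replace (/ (nu + INR n) - / (nu + (INR n + 1))) with (/ ((nu + INR n) * (nu + (INR n + 1)))) by (field; lra).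
          apply Rinv_le_contravar; nra. }
      assert (0 < / (nu + INR n)) by (apply Rinv_0_lt_compat; generalize (pos_INR n); lra). lra. }
  destruct HS as [S [HS0 HS]].
  assert (HT : forall h, Rabs h <= nu / 2 -> Rabs (ln (Gamma (nu + h)) - ln (Gamma nu) - h * L) <= 2 * S * h ^ 2).
  { intros h Hh. assert (Hh' := Hh). apply Rabs_le_between in Hh'.
    assert (HB : forall n, Rabs (ln (euler (nu + h) n) - ln (euler nu n) - h * (ln (INR n) - dsum nu n)) <= 2 * S * h ^ 2).
    { intros n. rewrite !Heq by lra.
      replace (ln (INR (fact n)) + (nu + h) * ln (INR n) - sum_f_R0 (fun k => ln (nu + h + INR k)) n -
        (ln (INR (fact n)) + nu * ln (INR n) - sum_f_R0 (fun k => ln (nu + INR k)) n) - h * (ln (INR n) - dsum nu n))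
        with (- (sum_f_R0 (fun k => ln (nu + h + INR k)) n - sum_f_R0 (fun k => ln (nu + INR k)) n - h * dsum nu n)) by ring.
      rewrite Rabs_Ropp. unfold dsum. rewrite scal_sum, <- !minus_sum.
      eapply Rle_trans; [apply sum_f_R0_triangle|].
      apply Rle_trans with (sum_f_R0 (fun k => / (nu + INR k) ^ 2 * (2 * h ^ 2)) n).
      - apply sum_Rle. intros k _. assert (Hk := pos_INR k).
        assert (E : ln (nu + h + INR k) - ln (nu + INR k) - / (nu + INR k) * h = ln (1 + h / (nu + INR k)) - h / (nu + INR k)).
        { replace (nu + h + INR k) with ((nu + INR k) * (1 + h / (nu + INR k))) by (field; lra).
          rewrite ln_mult; [unfold Rdiv; ring|lra|].
          assert (- (1 / 2) <= h / (nu + INR k)); [|lra].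
          apply Rmult_le_reg_r with (nu + INR k); [lra|].
          replace (h / (nu + INR k) * (nu + INR k)) with h by (field; lra). lra. }
        rewrite E. replace (/ (nu + INR k) ^ 2 * (2 * h ^ 2)) with (2 * (h / (nu + INR k)) ^ 2) by (field; lra).
        apply ln_1_taylor. unfold Rdiv at 1. rewrite Rabs_mult, Rabs_inv, (Rabs_pos_eq (nu + INR k)) by lra.
        apply Rmult_le_reg_r with (nu + INR k); [lra|]. rewrite Rmult_assoc, Rinv_l by lra. lra.
      - rewrite <- scal_sum. specialize (HS n). replace (2 * S * h ^ 2) with (2 * h ^ 2 * S) by ring.
        apply Rmult_le_compat_l; [|assumption]. generalize (pow2_ge_0 h). lra. }
    assert (Hlim : is_lim_seq (fun m => Rabs (ln (euler (nu + h) (2 * Datatypes.S m)) - ln (euler nu (2 * Datatypes.S m)) -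
       h * (ln (INR (2 * Datatypes.S m)) - dsum nu (2 * Datatypes.S m)))) (Rabs (ln (Gamma (nu + h)) - ln (Gamma nu) - h * L))).
    { apply (is_lim_seq_abs _ (Finite (ln (Gamma (nu + h)) - ln (Gamma nu) - h * L))).
      apply is_lim_seq_minus'; [apply is_lim_seq_minus'; apply Hln; lra|].
      apply (is_lim_seq_scal_l _ h L), HL. }
    apply (is_lim_seq_le _ (fun _ => 2 * S * h ^ 2) _ _ (fun m => HB (2 * Datatypes.S m)%nat) Hlim (is_lim_seq_const _)). }
  assert (HD : is_derive (fun x => ln (Gamma x)) nu L).
  { apply is_derive_Reals. intros eps Heps.
    assert (Hd : 0 < Rmin (nu / 2) (eps / (2 * S + 1))).
    { apply Rmin_glb_lt; [lra|]. apply Rdiv_lt_0_compat; lra. }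
    exists (mkposreal _ Hd). simpl. intros h Hh Hhd.
    assert (H1 : Rabs h < nu / 2) by (eapply Rlt_le_trans; [exact Hhd|apply Rmin_l]).
    assert (H2 : Rabs h < eps / (2 * S + 1)) by (eapply Rlt_le_trans; [exact Hhd|apply Rmin_r]).
    specialize (HT h ltac:(lra)).
    replace ((ln (Gamma (nu + h)) - ln (Gamma nu)) / h - L) with ((ln (Gamma (nu + h)) - ln (Gamma nu) - h * L) / h) by (field; assumption).
    assert (Hha : 0 < Rabs h) by now apply Rabs_pos_lt.
    unfold Rdiv. rewrite Rabs_mult, Rabs_inv. apply Rle_lt_trans with (2 * S * Rabs h).
    - apply Rmult_le_reg_r with (Rabs h); [assumption|]. rewrite Rmult_assoc, Rinv_l, Rmult_1_r by lra.
      eapply Rle_trans; [exact HT|]. rewrite <- (Rabs_pos_eq (h ^ 2)) by apply pow2_ge_0. rewrite <- RPow_abs. right; ring.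
    - apply Rle_lt_trans with ((2 * S + 1) * Rabs h); [nra|].
      replace eps with ((2 * S + 1) * (eps / (2 * S + 1))) by (field; lra). apply Rmult_lt_compat_l; lra. }
  assert (HG : is_derive Gamma nu (L * Gamma nu)).
  { apply is_derive_ext_loc with (fun x => exp (ln (Gamma x))).
    - exists (mkposreal nu Hnu). intros x Hx. change (Rabs (x - nu) < nu) in Hx. apply Rabs_lt_between in Hx.
      apply exp_ln, Gamma_pos. lra.
    - eapply is_derive_replace; [apply (is_derive_comp exp (fun x => ln (Gamma x))); [apply is_derive_exp|exact HD]|].
      change (L * exp (ln (Gamma nu)) = L * Gamma nu). rewrite exp_ln by now apply Gamma_pos. reflexivity. }
  unfold digamma. rewrite (is_derive_unique _ _ _ HG). field. apply Rgt_not_eq, Gamma_pos, Hnu.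
Qed.

Lemma digamma_Kint (nu : R) : 0 < nu -> (forall m : Z, nu <> IZR m) ->
  digamma nu = - (Kint nu / sin (PI * nu)) - / (2 * nu) - PI / 2 * (cos (PI * nu) / sin (PI * nu)) - egamma - ln 2.
Proof.
  intros Hnu Hz. apply digamma_lim; [assumption|]. apply dsum_lim; [assumption|]. now apply sin_PI_neq0.
Qed.

(** * Products of Bessel functions *)

(** Convergence at a point beyond a finite radius would force the terms to tend to 0 there. This
    upgrades the convergence of Cauchy products to absolute convergence. *)
Lemma entire_ex_pseries (a : nat -> R) : (forall x, ex_pseries a x) -> entire a.
Proof.
  intros H. apply radius_entire.
  destruct (CV_radius a) as [r| |] eqn:Er; [exfalso|reflexivity|exfalso].
  - apply (CV_disk_outside a (Rabs r + 1)).
    + rewrite Er. simpl. rewrite (Rabs_pos_eq (Rabs r + 1)); generalize (Rle_abs r) (Rabs_pos r); lra.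
    + apply ex_series_lim_0, ex_pseries_R, H.
  - generalize (CV_radius_ge_0 a). now rewrite Er.
Qed.

Lemma entire_mult (a b : nat -> R) : entire a -> entire b -> entire (PS_mult a b).
Proof.
  intros Ha Hb. apply entire_ex_pseries. intros x. apply ex_pseries_mult; now apply entire_radius.
Qed.

Fixpoint binom (x : R) (k : nat) : R :=
  match k with
  | O => 1
  | S j => binom x j * (x - INR j) / INR (S j)
  end.

(** Multiply by n + 1 = k + (n + 1 - k), lower the index of one factor in each of the two parts by
    [HS], and recombine: the coefficients add up to x + y - n. *)
Lemma Vandermonde (x y : R) (n : nat) :
  sum_f_R0 (fun k => binom x k * binom y (n - k)) n = binom (x + y) n.
Proof.
  induction n as [|n IH]; [simpl; ring|].
  assert (HS : forall z k, INR (S k) * binom z (S k) = (z - INR k) * binom z k).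
  { intros z k. cbn [binom]. field. apply not_0_INR. lia. }
  apply (Rmult_eq_reg_l (INR (S n))); [|apply not_0_INR; lia].
  rewrite HS, <- IH, !scal_sum.
  transitivity (sum_f_R0 (fun k => INR k * (binom x k * binom y (S n - k))) (S n)
    + sum_f_R0 (fun k => INR (S n - k) * (binom x k * binom y (S n - k))) (S n)).
  { rewrite <- plus_sum. apply sum_eq. intros k Hk. rewrite minus_INR by assumption. ring. }
  rewrite (decomp_sum (fun k => INR k * (binom x k * binom y (S n - k)))) by lia.
  rewrite (tech5 (fun k => INR (S n - k) * (binom x k * binom y (S n - k)))).
  rewrite Nat.sub_diag. change (INR 0) with 0. rewrite !Rmult_0_l, Rplus_0_l, Rplus_0_r.
  change (pred (S n)) with n. rewrite <- plus_sum. apply sum_eq. intros k Hk.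
  rewrite Nat.sub_succ. replace (S n - k)%nat with (S (n - k)) by lia.
  transitivity (INR (S k) * binom x (S k) * binom y (n - k) + binom x k * (INR (S (n - k)) * binom y (S (n - k)))); [ring|].
  rewrite !HS, minus_INR by assumption. ring.
Qed.

Lemma poch_neq0 (a : R) (k : nat) : (forall j, a + INR j <> 0) -> poch a k <> 0.
Proof.
  intros H. induction k as [|k IH]; simpl; [lra|]. now apply Rmult_integral_contrapositive_currified.
Qed.

Lemma poch_pos (a : R) (k : nat) : 0 < a -> 0 < poch a k.
Proof.
  intros H. induction k as [|k IH]; simpl; [lra|].
  apply Rmult_lt_0_compat; [assumption|]. generalize (pos_INR k). lra.
Qed.

Lemma poch_binom (a : R) (n j : nat) : (j <= n)%nat ->
  poch (1 + a) n = poch (1 + a) j * (binom (a + INR n) (n - j) * INR (fact (n - j))).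
Proof.
  intros Hj. remember (n - j)%nat as m eqn:Hm. revert j Hj Hm. induction m as [|m IH]; intros j Hj Hm.
  - replace j with n by lia. simpl. ring.
  - rewrite (IH (S j)) by lia. rewrite fact_simpl, mult_INR. cbn [poch binom].
    replace n with (m + S j)%nat by lia. rewrite plus_INR, (S_INR j).
    field. apply not_0_INR. lia.
Qed.

Lemma poch_add (a : R) (m n : nat) : poch a (m + n) = poch a m * poch (a + INR m) n.
Proof.
  induction n as [|n IH]; [rewrite Nat.add_0_r; simpl; ring|].
  rewrite Nat.add_succ_r. simpl. rewrite IH, plus_INR. ring.
Qed.

Lemma poch_double (c : R) (n : nat) : poch (2 * c + 1) (2 * n) = 4 ^ n * poch (c + 1 / 2) n * poch (c + 1) n.
Proof.
  induction n as [|n IH]; [simpl; ring|].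
  replace (2 * S n)%nat with (S (S (2 * n))) by lia. cbn [poch]. rewrite IH, S_INR, mult_INR.
  change (INR 2) with 2. simpl pow. field.
Qed.

Lemma poch_1 (k : nat) : poch 1 k = INR (fact k).
Proof.
  induction k as [|k IH]; [reflexivity|]. rewrite fact_simpl, mult_INR, S_INR. cbn [poch]. rewrite IH. ring.
Qed.

(** Coefficients of the 0F1 series: J_mu(z) is (z/2)^mu / Gamma(mu + 1) times this series at w =
    (z/2)^2. *)
Definition jcoef (mu : R) (k : nat) : R := (-1) ^ k / (INR (fact k) * poch (mu + 1) k).

(** Multiplying by (a + 1)_n (b + 1)_n turns the Cauchy product into Vandermonde's sum for a + n and
    b + n, and [poch_double] factors the resulting binomial coefficient. The half-sum c lets the
    pairs (nu, nu) and (nu, -nu) share one formula. *)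
Lemma jcoef_mult (a b c : R) (n : nat) : a + b = 2 * c ->
  (forall k, a + 1 + INR k <> 0) -> (forall k, b + 1 + INR k <> 0) -> (forall k, 2 * c + 1 + INR k <> 0) ->
  PS_mult (jcoef a) (jcoef b) n =
  (-4) ^ n * poch (c + 1 / 2) n * poch (c + 1) n /
    (poch (2 * c + 1) n * INR (fact n) * poch (a + 1) n * poch (b + 1) n).
Proof.
  intros Hc Ha Hb Hcn.
  assert (Pa := poch_neq0 _ n Ha). assert (Pb := poch_neq0 _ n Hb). assert (Pc := poch_neq0 _ n Hcn).
  assert (F : forall k, INR (fact k) <> 0) by apply INR_fact_neq_0.
  assert (E : PS_mult (jcoef a) (jcoef b) n * (poch (a + 1) n * poch (b + 1) n) = (-1) ^ n * binom (a + b + 2 * INR n) n).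
  { replace (a + b + 2 * INR n) with ((b + INR n) + (a + INR n)) by ring. rewrite <- Vandermonde.
    unfold PS_mult. rewrite scal_sum, (Rmult_comm (sum_f_R0 _ _)), scal_sum.
    apply sum_eq. intros k Hk. unfold jcoef.
    rewrite (Rplus_comm a 1), (Rplus_comm b 1).
    assert (Pak : poch (1 + a) k <> 0) by (rewrite Rplus_comm; now apply poch_neq0).
    assert (Pbk : poch (1 + b) (n - k) <> 0) by (rewrite Rplus_comm; now apply poch_neq0).
    rewrite (poch_binom a n k) by assumption. rewrite (poch_binom b n (n - k)) by lia.
    replace (n - (n - k))%nat with k by lia.
    replace ((-1) ^ n) with ((-1) ^ k * (-1) ^ (n - k)) by (rewrite <- pow_add; f_equal; lia).
    field. auto. }
  assert (E2 : binom (a + b + 2 * INR n) n * INR (fact n) = poch (2 * c + 1 + INR n) n).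
  { replace (2 * c + 1 + INR n) with (1 + (2 * c + INR n)) by ring. rewrite (poch_binom _ n 0) by lia.
    rewrite Nat.sub_0_r. simpl poch. rewrite Rmult_1_l. f_equal. f_equal. rewrite Hc. ring. }
  assert (E3 := poch_double c n). replace (2 * n)%nat with (n + n)%nat in E3 by lia. rewrite poch_add in E3.
  apply (Rmult_eq_reg_r (poch (a + 1) n * poch (b + 1) n)); [|now apply Rmult_integral_contrapositive_currified].
  rewrite E.
  apply (Rmult_eq_reg_r (INR (fact n) * poch (2 * c + 1) n)); [|apply Rmult_integral_contrapositive_currified; auto].
  transitivity ((-1) ^ n * (poch (2 * c + 1) n * (binom (a + b + 2 * INR n) n * INR (fact n)))); [ring|].
  rewrite E2, E3. replace (-4) with (-1 * 4) by ring. rewrite Rpow_mult_distr. field. auto.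
Qed.

Lemma entire_jcoef (mu : R) : (forall k, mu + 1 + INR k <> 0) -> entire (jcoef mu).
Proof.
  intros Hmu. apply entire_ratio.
  - intros n. unfold jcoef. apply Rmult_integral_contrapositive_currified; [apply pow_nonzero; lra|].
    apply Rinv_neq_0_compat, Rmult_integral_contrapositive_currified; [apply INR_fact_neq_0|now apply poch_neq0].
  - apply is_lim_seq_ext with (fun n => Rabs (/ INR (S n) * / (mu + 1 + INR n))).
    + intros n. rewrite <- Rabs_Ropp. f_equal. unfold jcoef. rewrite fact_simpl, mult_INR.
      cbn [poch pow]. assert (P := poch_neq0 _ n Hmu).
      field. repeat split; auto; try apply INR_fact_neq_0; try (apply not_0_INR; lia). apply pow_nonzero. lra.
    + apply (proj1 (is_lim_seq_abs_0 _)).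
      replace (Finite 0) with (Finite (0 * 0)) by (f_equal; ring). apply is_lim_seq_mult'.
      * apply (is_lim_seq_incr_1 (fun n => / INR n)), is_lim_seq_inv_INR.
      * apply (is_lim_seq_inv (fun n => mu + 1 + INR n) p_infty); [|discriminate].
        replace p_infty with (Rbar_plus (Finite (mu + 1)) p_infty) by reflexivity.
        apply is_lim_seq_plus with (Finite (mu + 1)) p_infty; [apply is_lim_seq_const|apply is_lim_seq_INR|reflexivity].
Qed.

Lemma jcoef_ode (mu w : R) : (forall k, mu + 1 + INR k <> 0) ->
  w * PSeries (PS_derive (PS_derive (jcoef mu))) w + (mu + 1) * PSeries (PS_derive (jcoef mu)) w + PSeries (jcoef mu) w = 0.
Proof.
  intros Hmu. assert (He := entire_jcoef mu Hmu). assert (He1 := entire_derive _ He). assert (He2 := entire_derive _ He1).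
  assert (E1 : w * PSeries (PS_derive (PS_derive (jcoef mu))) w = Series (fun k => INR k * PS_derive (jcoef mu) k * w ^ k)).
  { rewrite (Series_incr_1_aux (fun k => INR k * PS_derive (jcoef mu) k * w ^ k)) by (simpl; ring).
    unfold PSeries. rewrite <- Series_scal_l. apply Series_ext. intros k. unfold PS_derive at 1. simpl pow. ring. }
  rewrite E1. unfold PSeries. rewrite <- Series_scal_l.
  assert (X1 : ex_series (fun k => INR k * PS_derive (jcoef mu) k * w ^ k)).
  { apply ex_series_incr_1. apply ex_series_ext with (fun k => w * (PS_derive (PS_derive (jcoef mu)) k * w ^ k)).
    - intros k. unfold PS_derive at 1. simpl pow. Rring.
    - apply ex_series_Rscal, ex_series_entire, He2. }
  assert (X2 : ex_series (fun k => (mu + 1) * (PS_derive (jcoef mu) k * w ^ k))).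
  { apply ex_series_Rscal, ex_series_entire, He1. }
  rewrite <- Series_plus by assumption. rewrite <- Series_plus.
  2: { apply (ex_series_plus (K := R_AbsRing) (V := R_NormedModule)); assumption. }
  2: { apply ex_series_entire, He. }
  replace 0 with (Series (fun k : nat => 0 * 0)) by (rewrite Series_scal_l; ring).
  apply Series_ext. intros k. unfold PS_derive, jcoef. rewrite fact_simpl, mult_INR. cbn [pow poch].
  assert (P := poch_neq0 _ k Hmu). assert (F := INR_fact_neq_0 k). assert (N : INR (S k) <> 0) by (apply not_0_INR; lia).
  field. auto.
Qed.

(* [Jr mu] is [J_mu] on the positive real axis, up to the factor [Gamma (mu + 1)]. *)
Definition Jr (mu x : R) : R := Rpower (x / 2) mu * PSeries (jcoef mu) (x ^ 2 / 4).

(** A Gronwall argument: the energy of sqrt x * Jr changes at the integrable relative rate |c| /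
    x^2, hence stays bounded, and it dominates x * Jr^2. *)
Lemma Jr_decay (mu : R) : (forall k, mu + 1 + INR k <> 0) ->
  exists C, forall x, 1 <= x -> x * Jr mu x ^ 2 <= C.
Proof.
  intros Hmu. assert (He := entire_jcoef mu Hmu). assert (He1 := entire_derive _ He).
  set (s := PSeries (jcoef mu)). set (s1 := PSeries (PS_derive (jcoef mu))).
  set (s2 := PSeries (PS_derive (PS_derive (jcoef mu)))).
  set (W := fun x => x ^ 2 / 4).
  (* [y] is x times the derivative of [Jr mu]; in this form Bessel's equation is of first order. *)
  set (y := fun x => Rpower (x / 2) mu * (mu * s (W x) + 2 * W x * s1 (W x))).
  assert (HP : forall x, 0 < x -> is_derive (fun x => Rpower (x / 2) mu) x (mu * Rpower (x / 2) mu / x)).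
  { intros x Hx. unfold Rpower. auto_derive; [lra|]. unfold Rdiv. field. lra. }
  assert (HW : forall x, is_derive W x (x / 2)).
  { intros x. unfold W. auto_derive; [exact I|]. field. }
  assert (Hsd : forall x, is_derive (fun x => s (W x)) x (x / 2 * s1 (W x))).
  { intros x. apply (is_derive_comp s W); [apply is_derive_entire, He|apply HW]. }
  assert (Hs1d : forall x, is_derive (fun x => s1 (W x)) x (x / 2 * s2 (W x))).
  { intros x. apply (is_derive_comp s1 W); [apply is_derive_entire, He1|apply HW]. }
  assert (HJ : forall x, 0 < x -> is_derive (Jr mu) x (y x / x)).
  { intros x Hx. eapply is_derive_replace.
    - apply (is_derive_mult (fun x => Rpower (x / 2) mu) (fun x => s (W x))); [now apply HP|apply Hsd|intros; apply Rmult_comm].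
    - change (mu * Rpower (x / 2) mu / x * s (W x) + Rpower (x / 2) mu * (x / 2 * s1 (W x)) = y x / x).
      unfold y. replace (2 * W x) with (x * (x / 2)) by (unfold W; field). field. lra. }
  assert (Hy : forall x, 0 < x -> is_derive y x ((mu ^ 2 - x ^ 2) * Jr mu x / x)).
  { intros x Hx. eapply is_derive_replace.
    - apply (is_derive_mult (fun x => Rpower (x / 2) mu) (fun x => mu * s (W x) + 2 * W x * s1 (W x))); [now apply HP| |intros; apply Rmult_comm].
      apply (is_derive_plus (fun x => mu * s (W x)) (fun x => 2 * W x * s1 (W x))).
      + apply is_derive_scal, Hsd.
      + apply (is_derive_mult (fun x => 2 * W x) (fun x => s1 (W x))); [apply is_derive_scal, HW|apply Hs1d|intros; apply Rmult_comm].
    - change (mu * Rpower (x / 2) mu / x * (mu * s (W x) + 2 * W x * s1 (W x)) +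
        Rpower (x / 2) mu * (mu * (x / 2 * s1 (W x)) + (2 * (x / 2) * s1 (W x) + 2 * W x * (x / 2 * s2 (W x)))) =
        (mu ^ 2 - x ^ 2) * (Rpower (x / 2) mu * s (W x)) / x).
      assert (E := jcoef_ode mu (W x) Hmu). fold s s1 s2 in E.
      replace (2 * W x * (x / 2 * s2 (W x))) with (x * (W x * s2 (W x))) by field.
      replace (W x * s2 (W x)) with (- ((mu + 1) * s1 (W x)) - s (W x)) by (unfold s, s1, s2 in *; lra).
      set (S0 := s (W x)). set (S1 := s1 (W x)). unfold W. field. lra. }
  (* With v = sqrt x * Jr, Bessel's equation reads v'' = (c / x^2 - 1) v, and [H] is v^2 + v'^2. *)
  set (c := mu ^ 2 - 1 / 4).
  set (H := fun x => x * Jr mu x ^ 2 + (y x + Jr mu x / 2) ^ 2 / x).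
  assert (HH : forall x, 0 < x -> is_derive H x (2 * c * Jr mu x * (y x + Jr mu x / 2) / x ^ 2)).
  { intros x Hx. eapply is_derive_replace.
    - apply (is_derive_plus (fun x => x * Jr mu x ^ 2) (fun x => (y x + Jr mu x / 2) ^ 2 / x)).
      + apply (is_derive_mult (fun x => x) (fun x => Jr mu x ^ 2)); [apply is_derive_id| |intros; apply Rmult_comm].
        apply (is_derive_pow (Jr mu) 2), HJ, Hx.
      + apply (is_derive_div (fun x => (y x + Jr mu x / 2) ^ 2) (fun x => x)); [|apply is_derive_id|lra].
        apply (is_derive_pow (fun x => y x + Jr mu x / 2) 2).
        apply (is_derive_plus y (fun x => Jr mu x / 2)); [apply Hy, Hx|].
        apply (is_derive_scal_l (K := R_AbsRing) (V := R_NormedModule) (Jr mu) x), HJ, Hx.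
    - unfold scal, plus, mult, one; simpl; unfold mult, one; simpl. unfold c. field. lra. }
  (* The estimate 2 |u v| <= x u^2 + v^2 / x, from the squares of x u - v and x u + v. *)
  assert (HHb : forall x, 0 < x -> Rabs (2 * c * Jr mu x * (y x + Jr mu x / 2) / x ^ 2) <= Rabs c * H x / x ^ 2).
  { intros x Hx. unfold Rdiv. rewrite Rabs_mult, (Rabs_pos_eq (/ x ^ 2)).
    2: { left. apply Rinv_0_lt_compat. now apply pow_lt. }
    apply Rmult_le_compat_r; [left; apply Rinv_0_lt_compat; now apply pow_lt|].
    replace (2 * c * Jr mu x * (y x + Jr mu x * / 2)) with (c * (2 * Jr mu x * (y x + Jr mu x / 2))) by (unfold Rdiv; ring).
    rewrite Rabs_mult. apply Rmult_le_compat_l; [apply Rabs_pos|]. unfold H.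
    set (u := Jr mu x). set (v := y x + u / 2).
    assert (Hp : 0 <= (x * u - v) ^ 2 / x /\ 0 <= (x * u + v) ^ 2 / x).
    { split; apply Rdiv_le_0_compat; try lra; apply pow2_ge_0. }
    replace ((x * u - v) ^ 2 / x) with (x * u ^ 2 + v ^ 2 / x - 2 * u * v) in Hp by (field; lra).
    replace ((x * u + v) ^ 2 / x) with (x * u ^ 2 + v ^ 2 / x + 2 * u * v) in Hp by (field; lra).
    apply Rabs_le_between. lra. }
  assert (HH0 : forall x, 0 < x -> x * Jr mu x ^ 2 <= H x /\ 0 <= H x).
  { intros x Hx. unfold H. assert (0 <= (y x + Jr mu x / 2) ^ 2 / x) by (apply Rdiv_le_0_compat; [apply pow2_ge_0|lra]).
    assert (0 <= x * Jr mu x ^ 2) by (apply Rmult_le_pos; [lra|apply pow2_ge_0]). lra. }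
  (* The integrating factor has logarithmic derivative - |c| / x^2, so [E] is nonincreasing; being
     at least 1, it allows [E 1] as the constant. *)
  set (E := fun x => H x * exp (Rabs c / x)).
  assert (HE : forall x, 0 < x -> is_derive E x ((2 * c * Jr mu x * (y x + Jr mu x / 2) / x ^ 2 - Rabs c * H x / x ^ 2) * exp (Rabs c / x))).
  { intros x Hx. eapply is_derive_replace.
    - apply (is_derive_mult H (fun x => exp (Rabs c / x))); [now apply HH| |intros; apply Rmult_comm].
      instantiate (1 := - (Rabs c / x ^ 2) * exp (Rabs c / x)). auto_derive; [lra|]. unfold Rdiv. field. lra.
    - unfold plus, mult; simpl. unfold Rdiv. field. lra. }
  assert (Hdec : forall x, 1 <= x -> E x <= E 1).
  { intros x Hx. destruct (Req_dec x 1) as [->|Hne]; [lra|].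
    destruct (MVT_gen E 1 x (fun x => (2 * c * Jr mu x * (y x + Jr mu x / 2) / x ^ 2 - Rabs c * H x / x ^ 2) * exp (Rabs c / x))) as [z [Hz1 Hz2]].
    - intros z Hz. rewrite Rmin_left in Hz by lra. apply HE. lra.
    - intros z Hz. rewrite Rmin_left in Hz by lra. apply continuity_pt_filterlim.
      apply (ex_derive_continuous E). eexists. apply HE. lra.
    - rewrite Rmin_left, Rmax_right in Hz1 by lra.
      assert (B := HHb z ltac:(lra)). apply Rabs_le_between in B. assert (Hex := exp_pos (Rabs c / z)).
      assert ((2 * c * Jr mu z * (y z + Jr mu z / 2) / z ^ 2 - Rabs c * H z / z ^ 2) * exp (Rabs c / z) <= 0) by nra.
      nra. }
  exists (E 1). intros x Hx. apply Rle_trans with (E x); [|now apply Hdec].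
  destruct (HH0 x ltac:(lra)) as [B1 B2]. unfold E.
  assert (Hex : 1 <= exp (Rabs c / x)).
  { assert (0 <= Rabs c / x) by (apply Rdiv_le_0_compat; [apply Rabs_pos|lra]). generalize (exp_ineq1_le (Rabs c / x)). lra. }
  nra.
Qed.

(** * Laplace averages *)

Lemma abs_RInt_le_fun (f g : R -> R) (a b lg : R) :
  a <= b -> ex_RInt f a b -> is_RInt g a b lg -> (forall x, a <= x <= b -> Rabs (f x) <= g x) ->
  Rabs (RInt f a b) <= lg.
Proof.
  intros Hab Hf Hg H.
  apply (norm_RInt_le (V := R_NormedModule) f g a b); try assumption.
  apply (RInt_correct (V := R_CompleteNormedModule)), Hf.
Qed.

Lemma bounded_of_lim (f : R -> R) (l : R) : (forall x, continuous f x) -> is_lim f p_infty l ->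
  exists M, 0 < M /\ forall x, 0 <= x -> Rabs (f x - l) <= M.
Proof.
  intros Hc Hl. apply is_lim_spec in Hl. destruct (Hl (mkposreal 1 Rlt_0_1)) as [U HU]. simpl in HU.
  destruct (continuous_bounded (fun x => f x - l) 0 (Rmax 0 U + 1)) as [M [HM0 HM]].
  - generalize (Rmax_l 0 U). lra.
  - intros x _. apply continuous_Rminus; [apply Hc|apply continuous_const].
  - exists (M + 1). split; [lra|]. intros x Hx. destruct (Rle_dec x (Rmax 0 U + 1)) as [H|H].
    + specialize (HM x (conj Hx H)). lra.
    + assert (U < x) by (generalize (Rmax_r 0 U); lra). specialize (HU x H0). lra.
Qed.

Lemma is_RInt_exp_opp (a b : R) : is_RInt (fun t => exp (- t)) a b (exp (- a) - exp (- b)).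
Proof.
  apply (is_RInt_replace _ _ _ (- exp (- b) - - exp (- a))); [|ring].
  apply (is_RInt_Rderive (fun t => - exp (- t))).
  - intros x. auto_derive; [exact I|ring].
  - apply continuous_exp_opp.
Qed.

(** The density exp(-t) has total mass 1, and the part t < U / y, where f(y t) may still be far from
    l, has mass at most U / y. Splitting the integral there bounds the error uniformly in the upper
    end T. *)
Lemma abel_laplace (f F : R -> R) (l : R) :
  (forall x, continuous f x) -> is_lim f p_infty l ->
  (forall y, 0 < y -> is_lim (fun T => RInt (fun t => exp (- t) * f (y * t)) 0 T) p_infty (F y)) ->
  is_lim F p_infty l.
Proof.
  intros Hc Hl HF. destruct (bounded_of_lim f l Hc Hl) as [M [HM0 HM]].
  apply is_lim_spec. intros eps.
  assert (He : 0 < eps / 4) by (destruct eps; simpl; lra).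
  assert (Hl' := proj2 (is_lim_spec _ _ _) Hl (mkposreal _ He)). destruct Hl' as [U0 HU0]. simpl in HU0.
  set (U := Rmax 0 U0 + 1). assert (HU : 0 < U) by (unfold U; generalize (Rmax_l 0 U0); lra).
  assert (HU' : forall x, U <= x -> Rabs (f x - l) <= eps / 4).
  { intros x Hx. left. apply HU0. unfold U in Hx. generalize (Rmax_r 0 U0). lra. }
  exists (4 * M * U / eps). intros y Hy.
  assert (Hep := cond_pos eps).
  assert (Hy0 : 0 < y).
  { eapply Rle_lt_trans; [|exact Hy]. apply Rdiv_le_0_compat; [|assumption]. nra. }
  assert (HMU : M * (U / y) <= eps / 4).
  { apply Rmult_le_reg_r with (4 * y / eps); [apply Rdiv_lt_0_compat; lra|].
    replace (M * (U / y) * (4 * y / eps)) with (4 * M * U / eps) by (field; lra).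
    replace (eps / 4 * (4 * y / eps)) with y by (field; lra). lra. }
  set (g := fun t => exp (- t) * (f (y * t) - l)).
  assert (Hg : forall t, continuous g t).
  { intros t. apply continuous_Rmult; [apply continuous_exp_opp|]. apply continuous_Rminus; [|apply continuous_const].
    apply (continuous_comp (fun t => y * t) f); [solve_continuous|apply Hc]. }
  assert (Hbound : forall T, U / y <= T -> Rabs (RInt g 0 T) <= eps / 2).
  { intros T HT. assert (HUy : 0 < U / y) by now apply Rdiv_lt_0_compat.
    rewrite <- (RInt_Chasles (V := R_CompleteNormedModule) g 0 (U / y) T) by now apply ex_RInt_cont_all.
    change (Rabs (RInt g 0 (U / y) + RInt g (U / y) T) <= eps / 2).
    eapply Rle_trans; [apply Rabs_triang|]. replace (eps / 2) with (eps / 4 + eps / 4) by field.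
    apply Rplus_le_compat.
    - eapply Rle_trans; [|exact HMU]. rewrite Rmult_comm. rewrite <- (Rminus_0_r (U / y)) at 2.
      apply abs_RInt_bound; [lra|now apply ex_RInt_cont_all|].
      intros t Ht. unfold g. rewrite Rabs_mult. rewrite <- (Rmult_1_l M).
      apply Rmult_le_compat; try apply Rabs_pos.
      + rewrite Rabs_pos_eq by (left; apply exp_pos). rewrite <- exp_0.
        destruct (Req_dec t 0) as [->|Hne]; [rewrite Ropp_0; lra|]. left. apply exp_increasing. lra.
      + apply HM. apply Rmult_le_pos; lra.
    - eapply Rle_trans.
      + apply abs_RInt_le_fun with (g := fun t => eps / 4 * exp (- t)).
        * assumption.
        * now apply ex_RInt_cont_all.
        * exact (is_RInt_Rscal (eps / 4) (is_RInt_exp_opp _ _)).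
        * intros t Ht. unfold g. rewrite Rabs_mult, (Rabs_pos_eq (exp _)) by (left; apply exp_pos).
          rewrite Rmult_comm. apply Rmult_le_compat_r; [left; apply exp_pos|]. apply HU'.
          apply Rmult_le_reg_r with (/ y); [now apply Rinv_0_lt_compat|].
          replace (y * t * / y) with t by (field; lra). lra.
      + change (eps / 4 * (exp (- (U / y)) - exp (- T)) <= eps / 4).
        assert (0 < exp (- T)) by apply exp_pos.
        assert (exp (- (U / y)) <= 1) by (rewrite <- exp_0; left; apply exp_increasing; lra). nra. }
  assert (HD : is_lim (fun T => Rabs (RInt g 0 T)) p_infty (Rabs (F y - l))).
  { apply is_lim_ext with (fun T => Rabs (RInt (fun t => exp (- t) * f (y * t)) 0 T - l * (1 - exp (- (1 * T))))).
    - intros T. f_equal. symmetry. apply is_RInt_Runique.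
      apply is_RInt_ext with (fun t => exp (- t) * f (y * t) - l * exp (- t)).
      + intros t _. unfold g. Rring.
      + apply is_RInt_Rminus.
        * apply RInt_cont_correct. intros t.
          apply continuous_Rmult; [apply continuous_exp_opp|]. apply (continuous_comp (fun t => y * t) f); [solve_continuous|apply Hc].
        * apply is_RInt_Rscal. rewrite Rmult_1_l.
          eapply is_RInt_replace; [apply is_RInt_exp_opp|]. now rewrite Ropp_0, exp_0.
    - apply (is_lim_Rabs _ p_infty (Finite (F y - l))).
      replace (Finite (F y - l)) with (Finite (F y - l * (1 - 0))) by (f_equal; ring).
      apply is_lim_minus'; [now apply HF|].
      apply (is_lim_scal_l (fun T => 1 - exp (- (1 * T))) l p_infty (1 - 0)).
      apply is_lim_minus'; [apply is_lim_const|]. apply is_lim_exp_neg. lra. }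
  assert (HDle : Rbar_le (Rabs (F y - l)) (eps / 2)).
  { refine (is_lim_le_loc _ (fun _ => eps / 2) p_infty _ _ _ HD (is_lim_const _ _)).
    exists (U / y). intros T HT. apply Hbound. lra. }
  simpl in HDle. lra.
Qed.

(** On [0, T] the integration is termwise by [RInt_entire_comp]. A nonnegative kernel keeps the
    truncated moments below the full ones, so the summability hypothesis is exactly a dominating
    series for T -> oo. *)
Lemma laplace_series (kap : R -> R) (c m : nat -> R) (y : R) :
  (forall t, continuous kap t) -> (forall t, 0 <= t -> 0 <= kap t) -> entire c -> 0 <= y ->
  (forall k, is_lim (fun T => RInt (fun t => kap t * t ^ k) 0 T) p_infty (m k)) ->
  ex_series (fun k => Rabs (c k) * y ^ k * m k) ->
  is_lim (fun T => RInt (fun t => kap t * PSeries c (y * t)) 0 T) p_infty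
    (Series (fun k => c k * y ^ k * m k)).
Proof.
  intros Hk Hk0 Hc Hy Hm Hs.
  assert (Hcont : forall k t, continuous (fun t => kap t * t ^ k) t).
  { intros k t. apply continuous_Rmult; [apply Hk|]. solve_continuous. }
  assert (Hpos : forall k a b, 0 <= a <= b -> 0 <= RInt (fun t => kap t * t ^ k) a b).
  { intros k a b Hab. apply RInt_ge_0; [lra|now apply ex_RInt_cont_all|].
    intros t Ht. apply Rmult_le_pos; [apply Hk0; lra|apply pow_le; lra]. }
  assert (Hle : forall k T, 0 <= T -> 0 <= RInt (fun t => kap t * t ^ k) 0 T <= m k).
  { intros k T HT. split; [apply Hpos; lra|].
    refine (is_lim_le_loc (fun _ => RInt (fun t => kap t * t ^ k) 0 T) (fun T => RInt (fun t => kap t * t ^ k) 0 T)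
      p_infty _ _ _ (is_lim_const _ _) (Hm k)).
    exists T. intros T' HT'.
    rewrite <- (RInt_Chasles (V := R_CompleteNormedModule) (fun t => kap t * t ^ k) 0 T T') by now apply ex_RInt_cont_all.
    change (RInt (fun t => kap t * t ^ k) 0 T <= RInt (fun t => kap t * t ^ k) 0 T + RInt (fun t => kap t * t ^ k) T T').
    assert (H := Hpos k T T' ltac:(lra)). lra. }
  apply is_lim_ext_loc with (fun T => Series (fun k => c k * y ^ k * RInt (fun t => kap t * t ^ k) 0 T)).
  - exists 0. intros T HT.
    assert (H := RInt_entire_comp c kap (fun t => y * t) 0 T ltac:(lra) Hc (fun t _ => Hk t) ltac:(intros x _; solve_continuous)).
    rewrite <- (is_series_unique _ _ H). apply Series_ext. intros k. rewrite Rmult_assoc. f_equal.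
    transitivity (RInt (fun t => y ^ k * (kap t * t ^ k)) 0 T).
    { symmetry. apply (RInt_scal (V := R_CompleteNormedModule) (fun t => kap t * t ^ k) 0 T (y ^ k)). now apply ex_RInt_cont_all. }
    apply RInt_ext. intros t _. change (y ^ k * (kap t * t ^ k) = kap t * (y * t) ^ k). rewrite Rpow_mult_distr. ring.
  - apply (series_dominated (Rbar_locally p_infty) (fun k T => c k * y ^ k * RInt (fun t => kap t * t ^ k) 0 T)
      (fun k => c k * y ^ k * m k) (fun k => Rabs (c k) * y ^ k * m k)).
    + exact Hs.
    + exists 0. intros T HT k. assert (Hp : 0 <= y ^ k) by now apply pow_le.
      destruct (Hle k T ltac:(lra)) as [B1 B2].
      rewrite !Rabs_mult, (Rabs_pos_eq (y ^ k)), (Rabs_pos_eq (RInt _ _ _)) by assumption.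
      apply Rmult_le_compat_l; [|assumption]. apply Rmult_le_pos; [apply Rabs_pos|assumption].
    + intros k. apply (is_lim_scal_l (fun T => RInt (fun t => kap t * t ^ k) 0 T) (c k * y ^ k) p_infty (m k)), Hm.
Qed.

Lemma RInt_exp_pow_lim (k : nat) :
  is_lim (fun T => RInt (fun t => exp (- t) * t ^ k) 0 T) p_infty (INR (fact k)).
Proof.
  induction k as [|k IH].
  - apply is_lim_ext with (fun T => 1 - exp (- (1 * T))).
    + intros T. symmetry. apply is_RInt_Runique.
      apply is_RInt_ext with (fun t => exp (- t)).
      { intros t _. simpl. Rring. }
      rewrite Rmult_1_l. eapply is_RInt_replace; [apply is_RInt_exp_opp|]. now rewrite Ropp_0, exp_0.
    + simpl. replace (Finite 1) with (Finite (1 - 0)) by (f_equal; ring).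
      apply is_lim_minus'; [apply is_lim_const|]. apply is_lim_exp_neg. lra.
  - apply is_lim_ext_loc with (fun T => INR (S k) * RInt (fun t => exp (- t) * t ^ k) 0 T - pw (INR (S k)) T * exp (- T)).
    + exists 0. intros T HT.
      assert (H1 : is_RInt (fun t => INR (S k) * (exp (- t) * t ^ k) - exp (- t) * t ^ S k) 0 T
        (exp (- T) * T ^ S k - exp (- 0) * 0 ^ S k)).
      { apply (is_RInt_Rderive (fun t => exp (- t) * t ^ S k)).
        - intros t. eapply is_derive_replace.
          + apply (is_derive_mult (fun t => exp (- t)) (fun t => t ^ S k)).
            * instantiate (1 := - exp (- t)). auto_derive; [exact I|ring].
            * instantiate (1 := INR (S k) * t ^ k). auto_derive; [exact I|].
              change (1 * (INR (S k) * t ^ k) = INR (S k) * t ^ k). ring.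
            * intros; apply Rmult_comm.
          + change (- exp (- t) * t ^ S k + exp (- t) * (INR (S k) * t ^ k) = INR (S k) * (exp (- t) * t ^ k) - exp (- t) * t ^ S k). ring.
        - intros t. solve_continuous. }
      assert (H2 : is_RInt (fun t => exp (- t) * t ^ k) 0 T (RInt (fun t => exp (- t) * t ^ k) 0 T)).
      { apply RInt_cont_correct. intros t. solve_continuous. }
      assert (H3 := is_RInt_Rminus
         (is_RInt_Rscal (INR (S k)) H2) H1).
      symmetry. apply is_RInt_Runique.
      eapply is_RInt_replace; [eapply is_RInt_ext; [|exact H3]|].
      * intros t _. change (INR (S k) * (exp (- t) * t ^ k) - (INR (S k) * (exp (- t) * t ^ k) - exp (- t) * t ^ S k) = exp (- t) * t ^ S k). ring.
      * change (INR (S k) * RInt (fun t => exp (- t) * t ^ k) 0 T - (exp (- T) * T ^ S k - exp (- 0) * 0 ^ S k) =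
          INR (S k) * RInt (fun t => exp (- t) * t ^ k) 0 T - pw (INR (S k)) T * exp (- T)).
        rewrite pw_pos, Rpower_pow, (pow_ne_zero (S k)) by (lra || lia). ring.
    + rewrite fact_simpl, mult_INR. replace (Finite (INR (S k) * INR (fact k))) with (Finite (INR (S k) * INR (fact k) - 0)) by (f_equal; ring).
      apply is_lim_minus'.
      * apply (is_lim_scal_l (fun T => RInt (fun t => exp (- t) * t ^ k) 0 T) (INR (S k)) p_infty (INR (fact k))), IH.
      * apply pw_exp_lim. apply lt_0_INR. lia.
Qed.

Lemma GI_poch (nu : R) (k : nat) : 0 < nu -> GI (nu + INR k) = GI nu * poch (nu + 1) k.
Proof.
  intros Hnu. induction k as [|k IH]; [simpl; rewrite Rplus_0_r; ring|].
  rewrite S_INR. replace (nu + (INR k + 1)) with (nu + INR k + 1) by ring.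
  rewrite GI_S, IH by (generalize (pos_INR k); lra). cbn [poch]. ring.
Qed.

Lemma RInt_pw_exp_pow_lim (nu : R) (k : nat) : 0 < nu ->
  is_lim (fun T => RInt (fun t => pw nu t * exp (- t) * t ^ k) 0 T) p_infty (GI nu * poch (nu + 1) k).
Proof.
  intros Hnu. rewrite <- GI_poch by assumption. apply is_lim_ext_loc with (gint (nu + INR k)).
  - exists 0. intros T HT. unfold gint. apply RInt_ext. intros t Ht. rewrite Rmin_left in Ht by lra.
    rewrite pw_nat by lra. Rring.
  - apply GI_spec. generalize (pos_INR k). lra.
Qed.

(** Off a short interval [0, d] the argument 4 y sin^2 x is uniformly large and [r] is small; on
    [0, d] boundedness suffices. *)
Lemma RInt_concentrate (h r : R -> R) :
  (forall x, continuous h x) -> (forall x, continuous r x) -> is_lim r p_infty 0 ->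
  is_lim (fun y => RInt (fun x => h x * r (4 * y * sin x ^ 2)) 0 (PI / 2)) p_infty 0.
Proof.
  intros Hh Hr Hl. assert (HP := PI_RGT_0).
  destruct (bounded_of_lim r 0 Hr Hl) as [M [HM0 HM]].
  destruct (continuous_bounded h 0 (PI / 2)) as [N [HN0 HN]]; [lra|auto|].
  apply is_lim_spec. intros eps. assert (Hep := cond_pos eps).
  (* [0, d] then contributes at most eps / 4, and the rest at most 2 N e <= eps / 2 since PI / 2 <=
     2. Using N + 1 for N admits N = 0 in the denominators. *)
  set (d := Rmin (PI / 4) (eps / (4 * (M * (N + 1))))).
  assert (HMN : 0 < M * (N + 1)) by nra.
  assert (Hd : 0 < d). { apply Rmin_glb_lt; [lra|]. apply Rdiv_lt_0_compat; lra. }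
  assert (Hd1 : d <= PI / 4) by apply Rmin_l.
  assert (Hd2 : d * (M * (N + 1)) <= eps / 4).
  { apply Rle_trans with (eps / (4 * (M * (N + 1))) * (M * (N + 1))).
    - apply Rmult_le_compat_r; [lra|apply Rmin_r].
    - right. field. lra. }
  set (e := eps / (4 * (N + 1))). assert (He : 0 < e) by (apply Rdiv_lt_0_compat; lra).
  assert (Hl' := proj2 (is_lim_spec _ _ _) Hl (mkposreal _ He)). destruct Hl' as [U0 HU0]. simpl in HU0.
  set (U := Rmax 0 U0 + 1). assert (HU : 0 < U) by (unfold U; generalize (Rmax_l 0 U0); lra).
  assert (Hsd : 0 < sin d) by (apply sin_gt_0; lra).
  exists (U / sin d ^ 2). intros y Hy. rewrite Rminus_0_r.
  assert (Hsd2 : 0 < sin d ^ 2) by now apply pow_lt.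
  assert (Hy0 : 0 < y). { eapply Rlt_trans; [|exact Hy]. now apply Rdiv_lt_0_compat. }
  set (g := fun x => h x * r (4 * y * sin x ^ 2)).
  assert (Hg : forall x, continuous g x).
  { intros x. apply continuous_Rmult; [apply Hh|]. apply (continuous_comp (fun x => 4 * y * sin x ^ 2) r); [solve_continuous|apply Hr]. }
  rewrite <- (RInt_Chasles (V := R_CompleteNormedModule) g 0 d (PI / 2)) by now apply ex_RInt_cont_all.
  change (Rabs (RInt g 0 d + RInt g d (PI / 2)) < eps).
  assert (Hnn : forall x, 0 <= 4 * y * sin x ^ 2).
  { intros x. apply Rmult_le_pos; [lra|apply pow2_ge_0]. }
  assert (B1 : Rabs (RInt g 0 d) <= (d - 0) * (N * M)).
  { apply abs_RInt_bound; [lra|now apply ex_RInt_cont_all|]. intros x Hx. unfold g. rewrite Rabs_mult.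
    apply Rmult_le_compat; try apply Rabs_pos; [apply HN; lra|].
    rewrite <- (Rminus_0_r (r (4 * y * sin x ^ 2))). apply HM, Hnn. }
  assert (B2 : Rabs (RInt g d (PI / 2)) <= (PI / 2 - d) * (N * e)).
  { apply abs_RInt_bound; [lra|now apply ex_RInt_cont_all|]. intros x Hx. unfold g. rewrite Rabs_mult.
    apply Rmult_le_compat; try apply Rabs_pos; [apply HN; lra|].
    rewrite <- (Rminus_0_r (r (4 * y * sin x ^ 2))). left. apply HU0.
    assert (Hs : sin d <= sin x) by (apply sin_incr_1; lra).
    assert (Hs2 : sin d ^ 2 <= sin x ^ 2) by (apply pow_incr; lra).
    assert (U < y * sin d ^ 2).
    { apply (Rmult_lt_compat_r (sin d ^ 2)) in Hy; [|assumption].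
      replace (U / sin d ^ 2 * sin d ^ 2) with U in Hy by (field; lra). exact Hy. }
    assert (y * sin d ^ 2 <= y * sin x ^ 2) by (apply Rmult_le_compat_l; lra).
    assert (U0 < U) by (unfold U; generalize (Rmax_r 0 U0); lra). lra. }
  eapply Rle_lt_trans; [apply Rabs_triang|].
  assert (H4 := PI_4).
  assert (H1 : (PI / 2 - d) * (N * e) <= 2 * (N * e)).
  { apply Rmult_le_compat_r; [apply Rmult_le_pos; lra|lra]. }
  assert (H2 : N * e <= eps / 4).
  { unfold e. apply Rmult_le_reg_r with (4 * (N + 1)); [lra|].
    replace (N * (eps / (4 * (N + 1))) * (4 * (N + 1))) with (N * eps) by (field; lra).
    replace (eps / 4 * (4 * (N + 1))) with (eps * N + eps) by field. lra. }
  assert (H3 : (d - 0) * (N * M) <= d * (M * (N + 1))) by nra. lra.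
Qed.

Lemma is_lim_of_quarter_sq (f : R -> R) (l : R) :
  is_lim (fun x => f (x ^ 2 / 4)) p_infty l -> is_lim f p_infty l.
Proof.
  intros H. apply is_lim_ext_loc with (fun w => f ((2 * sqrt w) ^ 2 / 4)).
  - exists 0. intros w Hw. f_equal. rewrite Rpow_mult_distr, pow2_sqrt by lra. field.
  - apply (is_lim_comp (fun x => f (x ^ 2 / 4)) (fun w => 2 * sqrt w) p_infty l p_infty); [assumption| |exists 0; intros; discriminate].
    apply is_lim_spec. intros M. exists ((Rabs M) ^ 2). intros w Hw.
    assert (H0 := Rabs_pos M). assert (Hs : Rabs M < sqrt w).
    { rewrite <- (sqrt_pow2 (Rabs M)) by assumption. apply sqrt_lt_1; nra. }
    generalize (Rle_abs M). lra.
Qed.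

(** * Limits of the two series on the positive axis *)

(* Up to powers and Gamma factors, [Acoef] and [Dcoef] are the coefficients of J_nu^2 and J_nu J_{-nu}
   in w = (z/2)^2, and [pcoef] and [qcoef] those of the 2F3 and of the 3F4 times z^2 / (4 (1 - nu^2)). *)
Definition Acoef (nu : R) : nat -> R := PS_mult (jcoef nu) (jcoef nu).
Definition Dcoef (nu : R) : nat -> R := PS_mult (jcoef nu) (jcoef (- nu)).
Definition pcoef (nu : R) (k : nat) : R := nu / (nu + INR k) * Acoef nu k.
Definition qcoef (nu : R) (k : nat) : R :=
  match k with O => 0 | S _ => - Dcoef nu k / (2 * INR k) end.

Lemma plus_1_INR_neq0_pos (nu : R) : 0 < nu -> forall k, nu + 1 + INR k <> 0.
Proof. intros H k. generalize (pos_INR k). lra. Qed.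

Lemma plus_1_INR_neq0 (nu : R) : (forall m : Z, nu <> IZR m) -> forall k, nu + 1 + INR k <> 0.
Proof.
  intros H k. replace (nu + 1 + INR k) with (nu + INR (S k)) by (rewrite S_INR; ring).
  now apply nonint_INR.
Qed.

Lemma nonint_opp (nu : R) : (forall m : Z, nu <> IZR m) -> forall m : Z, - nu <> IZR m.
Proof. intros H m E. apply (H (- m)%Z). rewrite opp_IZR. lra. Qed.

Lemma Acoef_eq (nu : R) (k : nat) : 0 < nu ->
  Acoef nu k = (-4) ^ k * poch (nu + 1 / 2) k / (poch (2 * nu + 1) k * INR (fact k) * poch (nu + 1) k).
Proof.
  intros Hnu. unfold Acoef. rewrite (jcoef_mult nu nu nu); [|ring|now apply plus_1_INR_neq0_pos|now apply plus_1_INR_neq0_pos|].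
  - field. repeat split; try apply INR_fact_neq_0; apply Rgt_not_eq, poch_pos; lra.
  - intros j. generalize (pos_INR j). lra.
Qed.

Lemma Dcoef_eq (nu : R) (k : nat) : (forall m : Z, nu <> IZR m) ->
  Dcoef nu k = (-4) ^ k * poch (1 / 2) k / (INR (fact k) * (poch (1 - nu) k * poch (1 + nu) k)).
Proof.
  intros Hnu. unfold Dcoef. rewrite (jcoef_mult nu (- nu) 0); [|ring|now apply plus_1_INR_neq0|now apply plus_1_INR_neq0, nonint_opp|].
  - rewrite Rmult_0_r, !Rplus_0_l, (Rplus_comm (- nu) 1), (Rplus_comm nu 1).
    change (1 + - nu) with (1 - nu).
    assert (P1 : poch (1 - nu) k <> 0).
    { apply poch_neq0. intros j. replace (1 - nu + INR j) with (- nu + 1 + INR j) by ring. now apply plus_1_INR_neq0, nonint_opp. }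
    assert (P2 : poch (1 + nu) k <> 0).
    { apply poch_neq0. intros j. replace (1 + nu + INR j) with (nu + 1 + INR j) by ring. now apply plus_1_INR_neq0. }
    assert (P3 : poch 1 k <> 0) by (apply Rgt_not_eq, poch_pos; lra).
    assert (F := INR_fact_neq_0 k). field. auto.
  - intros j. generalize (pos_INR j). lra.
Qed.

Lemma entire_Acoef (nu : R) : 0 < nu -> entire (Acoef nu).
Proof. intros H. apply entire_mult; apply entire_jcoef, plus_1_INR_neq0_pos, H. Qed.

Lemma entire_Dcoef (nu : R) : (forall m : Z, nu <> IZR m) -> entire (Dcoef nu).
Proof.
  intros H. apply entire_mult; apply entire_jcoef; [now apply plus_1_INR_neq0|now apply plus_1_INR_neq0, nonint_opp].
Qed.

Lemma entire_pcoef (nu : R) : 0 < nu -> entire (pcoef nu).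
Proof.
  intros H. apply entire_le with (Acoef nu) 1; [|now apply entire_Acoef].
  intros k. assert (Hk := pos_INR k). unfold pcoef. rewrite Rabs_mult. apply Rmult_le_compat_r; [apply Rabs_pos|].
  rewrite Rabs_pos_eq by (apply Rdiv_le_0_compat; lra).
  apply Rmult_le_reg_r with (nu + INR k); [lra|].
  replace (nu / (nu + INR k) * (nu + INR k)) with nu by (field; lra). lra.
Qed.

Lemma entire_qcoef (nu : R) : (forall m : Z, nu <> IZR m) -> entire (qcoef nu).
Proof.
  intros H. apply entire_le with (Dcoef nu) 1; [|now apply entire_Dcoef].
  intros [|k]; unfold qcoef; [rewrite Rabs_R0, Rmult_1_l; apply Rabs_pos|].
  assert (Hk : 1 <= INR (S k)) by (change 1 with (INR 1); apply le_INR; lia).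
  unfold Rdiv. rewrite Rabs_mult, Rabs_Ropp, Rmult_comm. apply Rmult_le_compat_r; [apply Rabs_pos|].
  rewrite Rabs_pos_eq by (left; apply Rinv_0_lt_compat; lra).
  rewrite <- Rinv_1. apply Rinv_le_contravar; lra.
Qed.

Lemma PSeries_mult_w (c : nat -> R) (w : R) :
  w * PSeries (PS_derive c) w = PSeries (fun k => INR k * c k) w.
Proof.
  unfold PSeries. rewrite (Series_incr_1_aux (fun k => INR k * c k * w ^ k)) by (simpl; ring).
  rewrite <- Series_scal_l. apply Series_ext. intros k. unfold PS_derive. cbn [pow]. ring.
Qed.

Lemma entire_INR_mult (c : nat -> R) : entire c -> entire (fun k => INR k * c k).
Proof.
  intros H x. apply (ex_series_incr_1 (K := R_AbsRing) (V := R_NormedModule)).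
  apply (ex_series_ext (K := R_AbsRing) (V := R_NormedModule) (fun k => Rabs x * Rabs (PS_derive c k * x ^ k))).
  - intros k. rewrite <- Rabs_mult. unfold PS_derive. f_equal. cbn [pow]. ring.
  - apply ex_series_Rscal, (entire_derive c H x).
Qed.

(** After multiplication by w^(nu - 1), the left side is the derivative of w^nu times the series: up
    to constants, this part is an antiderivative of J_nu^2 / z. *)
Lemma pcoef_ode (nu w : R) : 0 < nu ->
  nu * PSeries (pcoef nu) w + w * PSeries (PS_derive (pcoef nu)) w = nu * PSeries (jcoef nu) w ^ 2.
Proof.
  intros Hnu. rewrite PSeries_mult_w.
  replace (PSeries (jcoef nu) w ^ 2) with (PSeries (Acoef nu) w).
  2: { unfold Acoef. rewrite PSeries_mult by apply entire_radius, entire_jcoef, plus_1_INR_neq0_pos, Hnu. ring. }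
  unfold PSeries. rewrite <- !Series_scal_l, <- Series_plus.
  - apply Series_ext. intros k. unfold pcoef. field. generalize (pos_INR k). lra.
  - apply ex_series_Rscal, ex_series_entire, entire_pcoef, Hnu.
  - apply (ex_series_entire (fun k => INR k * pcoef nu k)), entire_INR_mult, entire_pcoef, Hnu.
Qed.

(** The term 1 is the share of the logarithm: the series minus ln x, at w = x^2 / 4, has derivative
    - Jr nu x * Jr (- nu) x / x. *)
Lemma qcoef_ode (nu w : R) : (forall m : Z, nu <> IZR m) ->
  2 * (w * PSeries (PS_derive (qcoef nu)) w) = 1 - PSeries (jcoef nu) w * PSeries (jcoef (- nu)) w.
Proof.
  intros Hnu. rewrite PSeries_mult_w.
  replace (PSeries (jcoef nu) w * PSeries (jcoef (- nu)) w) with (PSeries (Dcoef nu) w).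
  2: { unfold Dcoef. rewrite PSeries_mult; [reflexivity| |]; apply entire_radius, entire_jcoef; [now apply plus_1_INR_neq0|now apply plus_1_INR_neq0, nonint_opp]. }
  rewrite (PSeries_decr_1 (Dcoef nu)) by apply CV_disk_correct, entire_Dcoef, Hnu.
  replace (Dcoef nu 0%nat) with 1.
  2: { unfold Dcoef, PS_mult, jcoef. simpl. field. }
  unfold PSeries. rewrite (Series_incr_1_aux (fun k => INR k * qcoef nu k * w ^ k)) by (simpl; ring).
  transitivity (- (w * Series (fun k => PS_decr_1 (Dcoef nu) k * w ^ k))); [|ring].
  rewrite <- !Series_scal_l, <- Series_opp. apply Series_ext. intros k. unfold qcoef, PS_decr_1. cbn [pow].
  field. apply not_0_INR. lia.
Qed.

Lemma Rpower_mult_opp (x a : R) : Rpower x a * Rpower x (- a) = 1.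
Proof. rewrite <- Rpower_plus, Rplus_opp_r. unfold Rpower. rewrite Rmult_0_l. apply exp_0. Qed.

(** In the variable x with w = x^2 / 4 the derivative is 2 nu Jr^2 / x, which [Jr_decay] makes
    O(x^(-2)). *)
Lemma ex_lim_power_part (nu : R) : 0 < nu ->
  exists l : R, is_lim (fun w => pw nu w * PSeries (pcoef nu) w) p_infty l.
Proof.
  intros Hnu. destruct (Jr_decay nu (plus_1_INR_neq0_pos nu Hnu)) as [C HC].
  assert (Hd : forall x, 1 <= x -> is_derive (fun x => pw nu (x ^ 2 / 4) * PSeries (pcoef nu) (x ^ 2 / 4)) x (2 * nu * Jr nu x ^ 2 / x)).
  { intros x Hx. assert (Hw : 0 < x ^ 2 / 4) by nra.
    assert (HW : is_derive (fun x => x ^ 2 / 4) x (x / 2)) by (auto_derive; [exact I|field]).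
    eapply is_derive_replace.
    - apply (is_derive_mult (fun x => pw nu (x ^ 2 / 4)) (fun x => PSeries (pcoef nu) (x ^ 2 / 4))); [| |intros; apply Rmult_comm].
      + apply (is_derive_comp (pw nu) (fun x => x ^ 2 / 4)); [|exact HW]. apply is_derive_pw_pos, Hw.
      + apply (is_derive_comp (PSeries (pcoef nu)) (fun x => x ^ 2 / 4)); [|exact HW]. apply is_derive_entire, entire_pcoef, Hnu.
    - change (x / 2 * (nu * pw (nu - 1) (x ^ 2 / 4)) * PSeries (pcoef nu) (x ^ 2 / 4) +
        pw nu (x ^ 2 / 4) * (x / 2 * PSeries (PS_derive (pcoef nu)) (x ^ 2 / 4)) = 2 * nu * Jr nu x ^ 2 / x).
      unfold Jr. rewrite Rpow_mult_distr. assert (E := pcoef_ode nu (x ^ 2 / 4) Hnu).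
      replace (Rpower (x / 2) nu ^ 2) with (pw nu (x ^ 2 / 4)).
      2: { replace (x ^ 2 / 4) with (x / 2 * (x / 2)) by field. rewrite pw_mult, pw_pos by lra. ring. }
      replace (pw nu (x ^ 2 / 4)) with (pw (nu - 1) (x ^ 2 / 4) * (x ^ 2 / 4)).
      2: { rewrite <- (pw_1 (x ^ 2 / 4)) at 2 by lra. rewrite <- pw_plus. f_equal. ring. }
      set (w := x ^ 2 / 4) in *. set (p := pw (nu - 1) w).
      apply (Rmult_eq_reg_r x); [|lra].
      transitivity (2 * p * w * (nu * PSeries (pcoef nu) w + w * PSeries (PS_derive (pcoef nu)) w)).
      + replace (x ^ 2 / 4) with w by reflexivity.
        replace ((x / 2 * (nu * p) * PSeries (pcoef nu) w + p * w * (x / 2 * PSeries (PS_derive (pcoef nu)) w)) * x)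
          with (2 * p * (x ^ 2 / 4) * (nu * PSeries (pcoef nu) w + w * PSeries (PS_derive (pcoef nu)) w)) by field.
        reflexivity.
      + rewrite E. field. lra. }
  destruct (is_lim_derive_bound (fun x => pw nu (x ^ 2 / 4) * PSeries (pcoef nu) (x ^ 2 / 4)) (fun x => 2 * nu * Jr nu x ^ 2 / x) (2 * nu * C)) as [l Hl].
  - exact Hd.
  - intros x Hx. rewrite Rabs_pos_eq.
    + specialize (HC x Hx). replace (2 * nu * Jr nu x ^ 2 / x) with (2 * nu * (x * Jr nu x ^ 2) / x ^ 2) by (field; lra).
      apply Rmult_le_compat_r; [left; apply Rinv_0_lt_compat; nra|]. apply Rmult_le_compat_l; lra.
    + apply Rdiv_le_0_compat; [|lra]. apply Rmult_le_pos; [lra|apply pow2_ge_0].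
  - exists l. apply (is_lim_of_quarter_sq (fun w => pw nu w * PSeries (pcoef nu) w)), Hl.
Qed.

Lemma ex_lim_log_part (nu : R) : (forall m : Z, nu <> IZR m) ->
  exists l : R, is_lim (fun w => PSeries (qcoef nu) w - / 2 * ln (4 * w)) p_infty l.
Proof.
  intros Hnu. destruct (Jr_decay nu (plus_1_INR_neq0 nu Hnu)) as [C1 HC1].
  destruct (Jr_decay (- nu) (plus_1_INR_neq0 _ (nonint_opp nu Hnu))) as [C2 HC2].
  destruct (is_lim_derive_bound (fun x => PSeries (qcoef nu) (x ^ 2 / 4) - ln x) (fun x => - (Jr nu x * Jr (- nu) x) / x) (C1 + C2)) as [l Hl].
  - intros x Hx. assert (HW : is_derive (fun x => x ^ 2 / 4) x (x / 2)) by (auto_derive; [exact I|field]).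
    eapply is_derive_replace.
    + apply (is_derive_minus (fun x => PSeries (qcoef nu) (x ^ 2 / 4)) ln).
      * apply (is_derive_comp (PSeries (qcoef nu)) (fun x => x ^ 2 / 4)); [|exact HW]. apply is_derive_entire, entire_qcoef, Hnu.
      * apply is_derive_Reals, derivable_pt_lim_ln. lra.
    + change (x / 2 * PSeries (PS_derive (qcoef nu)) (x ^ 2 / 4) - / x = - (Jr nu x * Jr (- nu) x) / x).
      assert (E := qcoef_ode nu (x ^ 2 / 4) Hnu).
      assert (E2 : Jr nu x * Jr (- nu) x = 1 - 2 * (x ^ 2 / 4 * PSeries (PS_derive (qcoef nu)) (x ^ 2 / 4))).
      { rewrite E. unfold Jr.
        transitivity (Rpower (x / 2) nu * Rpower (x / 2) (- nu) * (PSeries (jcoef nu) (x ^ 2 / 4) * PSeries (jcoef (- nu)) (x ^ 2 / 4))); [ring|].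
        rewrite Rpower_mult_opp. ring. }
      rewrite E2. field. lra.
  - intros x Hx. specialize (HC1 x Hx). specialize (HC2 x Hx).
    unfold Rdiv. rewrite Rabs_mult, Rabs_Ropp, (Rabs_pos_eq (/ x)) by (left; apply Rinv_0_lt_compat; lra).
    replace (Rabs (Jr nu x * Jr (- nu) x) * / x) with (x * Rabs (Jr nu x * Jr (- nu) x) * / x ^ 2) by (field; lra).
    apply Rmult_le_compat_r; [left; apply Rinv_0_lt_compat; nra|].
    apply Rle_trans with (x * Jr nu x ^ 2 + x * Jr (- nu) x ^ 2); [|lra].
    rewrite <- Rmult_plus_distr_l. apply Rmult_le_compat_l; [lra|].
    set (a := Jr nu x). set (b := Jr (- nu) x). assert (0 <= (a - b) ^ 2 /\ 0 <= (a + b) ^ 2) by (split; apply pow2_ge_0).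
    apply Rabs_le_between. nra.
  - exists l. apply (is_lim_of_quarter_sq (fun w => PSeries (qcoef nu) w - / 2 * ln (4 * w))).
    apply is_lim_ext_loc with (2 := Hl). exists 0. intros x Hx. f_equal.
    replace (4 * (x ^ 2 / 4)) with (x * x) by field. rewrite ln_mult by assumption. field.
Qed.

Lemma is_lim_R_unique (f : R -> R) (l1 l2 : R) : is_lim f p_infty l1 -> is_lim f p_infty l2 -> l1 = l2.
Proof. intros H1 H2. apply is_lim_unique in H1. apply is_lim_unique in H2. rewrite H1 in H2. now injection H2. Qed.

(** * Value of the limit of the power part *)

Definition sincos_int (nu : R) (k : nat) : R :=
  RInt (fun x => pw (2 * nu) (sin x) * pw (2 * nu) (cos x) * sin x ^ (2 * k)) 0 (PI / 2).

Lemma continuous_pw_comp (a : R) (f : R -> R) (x : R) : 0 < a -> continuous f x -> continuous (fun x => pw a (f x)) x.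
Proof. intros Ha Hf. apply (continuous_comp f (pw a)); [assumption|now apply continuous_pw]. Qed.

Lemma is_sincos_int (nu : R) (k : nat) : 0 < nu ->
  is_RInt (fun x => pw (2 * nu) (sin x) * pw (2 * nu) (cos x) * sin x ^ (2 * k)) 0 (PI / 2) (sincos_int nu k).
Proof.
  intros Hnu. apply RInt_cont_correct. intros x.
  apply continuous_Rmult; [|solve_continuous].
  apply continuous_Rmult; apply continuous_pw_comp; [lra|apply continuous_sin|lra|apply continuous_cos].
Qed.

(** One antiderivative, (sin x cos x)^(2 nu + 1) sin(x)^(2 k), gives the recursion. Its exponents
    exceed 1, so it is differentiable up to both ends, where it vanishes. *)
Lemma sincos_int_S (nu : R) (k : nat) : 0 < nu ->
  (2 * nu + 1 + INR k) * sincos_int nu (S k) = (nu + 1 / 2 + INR k) * sincos_int nu k.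
Proof.
  intros Hnu. assert (HP := PI_RGT_0).
  set (a := 2 * nu).
  assert (H : is_RInt (fun x =>
     2 * (nu + 1 / 2 + INR k) * (pw a (sin x) * pw a (cos x) * sin x ^ (2 * k)) -
     2 * (2 * nu + 1 + INR k) * (pw a (sin x) * pw a (cos x) * sin x ^ (2 * S k))) 0 (PI / 2)
     (pw (a + 1) (sin (PI / 2)) * sin (PI / 2) ^ (2 * k) * pw (a + 1) (cos (PI / 2)) -
      pw (a + 1) (sin 0) * sin 0 ^ (2 * k) * pw (a + 1) (cos 0))).
  { apply (is_RInt_derive (V := R_CompleteNormedModule) (fun x => pw (a + 1) (sin x) * sin x ^ (2 * k) * pw (a + 1) (cos x))).
    - intros x Hx. rewrite Rmin_left, Rmax_right in Hx by lra.
      assert (Hs : 0 <= sin x) by (apply sin_ge_0; lra). assert (Hc : 0 <= cos x) by (apply cos_ge_0; lra).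
      eapply is_derive_replace.
      + apply (is_derive_mult (fun x => pw (a + 1) (sin x) * sin x ^ (2 * k)) (fun x => pw (a + 1) (cos x))); [| |intros; apply Rmult_comm].
        * apply (is_derive_mult (fun x => pw (a + 1) (sin x)) (fun x => sin x ^ (2 * k))); [| |intros; apply Rmult_comm].
          -- apply (is_derive_comp (pw (a + 1)) sin); [apply is_derive_pw; unfold a; lra|apply is_derive_sin].
          -- apply (is_derive_pow sin (2 * k)), is_derive_sin.
        * apply (is_derive_comp (pw (a + 1)) cos); [apply is_derive_pw; unfold a; lra|apply is_derive_cos].
      + change ((cos x * ((a + 1) * pw (a + 1 - 1) (sin x)) * sin x ^ (2 * k) +
           pw (a + 1) (sin x) * (INR (2 * k) * cos x * sin x ^ pred (2 * k))) * pw (a + 1) (cos x) +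
           pw (a + 1) (sin x) * sin x ^ (2 * k) * (- sin x * ((a + 1) * pw (a + 1 - 1) (cos x))) =
           2 * (nu + 1 / 2 + INR k) * (pw a (sin x) * pw a (cos x) * sin x ^ (2 * k)) -
           2 * (2 * nu + 1 + INR k) * (pw a (sin x) * pw a (cos x) * sin x ^ (2 * S k))).
        replace (a + 1 - 1) with a by ring. rewrite !pw_plus, !pw_1 by assumption.
        replace (sin x ^ (2 * S k)) with (sin x ^ (2 * k) * (1 - cos x * cos x)).
        2: { replace (2 * S k)%nat with (2 * k + 2)%nat by lia. rewrite pow_add. f_equal.
             generalize (sin2_cos2 x). unfold Rsqr. simpl. lra. }
        replace (pw a (sin x) * sin x * (INR (2 * k) * cos x * sin x ^ pred (2 * k))) with
          (pw a (sin x) * (INR (2 * k) * (cos x * sin x ^ (2 * k)))).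
        2: { destruct k as [|k]; [simpl; ring|]. replace (2 * S k)%nat with (S (2 * k + 1)) by lia. change (Init.Nat.pred (S (2 * k + 1))) with (2 * k + 1)%nat.
             rewrite <- (tech_pow_Rmult (sin x) (2 * k + 1)). ring. }
        replace (pw a (sin x) * sin x * sin x ^ (2 * k) * (- sin x * ((a + 1) * pw a (cos x)))) with
          (- ((a + 1) * pw a (sin x) * pw a (cos x) * sin x ^ (2 * k) * (sin x * sin x))) by ring.
        replace (sin x * sin x) with (1 - cos x * cos x) by (generalize (sin2_cos2 x); unfold Rsqr; lra).
        rewrite mult_INR. change (INR 2) with 2. unfold a. field.
    - intros x _. assert (Hcc : forall k, continuous (fun x => pw a (sin x) * pw a (cos x) * sin x ^ (2 * k)) x).
      { intros j. apply continuous_Rmult; [|solve_continuous].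
        apply continuous_Rmult; apply continuous_pw_comp; [unfold a; lra|apply continuous_sin|unfold a; lra|apply continuous_cos]. }
      apply continuous_Rminus; apply continuous_Rmult; try apply continuous_const; apply Hcc. }
  assert (H2 := is_RInt_Rminus
    (is_RInt_Rscal (2 * (nu + 1 / 2 + INR k)) (is_sincos_int nu k Hnu))
    (is_RInt_Rscal (2 * (2 * nu + 1 + INR k)) (is_sincos_int nu (S k) Hnu))).
  apply is_RInt_Runique in H. apply is_RInt_Runique in H2.
  rewrite cos_PI2, sin_0, !(pw_neg _ 0) in H by lra.
  assert (E : 2 * (nu + 1 / 2 + INR k) * sincos_int nu k - 2 * (2 * nu + 1 + INR k) * sincos_int nu (S k) = 0).
  { etransitivity; [symmetry; exact H2|]. etransitivity; [exact H|]. ring. }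
  unfold a. lra.
Qed.

Lemma sincos_int_poch (nu : R) (k : nat) : 0 < nu ->
  sincos_int nu k * poch (2 * nu + 1) k = sincos_int nu 0 * poch (nu + 1 / 2) k.
Proof.
  intros Hnu. induction k as [|k IH]; [simpl; ring|]. cbn [poch].
  transitivity (poch (2 * nu + 1) k * ((2 * nu + 1 + INR k) * sincos_int nu (S k))); [ring|].
  rewrite sincos_int_S by assumption.
  transitivity ((nu + 1 / 2 + INR k) * (sincos_int nu k * poch (2 * nu + 1) k)); [ring|]. rewrite IH. ring.
Qed.

Lemma RInt_sin_cos (h : R -> R) : (forall x, continuous h x) ->
  RInt (fun x => h (sin x)) 0 (PI / 2) = RInt (fun x => h (cos x)) 0 (PI / 2).
Proof.
  intros Hh.
  assert (H := RInt_comp_lin (V := R_CompleteNormedModule) (fun x => h (sin x)) (-1) (PI / 2) 0 (PI / 2)).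
  replace (-1 * 0 + PI / 2) with (PI / 2) in H by ring. replace (-1 * (PI / 2) + PI / 2) with 0 in H by field.
  rewrite <- (opp_RInt_swap (V := R_CompleteNormedModule)) by (apply ex_RInt_cont_all; intros x; apply (continuous_comp sin h); [apply continuous_sin|apply Hh]).
  rewrite <- H by (apply ex_RInt_cont_all; intros x; apply (continuous_comp sin h); [apply continuous_sin|apply Hh]).
  rewrite <- (RInt_opp (V := R_CompleteNormedModule)).
  - apply RInt_ext. intros x _. change (- (-1 * h (sin (-1 * x + PI / 2))) = h (cos x)).
    rewrite cos_sin. replace (-1 * x + PI / 2) with (PI - (PI / 2 + x)) by field. rewrite sin_PI_x. ring.
  - apply ex_RInt_cont_all. intros x. apply (continuous_Rmult (fun _ => -1)); [apply continuous_const|].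
    apply (continuous_comp (fun y => sin (-1 * y + PI / 2)) h); [solve_continuous|apply Hh].
Qed.

Definition cos_int (nu : R) : R := RInt (fun x => pw (2 * nu) (cos x)) 0 (PI / 2).

(** The factor 4^nu turns (sin x cos x)^(2 nu) into sin(2 x)^(2 nu), and a substitution with the
    symmetry about PI / 2 leaves the integral of cos(x)^(2 nu). This normalizing constant cancels in
    [power_part_lim]. *)
Lemma sincos_int_0 (nu : R) : 0 < nu -> pw nu 4 * sincos_int nu 0 = cos_int nu.
Proof.
  intros Hnu. assert (HP := PI_RGT_0). set (h := pw (2 * nu)).
  assert (Hh : forall x, continuous h x) by (intros x; apply continuous_pw; lra).
  assert (Hs : forall x, continuous (fun x => h (sin x)) x).
  { intros x. apply continuous_pw_comp; [lra|apply continuous_sin]. }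
  assert (E1 : pw nu 4 * sincos_int nu 0 = RInt (fun x => h (sin (2 * x))) 0 (PI / 2)).
  { symmetry. apply is_RInt_Runique.
    eapply is_RInt_ext_PI2; [|exact (is_RInt_Rscal (pw nu 4) (is_sincos_int nu 0 Hnu))].
    intros x Hx. change (pw nu 4 * (h (sin x) * h (cos x) * 1) = h (sin (2 * x))).
    rewrite sin_2a. assert (Hs' : 0 < sin x) by (apply sin_gt_0; lra). assert (Hc' : 0 < cos x) by (apply cos_gt_0; lra).
    unfold h. rewrite !pw_mult by lra. replace 4 with (2 * 2) by ring. rewrite (pw_mult nu 2 2) by lra.
    replace (2 * nu) with (nu + nu) by ring. rewrite (pw_plus nu nu 2). ring. }
  rewrite E1.
  assert (H := RInt_comp_lin (V := R_CompleteNormedModule) (fun x => h (sin x)) 2 0 0 (PI / 2)).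
  replace (2 * 0 + 0) with 0 in H by ring. replace (2 * (PI / 2) + 0) with PI in H by field.
  specialize (H (ex_RInt_cont_all _ _ _ Hs)).
  assert (E2 : 2 * RInt (fun x => h (sin (2 * x))) 0 (PI / 2) = RInt (fun x => h (sin x)) 0 PI).
  { rewrite <- H. symmetry. transitivity (RInt (fun x => 2 * h (sin (2 * x))) 0 (PI / 2)).
    - apply RInt_ext. intros x _. now rewrite Rplus_0_r.
    - apply (RInt_scal (V := R_CompleteNormedModule) (fun x => h (sin (2 * x))) 0 (PI / 2) 2).
      apply ex_RInt_cont_all. intros x. apply continuous_pw_comp; [lra|solve_continuous]. }
  assert (H2 := RInt_comp_lin (V := R_CompleteNormedModule) (fun x => h (sin x)) 1 (PI / 2) 0 (PI / 2)).
  replace (1 * 0 + PI / 2) with (PI / 2) in H2 by ring. replace (1 * (PI / 2) + PI / 2) with PI in H2 by field.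
  specialize (H2 (ex_RInt_cont_all _ _ _ Hs)).
  assert (E3 : RInt (fun x => h (cos x)) 0 (PI / 2) = RInt (fun x => h (sin x)) (PI / 2) PI).
  { rewrite <- H2. apply RInt_ext. intros x _. change (h (cos x) = 1 * h (sin (1 * x + PI / 2))).
    rewrite cos_sin, !Rmult_1_l. do 2 f_equal. ring. }
  assert (E4 := RInt_Chasles (V := R_CompleteNormedModule) (fun x => h (sin x)) 0 (PI / 2) PI
    (ex_RInt_cont_all _ _ _ Hs) (ex_RInt_cont_all _ _ _ Hs)).
  change (RInt (fun x => h (sin x)) 0 (PI / 2) + RInt (fun x => h (sin x)) (PI / 2) PI = RInt (fun x => h (sin x)) 0 PI) in E4.
  rewrite (RInt_sin_cos h Hh), <- E3 in E4. unfold cos_int. fold h. lra.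
Qed.

Lemma sincos_int_pos (nu : R) : 0 < nu -> 0 < sincos_int nu 0.
Proof.
  intros Hnu. assert (HP := PI_RGT_0). unfold sincos_int. apply RInt_gt_0; [lra| |].
  - intros x Hx. simpl. rewrite Rmult_1_r. apply Rmult_lt_0_compat; apply pw_gt0; [apply sin_gt_0; lra|apply cos_gt_0; lra].
  - intros x _. apply continuous_Rmult; [|solve_continuous].
    apply continuous_Rmult; apply continuous_pw_comp; [lra|apply continuous_sin|lra|apply continuous_cos].
Qed.

(* The coefficients of [nu * w^(- nu)] times the lower incomplete Gamma function. *)
Definition gcoef (nu : R) (k : nat) : R := expc k * (nu / (nu + INR k)).

Lemma entire_gcoef (nu : R) : 0 < nu -> entire (gcoef nu).
Proof.
  intros H. apply entire_le with expc 1; [|apply entire_expc].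
  intros k. assert (Hk := pos_INR k). unfold gcoef. rewrite Rabs_mult, Rmult_comm. apply Rmult_le_compat_r; [apply Rabs_pos|].
  rewrite Rabs_pos_eq by (apply Rdiv_le_0_compat; lra).
  apply Rmult_le_reg_r with (nu + INR k); [lra|].
  replace (nu / (nu + INR k) * (nu + INR k)) with nu by (field; lra). lra.
Qed.

Lemma RInt_pw_pow (a w : R) (k : nat) : 0 < a -> 0 <= w ->
  RInt (fun t => pw a t * t ^ k) 0 w = pw a w * w ^ S k / (a + INR k + 1).
Proof.
  intros Ha Hw. assert (Hk := pos_INR k). apply is_RInt_Runique.
  apply is_RInt_ext with (pw (a + INR k)).
  { intros t Ht. rewrite Rmin_left in Ht by lra. now rewrite pw_nat by lra. }
  eapply is_RInt_replace.
  - apply (is_RInt_Rderive (fun t => pw (a + INR k + 1) t * / (a + INR k + 1))).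
    + intros t. eapply is_derive_replace.
      * apply (is_derive_scal_l (K := R_AbsRing) (V := R_NormedModule) (pw (a + INR k + 1)) t).
        apply is_derive_pw. lra.
      * replace (a + INR k + 1 - 1) with (a + INR k) by ring.
        change ((a + INR k + 1) * pw (a + INR k) t * / (a + INR k + 1) = pw (a + INR k) t). field. lra.
    + intros t. apply continuous_pw. lra.
  - simpl. rewrite (pw_neg _ 0) by lra. rewrite pw_plus, pw_1, pw_nat by lra. simpl. field. lra.
Qed.

(** The recursion between the lower incomplete Gamma functions of orders nu and nu + 1, the latter
    being [gint nu]. It shows that the left side tends to [GI nu]. *)
Lemma gcoef_gint (nu w : R) : 0 < nu -> 0 <= w ->
  pw nu w * PSeries (gcoef nu) w = pw nu w * exp (- w) + gint nu w.
Proof.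
  intros Hnu Hw.
  assert (HS := RInt_entire_comp expc (pw nu) (fun t => t) 0 w Hw entire_expc
    (fun x _ => continuous_pw nu x Hnu) (fun x _ => continuous_id x)).
  assert (E1 : gint nu w = pw nu w * Series (fun k => expc k * w ^ S k / (nu + INR k + 1))).
  { rewrite <- Series_scal_l. unfold gint.
    transitivity (RInt (fun x => pw nu x * PSeries expc x) 0 w).
    - apply RInt_ext. intros x _. now rewrite PSeries_expc.
    - rewrite <- (is_series_unique _ _ HS). apply Series_ext. intros k.
      rewrite RInt_pw_pow by assumption. unfold Rdiv. ring. }
  rewrite E1, <- PSeries_expc, <- Rmult_plus_distr_l. f_equal.
  unfold PSeries.
  assert (Hg := ex_series_entire (gcoef nu) w (entire_gcoef nu Hnu)).
  assert (He := ex_series_entire expc w entire_expc).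
  rewrite (Series_incr_1 (fun k => gcoef nu k * w ^ k)) by exact Hg.
  rewrite (Series_incr_1 (fun k => expc k * w ^ k)) by exact He.
  assert (Hd : Series (fun k => expc k * w ^ S k / (nu + INR k + 1)) =
    Series (fun k => gcoef nu (S k) * w ^ S k - expc (S k) * w ^ S k)).
  { apply Series_ext. intros k. unfold gcoef, expc. rewrite fact_simpl, mult_INR, S_INR.
    assert (Hk := pos_INR k). assert (F := INR_fact_neq_0 k). simpl pow. field. repeat split; try assumption; lra. }
  rewrite Hd, Series_minus.
  - replace (gcoef nu 0) with 1 by (unfold gcoef, expc; simpl; field; lra).
    replace (expc 0) with 1 by (unfold expc; simpl; field). ring.
  - apply (ex_series_incr_1 (fun k => gcoef nu k * w ^ k)), Hg.
  - apply (ex_series_incr_1 (fun k => expc k * w ^ k)), He.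
Qed.

Lemma poch_le (a b : R) (k : nat) : 0 < a <= b -> poch a k <= poch b k.
Proof.
  intros H. induction k as [|k IH]; simpl; [lra|]. assert (Hk := pos_INR k).
  apply Rmult_le_compat; try lra. left. apply poch_pos. lra.
Qed.

Lemma Rabs_m4_pow (k : nat) : Rabs ((-4) ^ k) = 4 ^ k.
Proof. rewrite <- RPow_abs. f_equal. rewrite Rabs_left; lra. Qed.

Lemma ex_series_exp_scaled (C y : R) : ex_series (fun k => C * (4 ^ k * y ^ k * / INR (fact k))).
Proof.
  apply ex_series_Rscal.
  apply (ex_series_ext (K := R_AbsRing) (V := R_NormedModule) (fun k => / INR (fact k) * (4 * y) ^ k)).
  - intros k. rewrite Rpow_mult_distr. Rring.
  - apply (ex_series_entire (fun k => / INR (fact k))), entire_exp.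
Qed.

Lemma ex_series_le_R (a b : nat -> R) : (forall k, Rabs (a k) <= b k) -> ex_series b -> ex_series a.
Proof. intros H. apply (ex_series_le (K := R_AbsRing) (V := R_CompleteNormedModule)), H. Qed.

(** The Laplace moment (nu + 1)_k cancels one Pochhammer symbol of the denominator; the quotient of
    two such symbols left over is a normalized moment of sin^2. *)
Lemma pcoef_poch (nu : R) (k : nat) : 0 < nu ->
  pcoef nu k * poch (nu + 1) k * sincos_int nu 0 = (-4) ^ k / INR (fact k) * (nu / (nu + INR k)) * sincos_int nu k.
Proof.
  intros Hnu. unfold pcoef. rewrite Acoef_eq by assumption.
  assert (P1 : poch (2 * nu + 1) k <> 0) by (apply Rgt_not_eq, poch_pos; lra).
  assert (P2 : poch (nu + 1) k <> 0) by (apply Rgt_not_eq, poch_pos; lra).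
  assert (F := INR_fact_neq_0 k). assert (Hk := pos_INR k).
  transitivity ((-4) ^ k / INR (fact k) * (nu / (nu + INR k)) * (sincos_int nu 0 * poch (nu + 1 / 2) k) / poch (2 * nu + 1) k).
  - field. repeat split; try assumption; lra.
  - rewrite <- sincos_int_poch by assumption. field. repeat split; try assumption; lra.
Qed.

Lemma power_part_laplace (nu y : R) : 0 < nu -> 0 < y ->
  is_lim (fun T => RInt (fun t => exp (- t) * (pw nu (y * t) * PSeries (pcoef nu) (y * t))) 0 T) p_infty
    (pw nu y * Series (fun k => pcoef nu k * y ^ k * (GI nu * poch (nu + 1) k))).
Proof.
  intros Hnu Hy. set (kap := fun t => pw nu t * exp (- t)).
  assert (HG := GI_pos nu Hnu).
  assert (H := laplace_series kap (pcoef nu) (fun k => GI nu * poch (nu + 1) k) y).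
  apply is_lim_ext_loc with (fun T => pw nu y * RInt (fun t => kap t * PSeries (pcoef nu) (y * t)) 0 T).
  - exists 0. intros T HT.
    transitivity (RInt (fun t => pw nu y * (kap t * PSeries (pcoef nu) (y * t))) 0 T).
    + symmetry. apply (RInt_scal (V := R_CompleteNormedModule) (fun t => kap t * PSeries (pcoef nu) (y * t)) 0 T (pw nu y)).
      apply ex_RInt_cont_all. intros t. apply continuous_Rmult; [now apply continuous_pw_exp|].
      apply (continuous_comp (fun t => y * t) (PSeries (pcoef nu))); [solve_continuous|apply continuous_entire, entire_pcoef, Hnu].
    + apply RInt_ext. intros t Ht. rewrite Rmin_left in Ht by lra. unfold kap. rewrite (pw_mult nu y t) by lra.
      Rring.
  - apply (is_lim_scal_l _ (pw nu y) p_infty (Finite _)). apply H.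
    + intros t. now apply continuous_pw_exp.
    + intros t _. apply Rmult_le_pos; [apply pw_ge0|left; apply exp_pos].
    + now apply entire_pcoef.
    + lra.
    + intros k. now apply RInt_pw_exp_pow_lim.
    + apply ex_series_le_R with (fun k => GI nu * (4 ^ k * y ^ k * / INR (fact k))); [|apply ex_series_exp_scaled].
      intros k. assert (Hk := pos_INR k).
      assert (P1 : 0 < poch (2 * nu + 1) k) by (apply poch_pos; lra).
      assert (P2 : 0 < poch (nu + 1) k) by (apply poch_pos; lra).
      assert (P3 : 0 < poch (nu + 1 / 2) k) by (apply poch_pos; lra).
      assert (F := INR_fact_lt_0 k). assert (Hyk : 0 < y ^ k) by now apply pow_lt.
      assert (H4 : 0 < 4 ^ k) by (apply pow_lt; lra).
      assert (Hle := poch_le (nu + 1 / 2) (2 * nu + 1) k ltac:(lra)).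
      assert (E : Rabs (pcoef nu k) * poch (nu + 1) k = 4 ^ k * / INR (fact k) * (nu / (nu + INR k) * (poch (nu + 1 / 2) k / poch (2 * nu + 1) k))).
      { unfold pcoef. rewrite Acoef_eq by assumption. unfold Rdiv. rewrite !Rabs_mult, Rabs_m4_pow, !Rabs_inv, !Rabs_mult.
        rewrite (Rabs_pos_eq nu), (Rabs_pos_eq (nu + INR k)), (Rabs_pos_eq (poch (nu + 1 * / 2) k)), (Rabs_pos_eq (poch (2 * nu + 1) k)),
          (Rabs_pos_eq (INR (fact k))), (Rabs_pos_eq (poch (nu + 1) k)) by (try lra; unfold Rdiv in *; lra).
        field. repeat split; lra. }
      rewrite Rabs_mult, (Rabs_pos_eq (GI nu * _)) by (apply Rmult_le_pos; lra).
      rewrite Rabs_mult, Rabs_Rabsolu, (Rabs_pos_eq (y ^ k)) by lra.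
      replace (Rabs (pcoef nu k) * y ^ k * (GI nu * poch (nu + 1) k)) with (GI nu * y ^ k * (Rabs (pcoef nu k) * poch (nu + 1) k)) by ring.
      rewrite E. replace (GI nu * (4 ^ k * y ^ k * / INR (fact k))) with (GI nu * y ^ k * (4 ^ k * / INR (fact k) * (1 * 1))) by ring.
      assert (Q1 : nu / (nu + INR k) <= 1).
      { apply Rmult_le_reg_r with (nu + INR k); [lra|]. replace (nu / (nu + INR k) * (nu + INR k)) with nu by (field; lra). lra. }
      assert (Q2 : poch (nu + 1 / 2) k / poch (2 * nu + 1) k <= 1).
      { apply Rmult_le_reg_r with (poch (2 * nu + 1) k); [lra|].
        replace (poch (nu + 1 / 2) k / poch (2 * nu + 1) k * poch (2 * nu + 1) k) with (poch (nu + 1 / 2) k) by (field; lra). lra. }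
      apply Rmult_le_compat_l; [apply Rmult_le_pos; lra|].
      apply Rmult_le_compat_l; [apply Rmult_le_pos; [lra|left; now apply Rinv_0_lt_compat]|].
      apply Rmult_le_compat; try assumption; apply Rdiv_le_0_compat; lra.
Qed.

(** Each moment is put back as an integral and the sum taken inside: the weight sin^(2 nu) combines
    with (4 y)^nu into the power of 4 y sin^2 x that belongs to the [gcoef] series. Splitting off
    [GI nu] leaves a remainder suited to [RInt_concentrate]. *)
Lemma power_part_mean (nu y : R) : 0 < nu -> 0 < y ->
  pw nu y * Series (fun k => pcoef nu k * y ^ k * (GI nu * poch (nu + 1) k)) =
  GI nu / cos_int nu * (cos_int nu * GI nu +
    RInt (fun x => pw (2 * nu) (cos x) * (pw nu (Rabs (4 * y * sin x ^ 2)) * PSeries (gcoef nu) (Rabs (4 * y * sin x ^ 2)) - GI nu)) 0 (PI / 2)).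
Proof.
  intros Hnu Hy. assert (HP := PI_RGT_0).
  set (h := fun x => pw (2 * nu) (sin x) * pw (2 * nu) (cos x)).
  assert (Hc : forall x, continuous (fun x => pw (2 * nu) (cos x)) x).
  { intros x. apply continuous_pw_comp; [lra|apply continuous_cos]. }
  assert (Hh : forall x, continuous h x).
  { intros x. apply continuous_Rmult; [|apply Hc]. apply continuous_pw_comp; [lra|apply continuous_sin]. }
  assert (Hs : forall x, continuous (fun x => 4 * y * sin x ^ 2) x) by (intros x; solve_continuous).
  assert (Hsp := sincos_int_pos nu Hnu). assert (H4 : 0 < pw nu 4) by (apply pw_gt0; lra).
  assert (Hci : cos_int nu = pw nu 4 * sincos_int nu 0) by now rewrite sincos_int_0.
  assert (HS := RInt_entire_comp (gcoef nu) h (fun x => 4 * y * sin x ^ 2) 0 (PI / 2) ltac:(lra) (entire_gcoef nu Hnu)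
    (fun x _ => Hh x) (fun x _ => Hs x)).
  assert (E1 : Series (fun k => pcoef nu k * y ^ k * (GI nu * poch (nu + 1) k)) =
     GI nu / sincos_int nu 0 * RInt (fun x => h x * PSeries (gcoef nu) (4 * y * sin x ^ 2)) 0 (PI / 2)).
  { rewrite <- (is_series_unique _ _ HS), <- Series_scal_l. apply Series_ext. intros k.
    assert (E : RInt (fun x => h x * (4 * y * sin x ^ 2) ^ k) 0 (PI / 2) = (4 * y) ^ k * sincos_int nu k).
    { apply is_RInt_Runique.
      eapply is_RInt_ext; [|exact (is_RInt_Rscal ((4 * y) ^ k) (is_sincos_int nu k Hnu))].
      intros x _. change ((4 * y) ^ k * (pw (2 * nu) (sin x) * pw (2 * nu) (cos x) * sin x ^ (2 * k)) = h x * (4 * y * sin x ^ 2) ^ k).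
      rewrite (Rpow_mult_distr (4 * y)), <- pow_mult. unfold h. ring. }
    rewrite E. assert (E2 := pcoef_poch nu k Hnu).
    replace (pcoef nu k * y ^ k * (GI nu * poch (nu + 1) k)) with
      (GI nu / sincos_int nu 0 * y ^ k * (pcoef nu k * poch (nu + 1) k * sincos_int nu 0)) by (field; lra).
    rewrite E2. unfold gcoef, expc. rewrite (Rpow_mult_distr 4 y). replace (-4) with (-1 * 4) by ring. rewrite (Rpow_mult_distr (-1) 4).
    field. repeat split; try apply INR_fact_neq_0; generalize (pos_INR k); lra. }
  rewrite E1.
  set (Gw := fun x => pw nu (Rabs (4 * y * sin x ^ 2)) * PSeries (gcoef nu) (Rabs (4 * y * sin x ^ 2))).
  assert (HG : forall x, continuous Gw x).
  { intros x. assert (Ha : continuous (fun x => Rabs (4 * y * sin x ^ 2)) x).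
    { apply (continuous_comp (fun x => 4 * y * sin x ^ 2) Rabs); [apply Hs|apply (continuous_Rabs (4 * y * sin x ^ 2))]. }
    apply continuous_Rmult; [now apply continuous_pw_comp|].
    apply (continuous_comp (fun x => Rabs (4 * y * sin x ^ 2)) (PSeries (gcoef nu))); [exact Ha|apply continuous_entire, entire_gcoef, Hnu]. }
  assert (I1 : is_RInt (fun x => pw (2 * nu) (cos x)) 0 (PI / 2) (cos_int nu)).
  { apply RInt_cont_correct, Hc. }
  assert (I2 : is_RInt (fun x => h x * PSeries (gcoef nu) (4 * y * sin x ^ 2)) 0 (PI / 2)
      (RInt (fun x => h x * PSeries (gcoef nu) (4 * y * sin x ^ 2)) 0 (PI / 2))).
  { apply RInt_cont_correct. intros x. apply continuous_Rmult; [apply Hh|].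
    apply (continuous_comp (fun x => 4 * y * sin x ^ 2) (PSeries (gcoef nu))); [apply Hs|apply continuous_entire, entire_gcoef, Hnu]. }
  assert (I3 : RInt (fun x => pw (2 * nu) (cos x) * (Gw x - GI nu)) 0 (PI / 2) =
     pw nu y * pw nu 4 * RInt (fun x => h x * PSeries (gcoef nu) (4 * y * sin x ^ 2)) 0 (PI / 2) - GI nu * cos_int nu).
  { apply is_RInt_Runique.
    eapply is_RInt_ext_PI2; [|exact (is_RInt_Rminus
      (is_RInt_Rscal (pw nu y * pw nu 4) I2)
      (is_RInt_Rscal (GI nu) I1))].
    intros x Hx. change (pw nu y * pw nu 4 * (h x * PSeries (gcoef nu) (4 * y * sin x ^ 2)) - GI nu * pw (2 * nu) (cos x) =
      pw (2 * nu) (cos x) * (Gw x - GI nu)).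
    assert (Hsx : 0 <= sin x) by (apply sin_ge_0; lra).
    unfold Gw, h. rewrite !Rabs_pos_eq by (apply Rmult_le_pos; [lra|apply pow2_ge_0]).
    rewrite (pw_mult nu (4 * y)), (pw_mult nu 4 y) by (try apply pow2_ge_0; lra).
    replace (sin x ^ 2) with (sin x * sin x) at 2 by ring. rewrite (pw_mult nu (sin x)) by assumption.
    replace (2 * nu) with (nu + nu) by ring. rewrite (pw_plus nu nu (sin x)). ring. }
  unfold Gw in I3. rewrite I3, Hci. field. split; lra.
Qed.

(** The same averages have two limits, the unknown one by [abel_laplace] and the explicit one by
    concentration; they must agree. *)
Lemma power_part_lim (nu : R) : 0 < nu ->
  is_lim (fun w => pw nu w * PSeries (pcoef nu) w) p_infty (GI nu ^ 2).
Proof.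
  intros Hnu. assert (HP := PI_RGT_0). destruct (ex_lim_power_part nu Hnu) as [l Hl].
  assert (Hsp := sincos_int_pos nu Hnu). assert (H4 : 0 < pw nu 4) by (apply pw_gt0; lra).
  assert (Hci : 0 < cos_int nu) by (rewrite <- sincos_int_0 by assumption; nra).
  assert (HF : is_lim (fun y => pw nu y * Series (fun k => pcoef nu k * y ^ k * (GI nu * poch (nu + 1) k))) p_infty l).
  { apply (abel_laplace (fun w => pw nu w * PSeries (pcoef nu) w)).
    - intros x. apply continuous_Rmult; [now apply continuous_pw|apply continuous_entire, entire_pcoef, Hnu].
    - exact Hl.
    - intros y Hy. now apply power_part_laplace. }
  assert (HF2 : is_lim (fun y => pw nu y * Series (fun k => pcoef nu k * y ^ k * (GI nu * poch (nu + 1) k))) p_infty (GI nu ^ 2)).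
  { eapply is_lim_ext_loc.
    { exists 0. intros y Hy. symmetry. apply power_part_mean; lra. }
    replace (Finite (GI nu ^ 2)) with (Finite (GI nu / cos_int nu * (cos_int nu * GI nu + 0))) by (f_equal; field; lra).
    apply (is_lim_scal_l _ (GI nu / cos_int nu) p_infty (Finite _)).
    apply is_lim_plus'; [apply is_lim_const|].
    apply (RInt_concentrate (fun x => pw (2 * nu) (cos x)) (fun w => pw nu (Rabs w) * PSeries (gcoef nu) (Rabs w) - GI nu)).
    - intros x. apply continuous_pw_comp; [lra|apply continuous_cos].
    - intros x. apply continuous_Rminus; [|apply continuous_const].
      apply continuous_Rmult; [apply continuous_pw_comp; [assumption|apply (continuous_Rabs x)]|].
      apply (continuous_comp Rabs (PSeries (gcoef nu))); [apply (continuous_Rabs x)|apply continuous_entire, entire_gcoef, Hnu].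
    - apply is_lim_ext_loc with (fun w => pw nu w * exp (- w) + (gint nu w - GI nu)).
      + exists 0. intros w Hw. rewrite Rabs_pos_eq by lra. rewrite gcoef_gint by lra. ring.
      + replace (Finite 0) with (Finite (0 + (GI nu - GI nu))) by (f_equal; ring).
        apply is_lim_plus'; [now apply pw_exp_lim|]. apply is_lim_minus'; [apply GI_spec, Hnu|apply is_lim_const]. }
  rewrite <- (is_lim_R_unique _ _ _ HF HF2). exact Hl.
Qed.

(** * Value of the limit of the logarithmic part *)

Definition kern_moment (nu : R) (k : nat) : R := RInt (fun x => kern nu x * sin x ^ (2 * k)) 0 (PI / 2).

Lemma is_kern_moment (nu : R) (k : nat) :
  is_RInt (fun x => kern nu x * sin x ^ (2 * k)) 0 (PI / 2) (kern_moment nu k).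
Proof.
  apply RInt_cont_correct. intros x.
  apply continuous_Rmult; [apply continuous_kern|solve_continuous].
Qed.

Lemma kern_moment_0 (nu : R) : kern_moment nu 0 = Kint nu.
Proof. apply RInt_ext. intros x _. simpl. Rring. Qed.

(** For n = k + 1, the product sin(x)^(2 n) cot x is the derivative of sin(x)^(2 n) / (2 n). One
    integration by parts gives [trigI], with a boundary term from PI / 2. *)
Lemma kern_moment_S (nu : R) (k : nat) :
  kern_moment nu (S k) = nu / INR (S k) * trigI (2 * nu) (S k) - sin (PI * nu) / (2 * INR (S k)).
Proof.
  assert (HP := PI_RGT_0). set (n := INR (S k)). assert (Hn : 0 < n) by (apply lt_0_INR; lia).
  set (f := fun x => sin (PI * nu - 2 * nu * x) - sin (PI * nu)).
  assert (H : is_RInt (fun x => / (2 * n) * (f x * (2 * n * cos x * sin x ^ S (2 * k))) -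
      nu / n * (sin x ^ (2 * S k) * cos (2 * nu * (PI / 2 - x)))) 0 (PI / 2)
      (/ (2 * n) * (f (PI / 2) * sin (PI / 2) ^ (2 * S k)) - / (2 * n) * (f 0 * sin 0 ^ (2 * S k)))).
  { apply (is_RInt_Rderive (fun x => / (2 * n) * (f x * sin x ^ (2 * S k)))).
    - intros x. eapply is_derive_replace.
      + apply is_derive_scal. apply (is_derive_mult f (fun x => sin x ^ (2 * S k))); [| |intros; apply Rmult_comm].
        * instantiate (1 := - (2 * nu) * cos (PI * nu - 2 * nu * x)). unfold f. auto_derive; [exact I|]. unfold Rminus. ring.
        * apply (is_derive_pow sin (2 * S k)), is_derive_sin.
      + replace (pred (2 * S k)) with (S (2 * k)) by lia. rewrite mult_INR. change (INR 2) with 2. fold n.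
        replace (2 * nu * (PI / 2 - x)) with (PI * nu - 2 * nu * x) by field.
        change (/ (2 * n) * (- (2 * nu) * cos (PI * nu - 2 * nu * x) * sin x ^ (2 * S k) + f x * (2 * n * cos x * sin x ^ S (2 * k))) =
          / (2 * n) * (f x * (2 * n * cos x * sin x ^ S (2 * k))) - nu / n * (sin x ^ (2 * S k) * cos (PI * nu - 2 * nu * x))).
        field. lra.
    - intros x. unfold f. solve_continuous. }
  assert (H2 := is_RInt_Rplus H
     (is_RInt_Rscal (nu / n) (is_trigI (2 * nu) (S k)))).
  apply is_RInt_Runique. eapply is_RInt_replace.
  - eapply is_RInt_ext_PI2; [|exact H2]. intros x Hx.
    change (/ (2 * n) * (f x * (2 * n * cos x * sin x ^ S (2 * k))) - nu / n * (sin x ^ (2 * S k) * cos (2 * nu * (PI / 2 - x)))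
       + nu / n * (sin x ^ (2 * S k) * cos (2 * nu * (PI / 2 - x))) = kern nu x * sin x ^ (2 * S k)).
    rewrite kern_eq by lra. fold (f x). replace (2 * S k)%nat with (S (S (2 * k))) by lia.
    rewrite <- !(tech_pow_Rmult (sin x)). field. split; [apply Rgt_not_eq, sin_gt_0; lra|lra].
  - change (/ (2 * n) * (f (PI / 2) * sin (PI / 2) ^ (2 * S k)) - / (2 * n) * (f 0 * sin 0 ^ (2 * S k)) + nu / n * trigI (2 * nu) (S k)
      = nu / n * trigI (2 * nu) (S k) - sin (PI * nu) / (2 * n)).
    unfold f. rewrite sin_PI2, pow1, sin_0, pow_ne_zero by lia.
    replace (PI * nu - 2 * nu * (PI / 2)) with 0 by field. rewrite sin_0. field. lra.
Qed.

(** This splits the averaged coefficient into half a coefficient of Ein(4 y), which carries all the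
    logarithmic growth, and a kernel moment, whose sum stays bounded. *)
Lemma qcoef_moment (nu : R) (k : nat) : (forall m : Z, nu <> IZR m) ->
  qcoef nu (S k) * INR (fact (S k)) =
  4 ^ S k * (/ 2 * PS_Int e1c (S k) - / sin (PI * nu) * (expc (S k) * kern_moment nu (S k))).
Proof.
  intros Hnu. assert (Hs := sin_PI_neq0 nu Hnu). assert (Hnu0 := Hnu 0%Z).
  assert (P1 : poch (1 - nu) (S k) <> 0).
  { apply poch_neq0. intros j. replace (1 - nu + INR j) with (- nu + 1 + INR j) by ring. now apply plus_1_INR_neq0, nonint_opp. }
  assert (P2 : poch (1 + nu) (S k) <> 0).
  { apply poch_neq0. intros j. replace (1 + nu + INR j) with (nu + 1 + INR j) by ring. now apply plus_1_INR_neq0. }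
  assert (F := INR_fact_neq_0 (S k)). assert (N : INR (S k) <> 0) by (apply not_0_INR; lia).
  assert (E := trigI_poch nu (S k) Hnu).
  rewrite kern_moment_S. unfold qcoef. rewrite Dcoef_eq by assumption.
  replace (poch (1 / 2) (S k)) with (2 * nu / sin (PI * nu) * (trigI (2 * nu) (S k) * (poch (1 - nu) (S k) * poch (1 + nu) (S k))) / INR (fact (S k))).
  2: { rewrite E. field. repeat split; assumption. }
  change (PS_Int e1c (S k)) with (- expc (S k) / INR (S k)). unfold expc.
  replace (-4) with (-1 * 4) by ring. rewrite Rpow_mult_distr.
  field. repeat split; assumption.
Qed.

Lemma trigI_bound (b : R) (k : nat) : Rabs (trigI b k) <= PI / 2.
Proof.
  assert (HP := PI_RGT_0). replace (PI / 2) with ((PI / 2 - 0) * 1) by ring.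
  apply abs_RInt_bound; [lra|eexists; apply is_trigI|].
  intros x _. rewrite Rabs_mult. rewrite <- (Rmult_1_l 1). apply Rmult_le_compat; try apply Rabs_pos.
  - rewrite <- RPow_abs. rewrite <- (pow1 (2 * k)). apply pow_incr. split; [apply Rabs_pos|apply Rabs_le, SIN_bound].
  - apply Rabs_le, COS_bound.
Qed.

(** The [Ein] part cancels the boundary term of [kern_moment_S], which leaves a single moment
    [trigI], bounded by PI / 2. *)
Lemma qcoef_bound (nu : R) : (forall m : Z, nu <> IZR m) ->
  exists C, forall k, Rabs (qcoef nu k) * INR (fact k) <= C * (4 ^ k * / INR (fact k)).
Proof.
  intros Hnu. assert (Hs := sin_PI_neq0 nu Hnu). assert (HP := PI_RGT_0).
  set (C := Rabs (nu / sin (PI * nu)) * (PI / 2)). exists C.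
  assert (HC : 0 <= C) by (apply Rmult_le_pos; [apply Rabs_pos|lra]).
  intros [|k].
  - simpl. rewrite Rabs_R0. lra.
  - assert (F := INR_fact_lt_0 (S k)). assert (N : 1 <= INR (S k)) by (change 1 with (INR 1); apply le_INR; lia).
    rewrite <- (Rabs_pos_eq (INR (fact (S k)))) at 1 by lra. rewrite <- Rabs_mult, qcoef_moment, kern_moment_S by assumption.
    change (PS_Int e1c (S k)) with (- expc (S k) / INR (S k)). unfold expc.
    replace (4 ^ S k * (/ 2 * (- ((-1) ^ S k / INR (fact (S k))) / INR (S k)) - / sin (PI * nu) * ((-1) ^ S k / INR (fact (S k)) *
      (nu / INR (S k) * trigI (2 * nu) (S k) - sin (PI * nu) / (2 * INR (S k)))))) with
      ((nu / sin (PI * nu) * trigI (2 * nu) (S k)) * ((-1) ^ S k) * (- / INR (S k)) * (4 ^ S k * / INR (fact (S k)))) by (field; repeat split; lra).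
    rewrite !(Rabs_mult _ (4 ^ S k * _)), (Rabs_pos_eq (4 ^ S k * _)).
    2: { apply Rmult_le_pos; [apply pow_le; lra|left; now apply Rinv_0_lt_compat]. }
    apply Rmult_le_compat_r.
    { apply Rmult_le_pos; [apply pow_le; lra|left; now apply Rinv_0_lt_compat]. }
    rewrite (Rabs_mult _ (- / _)), (Rabs_mult _ ((-1) ^ _)), Rabs_m1_pow, Rmult_1_r, Rabs_Ropp, (Rabs_mult _ (trigI _ _)).
    rewrite (Rabs_pos_eq (/ INR (S k))) by (left; apply Rinv_0_lt_compat; lra).
    rewrite <- (Rmult_1_r C). unfold C. apply Rmult_le_compat.
    + apply Rmult_le_pos; apply Rabs_pos.
    + left; apply Rinv_0_lt_compat; lra.
    + apply Rmult_le_compat_l; [apply Rabs_pos|apply trigI_bound].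
    + rewrite <- Rinv_1. apply Rinv_le_contravar; lra.
Qed.

(** The kernel moments with k >= 1 sum to the integral of the kernel against exp(-4 y sin^2 x)
    without its term k = 0. That missing term is [Kint nu], the constant that survives as y ->
    oo. *)
Lemma log_part_mean (nu y : R) : (forall m : Z, nu <> IZR m) -> 0 < y ->
  Series (fun k => qcoef nu k * y ^ k * INR (fact k)) =
  / 2 * Ein (4 * y) + / sin (PI * nu) * (Kint nu - RInt (fun x => kern nu x * exp (- (4 * y * sin x ^ 2))) 0 (PI / 2)).
Proof.
  intros Hnu Hy. assert (HP := PI_RGT_0). assert (Hs := sin_PI_neq0 nu Hnu).
  assert (HS := RInt_entire_comp expc (kern nu) (fun x => 4 * y * sin x ^ 2) 0 (PI / 2) ltac:(lra) entire_expc
    (fun x _ => continuous_kern nu x) ltac:(intros x _; solve_continuous)).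
  assert (E : forall k, RInt (fun x => kern nu x * (4 * y * sin x ^ 2) ^ k) 0 (PI / 2) = (4 * y) ^ k * kern_moment nu k).
  { intros k. apply is_RInt_Runique.
    eapply is_RInt_ext; [|exact (is_RInt_Rscal ((4 * y) ^ k) (is_kern_moment nu k))].
    intros x _. change ((4 * y) ^ k * (kern nu x * sin x ^ (2 * k)) = kern nu x * (4 * y * sin x ^ 2) ^ k).
    rewrite (Rpow_mult_distr (4 * y)), <- pow_mult. ring. }
  set (b := fun k => expc k * RInt (fun x => kern nu x * (4 * y * sin x ^ 2) ^ k) 0 (PI / 2)) in HS.
  set (e := fun k => PS_Int e1c k * (4 * y) ^ k).
  assert (Hb : Series b = RInt (fun x => kern nu x * exp (- (4 * y * sin x ^ 2))) 0 (PI / 2)).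
  { rewrite (is_series_unique _ _ HS). apply RInt_ext. intros x _. now rewrite PSeries_expc. }
  assert (Hbx : ex_series b) by (eexists; exact HS).
  assert (Hex : ex_series e) by apply ex_series_entire, entire_Int, entire_e1c.
  rewrite (Series_incr_1_aux (fun k => qcoef nu k * y ^ k * INR (fact k))) by (simpl; ring).
  transitivity (/ 2 * Series (fun k => e (S k)) - / sin (PI * nu) * Series (fun k => b (S k))).
  - rewrite <- !Series_scal_l, <- Series_minus.
    + apply Series_ext. intros k. unfold b, e. rewrite E.
      transitivity (y ^ S k * (qcoef nu (S k) * INR (fact (S k)))); [ring|]. rewrite qcoef_moment by assumption.
      rewrite (Rpow_mult_distr 4 y). ring.
    + apply ex_series_Rscal, (ex_series_incr_1 e), Hex.
    + apply ex_series_Rscal, (ex_series_incr_1 b), Hbx.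
  - rewrite <- Hb, (Series_incr_1 b) by exact Hbx.
    replace (b 0%nat) with (Kint nu).
    2: { unfold b. rewrite E, kern_moment_0. unfold expc. simpl. field. }
    replace (Ein (4 * y)) with (Series (fun k => e (S k))); [ring|].
    symmetry. unfold Ein, PSeries. apply (Series_incr_1_aux e). unfold e. simpl. ring.
Qed.

Lemma log_part_lim (nu : R) : (forall m : Z, nu <> IZR m) ->
  is_lim (fun w => PSeries (qcoef nu) w - / 2 * ln (4 * w)) p_infty (egamma + Kint nu / sin (PI * nu)).
Proof.
  intros Hnu. assert (HP := PI_RGT_0). assert (Hs := sin_PI_neq0 nu Hnu).
  destruct (ex_lim_log_part nu Hnu) as [l Hl]. destruct (qcoef_bound nu Hnu) as [C HC].
  assert (H4E : is_lim (fun w => Ein (4 * w) - ln (4 * w)) p_infty egamma).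
  { apply (is_lim_scale (fun w => Ein w - ln w)); [lra|apply egamma_spec]. }
  (* Subtracting half of Ein(4 w) in place of half of ln(4 w) keeps the function continuous at 0, as
     [abel_laplace] requires, and its average is known from [Ein_laplace]. *)
  set (f := fun w => PSeries (qcoef nu) w - / 2 * Ein (4 * w)).
  assert (Hq : forall x, continuous (PSeries (qcoef nu)) x) by (intros x; apply continuous_entire, entire_qcoef, Hnu).
  assert (HE : forall c x, continuous (fun x => Ein (c * x)) x).
  { intros c x. apply (continuous_comp (fun x => c * x) Ein); [solve_continuous|apply continuous_Ein]. }
  assert (Hf : is_lim f p_infty (l - / 2 * egamma)).
  { apply is_lim_ext with (fun w => (PSeries (qcoef nu) w - / 2 * ln (4 * w)) - / 2 * (Ein (4 * w) - ln (4 * w))).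
    - intros w. unfold f. ring.
    - apply is_lim_minus'; [exact Hl|]. apply (is_lim_scal_l _ (/ 2) p_infty egamma), H4E. }
  set (F := fun y => Series (fun k => qcoef nu k * y ^ k * INR (fact k)) - / 2 * ln (1 + 4 * y)).
  assert (HF : is_lim F p_infty (l - / 2 * egamma)).
  { apply (abel_laplace f); [|exact Hf|].
    - intros x. apply continuous_Rminus; [apply Hq|]. apply (continuous_Rmult (fun _ => / 2)); [apply continuous_const|apply HE].
    - intros y Hy.
      apply is_lim_ext with (fun T => RInt (fun t => exp (- t) * PSeries (qcoef nu) (y * t)) 0 T - / 2 * RInt (fun t => exp (- t) * Ein (4 * y * t)) 0 T).
      + intros T. symmetry. apply is_RInt_Runique.
        assert (I1 : is_RInt (fun t => exp (- t) * PSeries (qcoef nu) (y * t)) 0 T (RInt (fun t => exp (- t) * PSeries (qcoef nu) (y * t)) 0 T)).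
        { apply RInt_cont_correct. intros t. apply continuous_Rmult; [apply continuous_exp_opp|].
          apply (continuous_comp (fun t => y * t) (PSeries (qcoef nu))); [solve_continuous|apply Hq]. }
        assert (I2 : is_RInt (fun t => exp (- t) * Ein (4 * y * t)) 0 T (RInt (fun t => exp (- t) * Ein (4 * y * t)) 0 T)).
        { apply RInt_cont_correct. intros t. apply continuous_Rmult; [apply continuous_exp_opp|apply HE]. }
        eapply is_RInt_ext; [|exact (is_RInt_Rminus I1 (is_RInt_Rscal (/ 2) I2))].
        intros t _. change (exp (- t) * PSeries (qcoef nu) (y * t) - / 2 * (exp (- t) * Ein (4 * y * t)) = exp (- t) * f (y * t)).
        unfold f. replace (4 * (y * t)) with (4 * y * t) by ring. ring.
      + apply is_lim_minus'.
        * apply (laplace_series (fun t => exp (- t)) (qcoef nu) (fun k => INR (fact k)) y).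
          -- apply continuous_exp_opp.
          -- intros t _. left; apply exp_pos.
          -- now apply entire_qcoef.
          -- lra.
          -- apply RInt_exp_pow_lim.
          -- apply ex_series_le_R with (fun k => C * (4 ^ k * y ^ k * / INR (fact k))); [|apply ex_series_exp_scaled].
             intros k. assert (Hyk : 0 < y ^ k) by now apply pow_lt. assert (F0 := INR_fact_lt_0 k).
             rewrite Rabs_pos_eq by (repeat apply Rmult_le_pos; try apply Rabs_pos; lra).
             replace (Rabs (qcoef nu k) * y ^ k * INR (fact k)) with (Rabs (qcoef nu k) * INR (fact k) * y ^ k) by ring.
             replace (C * (4 ^ k * y ^ k * / INR (fact k))) with (C * (4 ^ k * / INR (fact k)) * y ^ k) by ring.
             apply Rmult_le_compat_r; [lra|apply HC].
        * apply (is_lim_scal_l _ (/ 2) p_infty (ln (1 + 4 * y))), Ein_laplace. lra. }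
  assert (HF2 : is_lim F p_infty (/ 2 * (egamma - 0) + / sin (PI * nu) * (Kint nu - 0))).
  { apply is_lim_ext_loc with (fun y => / 2 * ((Ein (4 * y) - ln (4 * y)) - ln (1 + / (4 * y))) +
      / sin (PI * nu) * (Kint nu - RInt (fun x => kern nu x * exp (- (4 * y * sin x ^ 2))) 0 (PI / 2))).
    - exists 0. intros y Hy. unfold F. rewrite log_part_mean by (assumption || lra).
      replace (1 + 4 * y) with (4 * y * (1 + / (4 * y))) by (field; lra).
      assert (0 < / (4 * y)) by (apply Rinv_0_lt_compat; lra). rewrite (ln_mult (4 * y) (1 + / (4 * y))) by lra. ring.
    - apply is_lim_plus'.
      + apply (is_lim_scal_l _ (/ 2) p_infty (Finite (egamma - 0))). apply is_lim_minus'; [exact H4E|].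
        rewrite <- ln_1. apply (is_lim_comp ln (fun y => 1 + / (4 * y)) p_infty (ln 1) 1).
        * apply is_lim_continuity, continuity_pt_filterlim, continuous_ln. lra.
        * replace (Finite 1) with (Finite (1 + / 4 * 0)) by (f_equal; ring). apply is_lim_plus'; [apply is_lim_const|].
          apply is_lim_ext with (fun y => / 4 * / y); [intros y; now rewrite Rinv_mult|].
          apply (is_lim_scal_l Rinv (/ 4) p_infty 0). apply (is_lim_inv (fun x => x) p_infty p_infty (is_lim_id p_infty)). discriminate.
        * exists 0. intros y Hy E. injection E. assert (0 < / (4 * y)) by (apply Rinv_0_lt_compat; lra). lra.
      + apply (is_lim_scal_l _ (/ sin (PI * nu)) p_infty (Finite (Kint nu - 0))). apply is_lim_minus'; [apply is_lim_const|].
        apply (RInt_concentrate (kern nu) (fun w => exp (- w))).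
        * apply continuous_kern.
        * apply continuous_exp_opp.
        * apply is_lim_ext with (fun w => exp (- (1 * w))); [intros w; now rewrite Rmult_1_l|]. apply is_lim_exp_neg. lra. }
  assert (E := is_lim_R_unique _ _ _ HF HF2).
  replace (egamma + Kint nu / sin (PI * nu)) with l; [exact Hl|]. unfold Rdiv. lra.
Qed.

(** The bracket of the theorem on the positive axis as a function of w = (x/2)^2, where ln 2 - ln(4
    w) / 2 stands for ln(2 / x). *)
Definition bracket_real (nu w : R) : R :=
  ln 2 - / 2 * ln (4 * w) + digamma nu + / (2 * nu)
  + PI * (cos (PI * nu) / sin (PI * nu)) * pw nu w / (2 * Gamma (nu + 1) ^ 2) * PSeries (pcoef nu) w
  + PSeries (qcoef nu) w.

Lemma bracket_real_lim (nu : R) : 0 < nu -> (forall m : Z, nu <> IZR m) -> is_lim (bracket_real nu) p_infty 0.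
Proof.
  intros Hnu Hz. assert (Hs := sin_PI_neq0 nu Hz). assert (HG := GI_pos nu Hnu).
  set (ct := cos (PI * nu) / sin (PI * nu)).
  apply is_lim_ext with (fun w => (ln 2 + digamma nu + / (2 * nu)) + (PI * ct / (2 * GI nu ^ 2) * (pw nu w * PSeries (pcoef nu) w)
     + (PSeries (qcoef nu) w - / 2 * ln (4 * w)))).
  { intros w. unfold bracket_real. rewrite Gamma_GI by assumption. fold ct. unfold Rdiv. ring. }
  replace (Finite 0) with (Finite ((ln 2 + digamma nu + / (2 * nu)) + (PI * ct / (2 * GI nu ^ 2) * GI nu ^ 2 + (egamma + Kint nu / sin (PI * nu))))).
  - apply is_lim_plus'; [apply is_lim_const|]. apply is_lim_plus'; [|now apply log_part_lim].
    apply (is_lim_scal_l _ (PI * ct / (2 * GI nu ^ 2)) p_infty (GI nu ^ 2)), power_part_lim, Hnu.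
  - f_equal. rewrite digamma_Kint by assumption. fold ct. field. repeat split; lra.
Qed.

(** * Complex power series with real coefficients *)

Lemma C_eq (x y : C) : Re x = Re y -> Im x = Im y -> x = y.
Proof. destruct x, y; simpl; intros -> ->; reflexivity. Qed.

Lemma im_le_Cmod (c : C) : Rabs (Im c) <= Cmod c.
Proof. eapply Rle_trans; [apply Rmax_r|apply Rmax_Cmod]. Qed.

Lemma Cmod_le_sum (c : C) : Cmod c <= Rabs (Re c) + Rabs (Im c).
Proof.
  rewrite <- (sqrt_pow2 (Rabs (Re c) + Rabs (Im c))).
  - apply sqrt_le_1_alt. rewrite <- (pow2_abs (fst c)), <- (pow2_abs (snd c)).
    generalize (Rabs_pos (fst c)) (Rabs_pos (snd c)). unfold Re, Im. nra.
  - generalize (Rabs_pos (Re c)) (Rabs_pos (Im c)). lra.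
Qed.

Definition Csummable (a : nat -> C) : Prop := ex_series (fun k => Cmod (a k)).

Lemma Csummable_Re (a : nat -> C) : Csummable a ->
  ex_series (fun k => Rabs (Re (a k))) /\ ex_series (fun k => Re (a k)).
Proof.
  intros H. assert (H1 : ex_series (fun k => Rabs (Re (a k)))).
  { apply ex_series_le_R with (2 := H). intros k. rewrite Rabs_Rabsolu. apply re_le_Cmod. }
  split; [exact H1|]. now apply ex_series_Rabs.
Qed.

Lemma Csummable_Im (a : nat -> C) : Csummable a ->
  ex_series (fun k => Rabs (Im (a k))) /\ ex_series (fun k => Im (a k)).
Proof.
  intros H. assert (H1 : ex_series (fun k => Rabs (Im (a k)))).
  { apply ex_series_le_R with (2 := H). intros k. rewrite Rabs_Rabsolu. apply im_le_Cmod. }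
  split; [exact H1|]. now apply ex_series_Rabs.
Qed.

Lemma Csummable_le (a : nat -> C) (b : nat -> R) : (forall k, Cmod (a k) <= b k) -> ex_series b -> Csummable a.
Proof.
  intros H. apply ex_series_le_R. intros k. rewrite Rabs_pos_eq by apply Cmod_ge_0. apply H.
Qed.

Lemma Csummable_scal (c : C) (a : nat -> C) : Csummable a -> Csummable (fun k => (c * a k)%C).
Proof.
  intros H. apply Csummable_le with (fun k => Cmod c * Cmod (a k)).
  - intros k. rewrite Cmod_mult. lra.
  - apply ex_series_Rscal, H.
Qed.

Lemma Csummable_plus (a b : nat -> C) : Csummable a -> Csummable b -> Csummable (fun k => (a k + b k)%C).
Proof.
  intros Ha Hb. apply Csummable_le with (fun k => Cmod (a k) + Cmod (b k)).
  - intros k. apply Cmod_triangle.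
  - apply (ex_series_plus (K := R_AbsRing) (V := R_NormedModule)); assumption.
Qed.

Lemma CSeries_ext (a b : nat -> C) : (forall k, a k = b k) -> CSeries a = CSeries b.
Proof. intros H. unfold CSeries. f_equal; apply Series_ext; intros k; now rewrite H. Qed.

Lemma CSeries_plus (a b : nat -> C) : Csummable a -> Csummable b ->
  CSeries (fun k => (a k + b k)%C) = (CSeries a + CSeries b)%C.
Proof.
  intros Ha Hb. apply C_eq.
  - apply (Series_plus (fun k => Re (a k)) (fun k => Re (b k))); [apply (Csummable_Re a Ha)|apply (Csummable_Re b Hb)].
  - apply (Series_plus (fun k => Im (a k)) (fun k => Im (b k))); [apply (Csummable_Im a Ha)|apply (Csummable_Im b Hb)].
Qed.

Lemma CSeries_scal_R (c : R) (a : nat -> C) : CSeries (fun k => (RtoC c * a k)%C) = (RtoC c * CSeries a)%C.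
Proof.
  apply C_eq.
  - rewrite re_scal_l. change (Series (fun k => Re (RtoC c * a k)) = c * Series (fun k => Re (a k))).
    rewrite <- Series_scal_l. apply Series_ext. intros k. apply re_scal_l.
  - rewrite im_scal_l. change (Series (fun k => Im (RtoC c * a k)) = c * Series (fun k => Im (a k))).
    rewrite <- Series_scal_l. apply Series_ext. intros k. apply im_scal_l.
Qed.

Lemma CSeries_scal (c : C) (a : nat -> C) : Csummable a ->
  CSeries (fun k => (c * a k)%C) = (c * CSeries a)%C.
Proof.
  intros Ha. destruct (Csummable_Re a Ha) as [_ H1]. destruct (Csummable_Im a Ha) as [_ H2].
  assert (HS : forall (d : R) (b : nat -> R), ex_series b -> ex_series (fun k => d * b k)).
  { intros d b. apply (ex_series_scal_l (K := R_AbsRing) (V := R_NormedModule) d b). }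
  apply C_eq.
  - change (Series (fun k => Re c * Re (a k) - Im c * Im (a k)) =
      Re c * Series (fun k => Re (a k)) - Im c * Series (fun k => Im (a k))).
    rewrite <- !Series_scal_l. apply Series_minus; now apply HS.
  - change (Series (fun k => Re c * Im (a k) + Im c * Re (a k)) =
      Re c * Series (fun k => Im (a k)) + Im c * Series (fun k => Re (a k))).
    rewrite <- !Series_scal_l. apply Series_plus; now apply HS.
Qed.

(** The factor 2 comes from bounding the two components, by which [CSeries] is defined,
    separately. *)
Lemma Cmod_CSeries (a : nat -> C) (b : nat -> R) : (forall k, Cmod (a k) <= b k) -> ex_series b ->
  Cmod (CSeries a) <= 2 * Series b.
Proof.
  intros H Hb. assert (Ha := Csummable_le a b H Hb).
  eapply Rle_trans; [apply Cmod_le_sum|]. unfold CSeries; simpl.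
  assert (B1 : Rabs (Series (fun k => Re (a k))) <= Series b).
  { eapply Rle_trans; [apply Series_Rabs, (Csummable_Re a Ha)|]. apply Series_le; [|exact Hb].
    intros k. split; [apply Rabs_pos|]. eapply Rle_trans; [apply re_le_Cmod|apply H]. }
  assert (B2 : Rabs (Series (fun k => Im (a k))) <= Series b).
  { eapply Rle_trans; [apply Series_Rabs, (Csummable_Im a Ha)|]. apply Series_le; [|exact Hb].
    intros k. split; [apply Rabs_pos|]. eapply Rle_trans; [apply im_le_Cmod|apply H]. }
  lra.
Qed.

Lemma CSeries_shift (a : nat -> C) : a O = RtoC 0 -> CSeries a = CSeries (fun k => a (S k)).
Proof.
  intros H. unfold CSeries. f_equal.
  - apply (Series_incr_1_aux (fun k => Re (a k))). rewrite H. reflexivity.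
  - apply (Series_incr_1_aux (fun k => Im (a k))). rewrite H. reflexivity.
Qed.

(* Complex values of a power series with real coefficients. *)
Definition CPS (a : nat -> R) (z : C) : C := CSeries (fun k => (RtoC (a k) * z ^ k)%C).

Lemma Cmod_term (a : R) (z : C) (k : nat) : Cmod (RtoC a * z ^ k)%C = Rabs (a * Cmod z ^ k).
Proof.
  rewrite Cmod_mult, Cmod_R, Cmod_pow, Rabs_mult. f_equal. symmetry. apply Rabs_pos_eq, pow_le, Cmod_ge_0.
Qed.

Lemma Csummable_CPS (a : nat -> R) (z : C) : entire a -> Csummable (fun k => (RtoC (a k) * z ^ k)%C).
Proof.
  intros Ha. apply Csummable_le with (fun k => Rabs (a k * Cmod z ^ k)); [|apply Ha].
  intros k. rewrite Cmod_term. lra.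
Qed.

Lemma CPS_ext (a b : nat -> R) (z : C) : (forall k, a k = b k) -> CPS a z = CPS b z.
Proof. intros H. apply CSeries_ext. intros k. now rewrite H. Qed.

Lemma CPS_plus (a b : nat -> R) (z : C) : entire a -> entire b ->
  CPS (fun k => a k + b k) z = (CPS a z + CPS b z)%C.
Proof.
  intros Ha Hb. unfold CPS. rewrite <- CSeries_plus by now apply Csummable_CPS.
  apply CSeries_ext. intros k. rewrite RtoC_plus. ring.
Qed.

Lemma CPS_scal (c : R) (a : nat -> R) (z : C) : CPS (fun k => c * a k) z = (RtoC c * CPS a z)%C.
Proof.
  unfold CPS. rewrite <- CSeries_scal_R. apply CSeries_ext. intros k. rewrite RtoC_mult. ring.
Qed.

Lemma CPS_const (a : nat -> R) (z : C) : (forall k, a (S k) = 0) -> CPS a z = RtoC (a O).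
Proof.
  intros H. assert (Hz : forall b : nat -> R, (forall k, b (S k) = 0) -> Series b = b O).
  { intros b Hb. apply is_series_unique.
    assert (E : forall n, sum_n b n = b O).
    { induction n as [|n IH]; [apply sum_O|]. rewrite sum_Sn, IH, Hb. apply Rplus_0_r. }
    change (is_lim_seq (sum_n b) (b O)). apply is_lim_seq_ext with (fun _ => b O); [now intros; rewrite E|apply is_lim_seq_const]. }
  unfold CPS, CSeries. rewrite !Hz.
  - apply C_eq; simpl; ring.
  - intros k. rewrite H. simpl. ring.
  - intros k. rewrite H. simpl. ring.
Qed.

Lemma CPS_RtoC (a : nat -> R) (x : R) : CPS a (RtoC x) = RtoC (PSeries a x).
Proof.
  apply C_eq.
  - change (Series (fun k => Re (RtoC (a k) * RtoC x ^ k)) = Series (fun k => a k * x ^ k)).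
    apply Series_ext. intros k. now rewrite re_scal_l, <- RtoC_pow.
  - change (Series (fun k => Im (RtoC (a k) * RtoC x ^ k)) = 0).
    replace 0 with (Series (fun _ : nat => 0 * 0)) by (rewrite Series_scal_l; ring).
    apply Series_ext. intros k. rewrite im_scal_l, <- RtoC_pow. simpl. ring.
Qed.

Lemma CPS_mult_w (c : nat -> R) (z : C) : entire c ->
  (z * CPS (PS_derive c) z)%C = CPS (fun k => INR k * c k) z.
Proof.
  intros Hc. unfold CPS. rewrite <- CSeries_scal by (apply Csummable_CPS, entire_derive, Hc).
  rewrite (CSeries_shift (fun k => (RtoC (INR k * c k) * z ^ k)%C)).
  - apply CSeries_ext. intros k. unfold PS_derive. rewrite Cpow_S. ring.
  - simpl (INR 0). rewrite Rmult_0_l. ring.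
Qed.

(** Four real Cauchy products, one for each pair of components; [T] matches z^n with z^k z^(n-k). *)
Lemma CPS_PS_mult (a b : nat -> R) (z : C) : entire a -> entire b ->
  CPS (PS_mult a b) z = (CPS a z * CPS b z)%C.
Proof.
  intros Ha Hb. set (x := fun k => (RtoC (a k) * z ^ k)%C). set (y := fun k => (RtoC (b k) * z ^ k)%C).
  assert (Hx : Csummable x) by now apply Csummable_CPS.
  assert (Hy : Csummable y) by now apply Csummable_CPS.
  destruct (Csummable_Re x Hx) as [xr1 xr2]. destruct (Csummable_Im x Hx) as [xi1 xi2].
  destruct (Csummable_Re y Hy) as [yr1 yr2]. destruct (Csummable_Im y Hy) as [yi1 yi2].
  assert (M : forall u v : nat -> R, ex_series (fun k => Rabs (u k)) -> ex_series (fun k => Rabs (v k)) ->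
    ex_series (fun n => sum_f_R0 (fun k => u k * v (n - k)%nat) n) /\
    Series (fun n => sum_f_R0 (fun k => u k * v (n - k)%nat) n) = Series u * Series v).
  { intros u v Hu Hv. assert (H := is_series_mult u v _ _ (Series_correct _ (ex_series_Rabs _ Hu)) (Series_correct _ (ex_series_Rabs _ Hv)) Hu Hv).
    split; [eexists; exact H|now apply is_series_unique]. }
  destruct (M (fun k => Re (x k)) (fun k => Re (y k)) xr1 yr1) as [rr1 rr2].
  destruct (M (fun k => Im (x k)) (fun k => Im (y k)) xi1 yi1) as [ii1 ii2].
  destruct (M (fun k => Re (x k)) (fun k => Im (y k)) xr1 yi1) as [ri1 ri2].
  destruct (M (fun k => Im (x k)) (fun k => Re (y k)) xi1 yr1) as [ir1 ir2].
  assert (T : forall n k, (k <= n)%nat -> (RtoC (a k * b (n - k)%nat) * z ^ n = x k * y (n - k)%nat)%C).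
  { intros n k Hk. unfold x, y. replace n with (k + (n - k))%nat at 2 by lia. rewrite Cpow_add_r, RtoC_mult. ring. }
  apply C_eq.
  - change (Series (fun n => Re (RtoC (PS_mult a b n) * z ^ n)) =
      Series (fun k => Re (x k)) * Series (fun k => Re (y k)) - Series (fun k => Im (x k)) * Series (fun k => Im (y k))).
    rewrite <- rr2, <- ii2, <- Series_minus by assumption. apply Series_ext. intros n.
    rewrite re_scal_l. unfold PS_mult. rewrite Rmult_comm, scal_sum, <- minus_sum. apply sum_eq. intros k Hk.
    rewrite <- re_scal_l, T by assumption. reflexivity.
  - change (Series (fun n => Im (RtoC (PS_mult a b n) * z ^ n)) =
      Series (fun k => Re (x k)) * Series (fun k => Im (y k)) + Series (fun k => Im (x k)) * Series (fun k => Re (y k))).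
    rewrite <- ri2, <- ir2, <- Series_plus by assumption. apply Series_ext. intros n.
    rewrite im_scal_l. unfold PS_mult. rewrite Rmult_comm, scal_sum, <- plus_sum. apply sum_eq. intros k Hk.
    rewrite <- im_scal_l, T by assumption. reflexivity.
Qed.

(** As r >= 1, exponents of r may be raised freely, so the crude factor n^2 r^n reproduces itself in
    the induction. At n = 0 the factor [INR n] neutralizes [pred]. *)
Lemma Cpow_taylor (z h : C) (n : nat) (r : R) : 1 <= r -> Cmod z <= r -> Cmod (z + h)%C <= r ->
  Cmod ((z + h) ^ n - z ^ n - RtoC (INR n) * z ^ pred n * h)%C <= INR n ^ 2 * r ^ n * Cmod h ^ 2.
Proof.
  intros Hr Hz Hzh. induction n as [|n IH].
  - simpl. replace (1 - 1 - RtoC 0 * 1 * h)%C with (RtoC 0) by ring. rewrite Cmod_0. lra.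
  - replace ((z + h) ^ S n - z ^ S n - RtoC (INR (S n)) * z ^ pred (S n) * h)%C with
      ((z + h) * ((z + h) ^ n - z ^ n - RtoC (INR n) * z ^ pred n * h) + RtoC (INR n) * z ^ pred n * (h * h))%C.
    2: { rewrite S_INR, RtoC_plus. simpl pred. destruct n as [|n]; [simpl; ring|]. simpl pred. rewrite !Cpow_S. ring. }
    eapply Rle_trans; [apply Cmod_triangle|]. rewrite !Cmod_mult, Cmod_R, Cmod_pow, (Rabs_pos_eq (INR n)) by apply pos_INR.
    assert (Hn := pos_INR n). assert (Hh := Cmod_ge_0 h). assert (Hm := Cmod_ge_0 z).
    assert (Hrn : 1 <= r ^ n) by now apply pow_R1_Rle.
    assert (B1 : Cmod (z + h) * Cmod ((z + h) ^ n - z ^ n - RtoC (INR n) * z ^ pred n * h) <= r * (INR n ^ 2 * r ^ n * Cmod h ^ 2)).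
    { apply Rmult_le_compat; try apply Cmod_ge_0; assumption. }
    assert (B2 : Cmod z ^ pred n <= r ^ S n).
    { apply Rle_trans with (r ^ pred n); [apply pow_incr; lra|]. apply Rle_pow; [assumption|lia]. }
    assert (B3 : INR n * Cmod z ^ pred n * (Cmod h * Cmod h) <= INR n * r ^ S n * (Cmod h * Cmod h)).
    { apply Rmult_le_compat_r; [nra|]. apply Rmult_le_compat_l; assumption. }
    rewrite S_INR. replace (r * (INR n ^ 2 * r ^ n * Cmod h ^ 2)) with (INR n ^ 2 * r ^ S n * Cmod h ^ 2) in B1 by (simpl; ring).
    replace ((INR n + 1) ^ 2 * r ^ S n * Cmod h ^ 2) with
      (INR n ^ 2 * r ^ S n * Cmod h ^ 2 + INR n * r ^ S n * (Cmod h * Cmod h) + (INR n + 1) * r ^ S n * Cmod h ^ 2) by ring.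
    assert (0 <= (INR n + 1) * r ^ S n * Cmod h ^ 2).
    { apply Rmult_le_pos; [|apply pow2_ge_0]. apply Rmult_le_pos; [lra|apply pow_le; lra]. }
    lra.
Qed.

(** Termwise Taylor estimates with r = |z| + 1 sum up, as n^2 a_n is again entire. A quadratic error
    uniform in |h| <= 1 is all that differentiation along a curve uses. *)
Lemma CPS_taylor (a : nat -> R) (z : C) : entire a ->
  exists K, 0 <= K /\ forall h, Cmod h <= 1 ->
    Cmod (CPS a (z + h) - CPS a z - CPS (PS_derive a) z * h)%C <= K * Cmod h ^ 2.
Proof.
  intros Ha. set (r := Cmod z + 1). assert (Hr : 1 <= r) by (unfold r; generalize (Cmod_ge_0 z); lra).
  assert (Hsum : ex_series (fun k => Rabs (INR k * (INR k * a k) * r ^ k))).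
  { apply (entire_INR_mult (fun k => INR k * a k) (entire_INR_mult a Ha) r). }
  assert (Hpos : 0 <= Series (fun k => Rabs (INR k * (INR k * a k) * r ^ k))).
  { replace 0 with (Series (fun _ : nat => 0 * 0)) by (rewrite Series_scal_l; ring).
    apply Series_le; [|exact Hsum]. intros k. rewrite Rmult_0_l. split; [lra|apply Rabs_pos]. }
  exists (2 * Series (fun k => Rabs (INR k * (INR k * a k) * r ^ k))). split; [lra|]. intros h Hh.
  assert (E1 : CPS (PS_derive a) z = CSeries (fun k => (RtoC (INR k * a k) * z ^ pred k)%C)).
  { symmetry. apply CSeries_shift. simpl. rewrite Rmult_0_l. ring. }
  assert (S1 : Csummable (fun k => (RtoC (INR k * a k) * z ^ pred k)%C)).
  { apply (ex_series_incr_1 (K := R_AbsRing) (V := R_NormedModule)). simpl pred. apply (Csummable_CPS (PS_derive a)), entire_derive, Ha. }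
  assert (E : (CPS a (z + h) - CPS a z - CPS (PS_derive a) z * h)%C =
    CSeries (fun k => (RtoC (a k) * ((z + h) ^ k - z ^ k - RtoC (INR k) * z ^ pred k * h))%C)).
  { transitivity (CSeries (fun k => (RtoC (a k) * (z + h) ^ k + (RtoC (-1) * (RtoC (a k) * z ^ k) + (- h) * (RtoC (INR k * a k) * z ^ pred k)))%C)).
    - rewrite CSeries_plus.
      + rewrite CSeries_plus.
        * rewrite CSeries_scal_R, CSeries_scal by assumption. rewrite <- E1. unfold CPS. ring.
        * now apply Csummable_scal, Csummable_CPS.
        * now apply Csummable_scal.
      + now apply Csummable_CPS.
      + apply Csummable_plus; apply Csummable_scal; [now apply Csummable_CPS|assumption].
    - apply CSeries_ext. intros k. rewrite RtoC_mult. ring. }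
  rewrite E.
  replace (2 * Series (fun k => Rabs (INR k * (INR k * a k) * r ^ k)) * Cmod h ^ 2) with
    (2 * Series (fun k => Rabs (INR k * (INR k * a k) * r ^ k) * Cmod h ^ 2)) by (rewrite Series_scal_r; ring).
  apply Cmod_CSeries.
  - intros k. rewrite Cmod_mult, Cmod_R.
    assert (T := Cpow_taylor z h k r Hr ltac:(unfold r; lra) ltac:(eapply Rle_trans; [apply Cmod_triangle|unfold r; lra])).
    eapply Rle_trans; [apply Rmult_le_compat_l; [apply Rabs_pos|exact T]|].
    rewrite !Rabs_mult, (Rabs_pos_eq (INR k)), (Rabs_pos_eq (r ^ k)) by (apply pos_INR || (apply pow_le; lra)). right. ring.
  - apply (ex_series_scal_r (Cmod h ^ 2) (fun k => Rabs (INR k * (INR k * a k) * r ^ k))), Hsum.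
Qed.

(** * Derivatives along curves and the principal logarithm *)

(** Componentwise, in agreement with [path_derive]. *)
Definition is_derive_C (f : R -> C) (t : R) (l : C) : Prop :=
  is_derive (fun s => Re (f s)) t (Re l) /\ is_derive (fun s => Im (f s)) t (Im l).

Lemma is_derive_C_replace (f : R -> C) (t : R) (l l' : C) : is_derive_C f t l -> l = l' -> is_derive_C f t l'.
Proof. intros H <-. exact H. Qed.

Lemma is_derive_C_ext (f g : R -> C) (t : R) (l : C) : (forall s, f s = g s) -> is_derive_C f t l -> is_derive_C g t l.
Proof.
  intros H [H1 H2]. split.
  - apply is_derive_ext with (2 := H1). intros s. now rewrite H.
  - apply is_derive_ext with (2 := H2). intros s. now rewrite H.
Qed.

Lemma is_derive_C_const (c : C) (t : R) : is_derive_C (fun _ => c) t (RtoC 0).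
Proof. split; apply (is_derive_const (K := R_AbsRing) (V := R_NormedModule)). Qed.

Lemma is_derive_C_plus (f g : R -> C) (t : R) (k l : C) : is_derive_C f t k -> is_derive_C g t l -> is_derive_C (fun s => (f s + g s)%C) t (k + l)%C.
Proof.
  intros [F1 F2] [G1 G2]. split.
  - apply (is_derive_plus (fun s => Re (f s)) (fun s => Re (g s))); assumption.
  - apply (is_derive_plus (fun s => Im (f s)) (fun s => Im (g s))); assumption.
Qed.

Lemma is_derive_C_mult (f g : R -> C) (t : R) (k l : C) : is_derive_C f t k -> is_derive_C g t l ->
  is_derive_C (fun s => (f s * g s)%C) t (k * g t + f t * l)%C.
Proof.
  intros [F1 F2] [G1 G2].
  assert (M : forall u v du dv, is_derive u t du -> is_derive v t dv -> is_derive (fun s => u s * v s) t (du * v t + u t * dv)).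
  { intros u v du dv Hu Hv. apply (is_derive_mult u v); try assumption. intros; apply Rmult_comm. }
  split.
  - eapply is_derive_replace.
    + apply (is_derive_minus (fun s => Re (f s) * Re (g s)) (fun s => Im (f s) * Im (g s))); apply M; eassumption.
    + change (Re k * Re (g t) + Re (f t) * Re l - (Im k * Im (g t) + Im (f t) * Im l) =
        Re k * Re (g t) - Im k * Im (g t) + (Re (f t) * Re l - Im (f t) * Im l)). ring.
  - eapply is_derive_replace.
    + apply (is_derive_plus (fun s => Re (f s) * Im (g s)) (fun s => Im (f s) * Re (g s))); apply M; eassumption.
    + change (Re k * Im (g t) + Re (f t) * Im l + (Im k * Re (g t) + Im (f t) * Re l) =
        Re k * Im (g t) + Im k * Re (g t) + (Re (f t) * Im l + Im (f t) * Re l)). ring.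
Qed.

Lemma is_derive_C_scal (c : C) (f : R -> C) (t : R) (l : C) : is_derive_C f t l -> is_derive_C (fun s => (c * f s)%C) t (c * l)%C.
Proof.
  intros H. eapply is_derive_C_replace; [apply (is_derive_C_mult (fun _ => c) f t _ _ (is_derive_C_const c t) H)|]. ring.
Qed.

Definition continuous_C (f : R -> C) (t : R) : Prop :=
  continuous (fun s => Re (f s)) t /\ continuous (fun s => Im (f s)) t.

Lemma is_derive_C_continuous (f : R -> C) (t : R) (l : C) : is_derive_C f t l -> continuous_C f t.
Proof.
  intros [H1 H2]. split.
  - apply (ex_derive_continuous (fun s => Re (f s))). eexists; exact H1.
  - apply (ex_derive_continuous (fun s => Im (f s))). eexists; exact H2.
Qed.

Lemma continuous_C_mult (f g : R -> C) (t : R) : continuous_C f t -> continuous_C g t -> continuous_C (fun s => (f s * g s)%C) t.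
Proof.
  intros [F1 F2] [G1 G2]. split.
  - apply (continuous_Rminus (fun s => Re (f s) * Re (g s)) (fun s => Im (f s) * Im (g s))); now apply continuous_Rmult.
  - apply (continuous_Rplus (fun s => Re (f s) * Im (g s)) (fun s => Im (f s) * Re (g s))); now apply continuous_Rmult.
Qed.

Lemma continuous_C_plus (f g : R -> C) (t : R) : continuous_C f t -> continuous_C g t -> continuous_C (fun s => (f s + g s)%C) t.
Proof. intros [F1 F2] [G1 G2]. split; now apply continuous_Rplus. Qed.

Lemma continuous_C_const (c : C) (t : R) : continuous_C (fun _ => c) t.
Proof. split; apply continuous_const. Qed.

Lemma continuous_C_inv (f : R -> C) (t : R) : continuous_C f t -> f t <> RtoC 0 -> continuous_C (fun s => (/ f s)%C) t.
Proof.
  intros [F1 F2] H0.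
  assert (Hn : Re (f t) ^ 2 + Im (f t) ^ 2 <> 0).
  { intros E. apply H0. apply C_eq; simpl; nra. }
  assert (Hi : continuous (fun s => / (Re (f s) ^ 2 + Im (f s) ^ 2)) t).
  { apply (continuous_comp (fun s => Re (f s) ^ 2 + Im (f s) ^ 2) Rinv).
    - apply continuous_Rplus; now apply continuous_pow.
    - now apply continuous_Rinv. }
  split.
  - apply (continuous_Rmult (fun s => Re (f s)) (fun s => / (Re (f s) ^ 2 + Im (f s) ^ 2))); assumption.
  - apply (continuous_Rmult (fun s => - Im (f s)) (fun s => / (Re (f s) ^ 2 + Im (f s) ^ 2))); [|assumption].
    apply (continuous_opp (fun s => Im (f s))). assumption.
Qed.

Lemma is_derive_dominated (r B : R -> R) (t : R) :
  locally t (fun s => Rabs (r s) <= B s) -> B t = 0 -> is_derive B t 0 -> is_derive r t 0.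
Proof.
  intros [d Hd] HB0 HB.
  assert (Hr0 : r t = 0).
  { assert (H : Rabs (r t) <= B t) by (apply Hd, ball_center). rewrite HB0 in H.
    assert (H' := Rabs_pos (r t)). destruct (Req_dec (r t) 0) as [E|E]; [exact E|].
    apply Rabs_pos_lt in E. lra. }
  apply is_derive_Reals. apply is_derive_Reals in HB. intros eps Heps.
  destruct (HB eps Heps) as [d2 Hd2].
  assert (Hm : 0 < Rmin d d2) by (apply Rmin_glb_lt; apply cond_pos).
  exists (mkposreal _ Hm). simpl. intros h Hh Hhm.
  specialize (Hd2 h Hh (Rlt_le_trans _ _ _ Hhm (Rmin_r _ _))).
  assert (Hb : Rabs (r (t + h)) <= B (t + h)).
  { apply Hd. change (Rabs (t + h - t) < d). replace (t + h - t) with h by ring.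
    eapply Rlt_le_trans; [exact Hhm|apply Rmin_l]. }
  rewrite HB0, !Rminus_0_r in Hd2. rewrite Hr0, !Rminus_0_r.
  eapply Rle_lt_trans; [|exact Hd2]. unfold Rdiv. rewrite !Rabs_mult.
  apply Rmult_le_compat_r; [apply Rabs_pos|]. eapply Rle_trans; [exact Hb|apply Rle_abs].
Qed.

(** The error of the linear approximation is at most K times the squared displacement of the curve,
    which has derivative 0 at t; [is_derive_dominated] passes this on to the error. *)
Lemma is_derive_C_CPS (a : nat -> R) (g : R -> C) (t : R) (l : C) : entire a -> is_derive_C g t l ->
  is_derive_C (fun s => CPS a (g s)) t (CPS (PS_derive a) (g t) * l)%C.
Proof.
  intros Ha Hg. assert (Hg' := Hg). destruct Hg' as [G1 G2].
  destruct (CPS_taylor a (g t) Ha) as [K [HK HT]].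
  set (D := CPS (PS_derive a) (g t)).
  set (rho := fun s => (CPS a (g s) - CPS a (g t) - D * (g s - g t))%C).
  set (B := fun s => K * ((Re (g s) - Re (g t)) ^ 2 + (Im (g s) - Im (g t)) ^ 2)).
  assert (HB : is_derive B t 0).
  { eapply is_derive_replace.
    - apply is_derive_scal. apply (is_derive_plus (fun s => (Re (g s) - Re (g t)) ^ 2) (fun s => (Im (g s) - Im (g t)) ^ 2)).
      + apply (is_derive_pow (fun s => Re (g s) - Re (g t)) 2).
        apply (is_derive_minus (fun s => Re (g s)) (fun _ => Re (g t))); [exact G1|apply (is_derive_const (K := R_AbsRing) (V := R_NormedModule))].
      + apply (is_derive_pow (fun s => Im (g s) - Im (g t)) 2).
        apply (is_derive_minus (fun s => Im (g s)) (fun _ => Im (g t))); [exact G2|apply (is_derive_const (K := R_AbsRing) (V := R_NormedModule))].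
    - rewrite !Rminus_diag. simpl. unfold plus; simpl. ring. }
  assert (HB0 : B t = 0) by (unfold B; rewrite !Rminus_diag; simpl; ring).
  assert (HD : is_derive_C (fun s => (g s - g t)%C) t l).
  { eapply is_derive_C_replace; [apply is_derive_C_plus; [exact Hg|apply (is_derive_C_const (- g t))]|]. ring. }
  assert (Hrho : locally t (fun s => Cmod (rho s) <= B s)).
  { destruct (is_derive_C_continuous _ _ _ HD) as [C1 C2].
    (* Two components below 1/2 keep the displacement within the unit disc required by
       [CPS_taylor]. *)
    assert (Hh : 0 < / 2) by lra.
    assert (L1 := proj1 (filterlim_locally _ _) C1 (mkposreal _ Hh)).
    assert (L2 := proj1 (filterlim_locally _ _) C2 (mkposreal _ Hh)).
    generalize (filter_and _ _ L1 L2). apply filter_imp. intros s [B1 B2].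
    change (Rabs (Re (g s - g t) - Re (g t - g t)) < / 2) in B1.
    change (Rabs (Im (g s - g t) - Im (g t - g t)) < / 2) in B2.
    replace (g t - g t)%C with (RtoC 0) in * by ring. simpl (Re (RtoC 0)) in B1. simpl (Im (RtoC 0)) in B2.
    rewrite Rminus_0_r in B1, B2.
    assert (Hc : Cmod (g s - g t) <= 1) by (eapply Rle_trans; [apply Cmod_le_sum|lra]).
    specialize (HT _ Hc). replace (g t + (g s - g t))%C with (g s) in HT by ring.
    unfold rho, D. eapply Rle_trans; [exact HT|]. rewrite Cmod2_alt. right. reflexivity. }
  apply is_derive_C_ext with (fun s => (CPS a (g t) + (D * (g s - g t) + rho s))%C).
  { intros s. unfold rho. ring. }
  eapply is_derive_C_replace.
  - apply is_derive_C_plus; [apply is_derive_C_const|]. apply is_derive_C_plus; [apply is_derive_C_scal, HD|].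
    instantiate (1 := RtoC 0). split.
    + apply is_derive_dominated with B; try assumption. revert Hrho. apply filter_imp. intros s Hs.
      eapply Rle_trans; [apply re_le_Cmod|exact Hs].
    + apply is_derive_dominated with B; try assumption. revert Hrho. apply filter_imp. intros s Hs.
      eapply Rle_trans; [apply im_le_Cmod|exact Hs].
  - ring.
Qed.

Lemma is_derive_C_Cexp (f : R -> C) (t : R) (l : C) : is_derive_C f t l -> is_derive_C (fun s => Cexp (f s)) t (Cexp (f t) * l)%C.
Proof.
  intros [F1 F2].
  assert (HE : is_derive (fun s => exp (Re (f s))) t (Re l * exp (Re (f t)))).
  { apply (is_derive_comp exp (fun s => Re (f s))); [apply is_derive_exp|exact F1]. }
  assert (HC : is_derive (fun s => cos (Im (f s))) t (Im l * - sin (Im (f t)))).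
  { apply (is_derive_comp cos (fun s => Im (f s))); [apply is_derive_cos|exact F2]. }
  assert (HS : is_derive (fun s => sin (Im (f s))) t (Im l * cos (Im (f t)))).
  { apply (is_derive_comp sin (fun s => Im (f s))); [apply is_derive_sin|exact F2]. }
  split.
  - eapply is_derive_replace; [apply (is_derive_mult (fun s => exp (Re (f s))) (fun s => cos (Im (f s)))); [exact HE|exact HC|intros; apply Rmult_comm]|].
    change (Re l * exp (Re (f t)) * cos (Im (f t)) + exp (Re (f t)) * (Im l * - sin (Im (f t))) =
      exp (Re (f t)) * cos (Im (f t)) * Re l - exp (Re (f t)) * sin (Im (f t)) * Im l). ring.
  - eapply is_derive_replace; [apply (is_derive_mult (fun s => exp (Re (f s))) (fun s => sin (Im (f s)))); [exact HE|exact HS|intros; apply Rmult_comm]|].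
    change (Re l * exp (Re (f t)) * sin (Im (f t)) + exp (Re (f t)) * (Im l * cos (Im (f t))) =
      exp (Re (f t)) * cos (Im (f t)) * Im l + exp (Re (f t)) * sin (Im (f t)) * Re l). ring.
Qed.

Lemma Cexp_plus (x y : C) : Cexp (x + y) = (Cexp x * Cexp y)%C.
Proof.
  apply C_eq.
  - change (exp (Re x + Re y) * cos (Im x + Im y) =
      exp (Re x) * cos (Im x) * (exp (Re y) * cos (Im y)) - exp (Re x) * sin (Im x) * (exp (Re y) * sin (Im y))).
    rewrite exp_plus, cos_plus. ring.
  - change (exp (Re x + Re y) * sin (Im x + Im y) =
      exp (Re x) * cos (Im x) * (exp (Re y) * sin (Im y)) + exp (Re x) * sin (Im x) * (exp (Re y) * cos (Im y))).
    rewrite exp_plus, sin_plus. ring.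
Qed.

Lemma Cexp_0 : Cexp (RtoC 0) = RtoC 1.
Proof. unfold Cexp. apply C_eq; simpl; rewrite exp_0, ?cos_0, ?sin_0; ring. Qed.

Definition slit (z : C) : Prop := ~ (Im z = 0 /\ Re z <= 0).

Lemma slit_pos (z : C) : slit z -> 0 < Cmod z + Re z.
Proof.
  intros H. assert (H1 := re_le_Cmod z). apply Rabs_le_between in H1.
  destruct (Req_dec (Cmod z + Re z) 0) as [E|E]; [|lra]. exfalso. apply H.
  assert (H2 := Cmod2_alt z). assert (H3 : Cmod z = - Re z) by lra. rewrite H3 in H2.
  split; [nra|]. generalize (Cmod_ge_0 z). lra.
Qed.

Lemma slit_neq0 (z : C) : slit z -> z <> RtoC 0.
Proof. intros H ->. apply H. simpl. split; [reflexivity|lra]. Qed.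

Lemma slit_scal (c : R) (z : C) : 0 < c -> slit z -> slit (RtoC c * z)%C.
Proof.
  intros Hc H [H1 H2]. rewrite im_scal_l in H1. rewrite re_scal_l in H2. apply H. split; nra.
Qed.

(** The half-angle formula. Unlike the case distinction with [acos], it is one smooth expression
    across the positive real axis, hence differentiable along curves in the whole cut plane. *)
Lemma Carg_atan (z : C) : slit z -> Carg z = 2 * atan (Im z / (Cmod z + Re z)).
Proof.
  intros H. assert (Hp := slit_pos z H). assert (Hr : 0 < Cmod z) by (apply Cmod_gt_0, slit_neq0, H).
  set (r := Cmod z) in *. set (x := Re z) in *. set (y := Im z) in *. set (u := y / (r + x)).
  assert (Hr2 : r ^ 2 = x ^ 2 + y ^ 2) by apply Cmod2_alt.
  assert (Hb := atan_bound u).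
  assert (Hcos : cos (2 * atan u) = x / r).
  { rewrite cos_2a_cos, cos_atan.
    assert (Hu : 1 + u² = 2 * r / (r + x)).
    { unfold u, Rsqr. apply (Rmult_eq_reg_r ((r + x) ^ 2)); [|apply pow_nonzero; lra].
      transitivity ((r + x) ^ 2 + y ^ 2); [field; lra|]. transitivity (2 * r * (r + x)); [nra|field; lra]. }
    assert (H0 : 0 < 1 + u²) by (generalize (Rle_0_sqr u); lra).
    transitivity (2 / (sqrt (1 + u²) * sqrt (1 + u²)) - 1).
    { field. apply Rgt_not_eq, sqrt_lt_R0, H0. }
    rewrite sqrt_sqrt by lra. rewrite Hu. field. lra. }
  unfold Carg. fold x y r. destruct (Rle_dec 0 y) as [Hy|Hy].
  - rewrite <- Hcos. apply acos_cos. split; [|lra].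
    assert (0 <= u) by (apply Rdiv_le_0_compat; lra).
    assert (0 <= atan u).
    { rewrite <- atan_0. destruct H0 as [H0| <-]; [left; now apply atan_increasing|lra]. }
    lra.
  - rewrite <- Hcos. rewrite <- cos_neg.
    assert (atan u <= 0).
    { rewrite <- atan_0. left. apply atan_increasing. unfold u.
      apply Rmult_lt_reg_r with (r + x); [lra|]. replace (y / (r + x) * (r + x)) with y by (field; lra). lra. }
    rewrite acos_cos by lra. ring.
Qed.

Lemma slit_locally (g : R -> C) (t : R) : continuous_C g t -> slit (g t) -> locally t (fun s => slit (g s)).
Proof.
  intros [H1 H2] H.
  destruct (Req_dec (Im (g t)) 0) as [E|E].
  - assert (Hx : 0 < Re (g t)).
    { apply Rnot_le_lt. intros Hx. now apply H. }
    assert (L := proj1 (filterlim_locally _ _) H1 (mkposreal _ Hx)).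
    revert L. apply filter_imp. intros s Hs. change (Rabs (Re (g s) - Re (g t)) < Re (g t)) in Hs.
    apply Rabs_lt_between in Hs. intros [_ Hn]. lra.
  - assert (Hy := Rabs_pos_lt _ E).
    assert (L := proj1 (filterlim_locally _ _) H2 (mkposreal _ Hy)).
    revert L. apply filter_imp. intros s Hs. change (Rabs (Im (g s) - Im (g t)) < Rabs (Im (g t))) in Hs.
    intros [Hn _]. rewrite Hn, Rminus_0_l, Rabs_Ropp in Hs. lra.
Qed.

Lemma is_derive_C_Clog (g : R -> C) (t : R) (l : C) : slit (g t) -> is_derive_C g t l ->
  is_derive_C (fun s => Clog (g s)) t (l / g t)%C.
Proof.
  intros H Hg. assert (HL := slit_locally g t (is_derive_C_continuous _ _ _ Hg) H).
  assert (Hp := slit_pos _ H). assert (Hr : 0 < Cmod (g t)) by (apply Cmod_gt_0, slit_neq0, H).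
  assert (Hr2 : Cmod (g t) ^ 2 = Re (g t) ^ 2 + Im (g t) ^ 2) by apply Cmod2_alt.
  destruct Hg as [G1 G2].
  set (x := Re (g t)) in *. set (y := Im (g t)) in *. set (r := Cmod (g t)) in *.
  set (x' := Re l) in *. set (y' := Im l) in *.
  assert (Hmod : is_derive (fun s => Cmod (g s)) t ((x * x' + y * y') / r)).
  { eapply is_derive_replace.
    - apply (is_derive_comp sqrt (fun s => Re (g s) ^ 2 + Im (g s) ^ 2)).
      + apply is_derive_Reals. apply derivable_pt_lim_sqrt. fold x y. rewrite <- Hr2. now apply pow_lt.
      + apply (is_derive_plus (fun s => Re (g s) ^ 2) (fun s => Im (g s) ^ 2)).
        * apply (is_derive_pow (fun s => Re (g s)) 2), G1.
        * apply (is_derive_pow (fun s => Im (g s)) 2), G2.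
    - fold x y. rewrite <- Hr2, sqrt_pow2 by lra. unfold plus, scal; simpl; unfold mult; simpl. field. lra. }
  assert (Hre : is_derive (fun s => ln (Cmod (g s))) t ((x * x' + y * y') / r ^ 2)).
  { eapply is_derive_replace.
    - apply (is_derive_comp ln (fun s => Cmod (g s))); [|exact Hmod].
      apply is_derive_Reals, derivable_pt_lim_ln. exact Hr.
    - change ((x * x' + y * y') / r * / r = (x * x' + y * y') / r ^ 2). field. lra. }
  assert (Him : is_derive (fun s => 2 * atan (Im (g s) / (Cmod (g s) + Re (g s)))) t ((x * y' - y * x') / r ^ 2)).
  { eapply is_derive_replace.
    - apply is_derive_scal. apply (is_derive_comp atan (fun s => Im (g s) / (Cmod (g s) + Re (g s)))).
      + apply is_derive_Reals, derivable_pt_lim_atan.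
      + apply (is_derive_div (fun s => Im (g s)) (fun s => Cmod (g s) + Re (g s))); [exact G2| |fold r x; lra].
        apply (is_derive_plus (fun s => Cmod (g s)) (fun s => Re (g s))); [exact Hmod|exact G1].
    - fold x y r.
      change (2 * ((y' * (r + x) - y * ((x * x' + y * y') / r + x')) / (r + x) ^ 2 * / (1 + (y / (r + x)) ^ 2)) = (x * y' - y * x') / r ^ 2).
      assert (Hu : 1 + (y / (r + x)) ^ 2 = 2 * r / (r + x)).
      { apply (Rmult_eq_reg_r ((r + x) ^ 2)); [|apply pow_nonzero; lra].
        transitivity ((r + x) ^ 2 + y ^ 2); [field; lra|]. transitivity (2 * r * (r + x)); [nra|field; lra]. }
      rewrite Hu.
      transitivity ((y' * (r + x) * r - (x * x' + y * y' + r * x') * y) / (r ^ 2 * (r + x))); [field; lra|].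
      replace (y' * (r + x) * r - (x * x' + y * y' + r * x') * y) with ((x * y' - y * x') * (r + x)); [field; lra|].
      replace (y' * (r + x) * r) with (y' * r ^ 2 + y' * x * r) by ring. rewrite Hr2. ring. }
  assert (Hq : (l / g t)%C = ((x * x' + y * y') / r ^ 2, (x * y' - y * x') / r ^ 2)).
  { rewrite Hr2. unfold Cdiv, Cinv. apply C_eq; simpl; fold (Re l) (Im l) (Re (g t)) (Im (g t)); fold x y x' y'; field; nra. }
  rewrite Hq. split.
  - exact Hre.
  - apply is_derive_ext_loc with (2 := Him). revert HL. apply filter_imp. intros s Hs.
    symmetry. change (Carg (g s) = 2 * atan (Im (g s) / (Cmod (g s) + Re (g s)))). now apply Carg_atan.
Qed.

Lemma slit_inv (z : C) : slit z -> slit (/ z)%C.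
Proof.
  intros H. assert (Hr : 0 < Cmod z) by (apply Cmod_gt_0, slit_neq0, H).
  assert (Hr2 := Cmod2_alt z). assert (Hd : 0 < Re z ^ 2 + Im z ^ 2) by (rewrite <- Hr2; now apply pow_lt).
  intros [H1 H2]. apply H. unfold Cinv in H1, H2. simpl in H1, H2. fold (Re z) (Im z) in H1, H2.
  split.
  - apply (Rmult_eq_compat_r (Re z ^ 2 + Im z ^ 2)) in H1. simpl in H1, Hd.
    replace (- Im z / (Re z * (Re z * 1) + Im z * (Im z * 1)) * (Re z * (Re z * 1) + Im z * (Im z * 1))) with (- Im z) in H1 by (field; lra). lra.
  - apply (Rmult_le_compat_r (Re z ^ 2 + Im z ^ 2)) in H2; [|lra]. simpl in H2, Hd.
    replace (Re z / (Re z * (Re z * 1) + Im z * (Im z * 1)) * (Re z * (Re z * 1) + Im z * (Im z * 1))) with (Re z) in H2 by (field; lra). lra.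
Qed.

Lemma Clog_inv (z : C) : slit z -> Clog (/ z) = (- Clog z)%C.
Proof.
  intros H. assert (Hz := slit_neq0 z H). assert (Hr : 0 < Cmod z) by (apply Cmod_gt_0, Hz). assert (Hp := slit_pos z H).
  assert (Hr2 := Cmod2_alt z).
  unfold Clog. rewrite !Carg_atan by (try apply slit_inv; assumption). rewrite Cmod_inv by assumption.
  apply C_eq; simpl.
  - apply ln_Rinv, Hr.
  - replace (- snd z / (fst z * (fst z * 1) + snd z * (snd z * 1)) / (/ Cmod z + fst z / (fst z * (fst z * 1) + snd z * (snd z * 1)))) with (- (Im z / (Cmod z + Re z))).
    + rewrite atan_opp. unfold Re, Im. ring.
    + fold (Re z) (Im z). replace (Re z * (Re z * 1) + Im z * (Im z * 1)) with (Cmod z ^ 2) by (rewrite Hr2; ring).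
      field. repeat split; lra.
Qed.

(** * The antiderivative and the path integral *)

Lemma RtoC_neq0 (x : R) : x <> 0 -> RtoC x <> RtoC 0.
Proof. intros H E. apply H. now apply RtoC_inj. Qed.

Lemma Gamma_poch (x : R) (k : nat) : (forall j, x + INR j <> 0) -> Gamma (x + INR k) = Gamma x * poch x k.
Proof.
  intros H. induction k as [|k IH]; [simpl; rewrite Rplus_0_r; ring|].
  rewrite S_INR. replace (x + (INR k + 1)) with (x + INR k + 1) by ring.
  rewrite Gamma_S, IH; [cbn [poch]; ring|]. intros j. rewrite Rplus_assoc, <- plus_INR. apply H.
Qed.

(** The variable w of the overview. *)
Definition hsq (z : C) : C := ((z / RtoC 2) ^ 2)%C.

Lemma BesselJ_CPS (mu : R) (z : C) : (forall k, mu + 1 + INR k <> 0) ->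
  BesselJ mu z = (Cexp (RtoC mu * Clog (z / RtoC 2)) * (RtoC (/ Gamma (mu + 1)) * CPS (jcoef mu) (hsq z)))%C.
Proof.
  intros Hmu. unfold BesselJ, Cpower, CPS. f_equal. rewrite <- CSeries_scal_R. apply CSeries_ext. intros k.
  replace (mu + INR k + 1) with (mu + 1 + INR k) by ring. rewrite Gamma_poch by assumption.
  unfold hsq. rewrite <- Cpow_mult_r, <- RtoC_pow.
  assert (G0 : Gamma (mu + 1) <> 0) by now apply euler_cv.
  assert (P := poch_neq0 _ k Hmu). assert (F := INR_fact_neq_0 k).
  unfold jcoef. rewrite RtoC_div, !RtoC_mult, RtoC_inv by (repeat apply Rmult_integral_contrapositive_currified; assumption).
  field. repeat split; now apply RtoC_neq0.
Qed.

Lemma Cpoch_RtoC (a : R) (k : nat) : Cpoch (RtoC a) k = RtoC (poch a k).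
Proof.
  induction k as [|k IH]; [reflexivity|]. simpl. now rewrite IH, RtoC_mult, RtoC_plus.
Qed.

Lemma poch_S_l (a : R) (k : nat) : poch a (S k) = a * poch (a + 1) k.
Proof.
  induction k as [|k IH]; [simpl; ring|].
  change (poch a (S k) * (a + INR (S k)) = a * (poch (a + 1) k * (a + 1 + INR k))). rewrite IH, S_INR. ring.
Qed.

Lemma hsq_4 (z : C) : (- z ^ 2)%C = (RtoC (-4) * hsq z)%C.
Proof.
  unfold hsq. assert (E : RtoC (-4) = (- (RtoC 2 * RtoC 2))%C).
  { rewrite <- RtoC_mult, <- RtoC_opp. apply f_equal; ring. }
  rewrite E. field.
Qed.

Lemma pFq_2F3 (nu : R) (z : C) : 0 < nu ->
  pFq [RtoC nu; (RtoC nu + RtoC 1 / RtoC 2)%C]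
      [(RtoC nu + RtoC 1)%C; (RtoC nu + RtoC 1)%C; (RtoC 2 * RtoC nu + RtoC 1)%C] (- z ^ 2)%C = CPS (pcoef nu) (hsq z).
Proof.
  intros Hnu. unfold pFq, CPS. apply CSeries_ext. intros k. rewrite hsq_4, Cpow_mult_l, <- RtoC_pow.
  rewrite <- RtoC_div by lra. rewrite <- !RtoC_mult, <- !RtoC_plus. unfold Cpoch_list. simpl fold_right. rewrite !Cpoch_RtoC.
  rewrite <- !RtoC_mult.
  assert (P1 : 0 < poch (2 * nu + 1) k) by (apply poch_pos; lra).
  assert (P2 : 0 < poch (nu + 1) k) by (apply poch_pos; lra).
  assert (F := INR_fact_neq_0 k).
  assert (E : poch nu k * (nu + INR k) = nu * poch (nu + 1) k) by (rewrite <- poch_S_l; reflexivity).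
  rewrite <- RtoC_div by (repeat apply Rmult_integral_contrapositive_currified; lra).
  assert (Hk := pos_INR k).
  unfold Cdiv. rewrite <- RtoC_inv by assumption.
  transitivity (RtoC (poch nu k * (poch (nu + 1 / 2) k * 1) / (poch (nu + 1) k * (poch (nu + 1) k * (poch (2 * nu + 1) k * 1))) * (-4) ^ k * / INR (fact k)) * hsq z ^ k)%C.
  - rewrite !RtoC_mult. ring.
  - f_equal. f_equal. unfold pcoef. rewrite Acoef_eq by assumption.
    replace (poch nu k) with (nu * poch (nu + 1) k / (nu + INR k)) by (rewrite <- E; field; lra).
    field. repeat split; lra.
Qed.

Lemma Csummable_S (c : nat -> R) (z : C) : entire c -> Csummable (fun k => (RtoC (c (S k)) * z ^ k)%C).
Proof.
  intros H. apply Csummable_le with (fun k => Rabs (PS_derive c k * Cmod z ^ k)).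
  - intros k. rewrite Cmod_term. unfold PS_derive. rewrite !Rabs_mult. apply Rmult_le_compat_r; [apply Rabs_pos|].
    rewrite <- (Rmult_1_l (Rabs (c (S k)))) at 1. apply Rmult_le_compat_r; [apply Rabs_pos|].
    rewrite Rabs_pos_eq by apply pos_INR. change 1 with (INR 1). apply le_INR. lia.
  - apply (entire_derive c H).
Qed.

(** The factor z^2 shifts the index by one: (1)_k / (2)_k = 1 / (k + 1) yields the denominators of
    [qcoef], while 1 - nu^2 completes the other two symbols of the denominator to index k + 1. *)
Lemma pFq_3F4 (nu : R) (z : C) : (forall m : Z, nu <> IZR m) ->
  (z ^ 2 / (RtoC 4 * (RtoC 1 - RtoC nu ^ 2)) *
   pFq [RtoC 1; RtoC 1; (RtoC 3 / RtoC 2)%C] [RtoC 2; RtoC 2; (RtoC 2 - RtoC nu)%C; (RtoC 2 + RtoC nu)%C] (- z ^ 2))%C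
  = CPS (qcoef nu) (hsq z).
Proof.
  intros Hnu. assert (H1 : 1 - nu <> 0) by (intros E; apply (Hnu 1%Z); lra).
  assert (H2 : 1 + nu <> 0) by (intros E; apply (Hnu (-1)%Z); lra).
  assert (H12 : 1 - nu ^ 2 <> 0).
  { replace (1 - nu ^ 2) with ((1 - nu) * (1 + nu)) by ring. now apply Rmult_integral_contrapositive_currified. }
  unfold CPS. rewrite CSeries_shift by (simpl; ring).
  transitivity (hsq z * CSeries (fun k => (RtoC (qcoef nu (S k)) * hsq z ^ k)%C))%C.
  2: { rewrite <- CSeries_scal by (apply Csummable_S, entire_qcoef, Hnu). apply CSeries_ext. intros k. rewrite Cpow_S. ring. }
  replace (z ^ 2 / (RtoC 4 * (RtoC 1 - RtoC nu ^ 2)))%C with (hsq z * RtoC (/ (1 - nu ^ 2)))%C.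
  2: { rewrite RtoC_inv, RtoC_minus, RtoC_pow by assumption. unfold hsq.
       replace (RtoC 4) with (RtoC 2 * RtoC 2)%C by (rewrite <- RtoC_mult; f_equal; ring).
       field. rewrite <- RtoC_pow, <- RtoC_minus. now apply RtoC_neq0. }
  rewrite <- Cmult_assoc. f_equal. unfold pFq. rewrite <- CSeries_scal_R. apply CSeries_ext. intros k.
  rewrite hsq_4, Cpow_mult_l, <- RtoC_pow.
  rewrite <- RtoC_div by lra. rewrite <- !RtoC_minus, <- !RtoC_plus. unfold Cpoch_list. simpl fold_right. rewrite !Cpoch_RtoC.
  rewrite <- !RtoC_mult.
  assert (F := INR_fact_neq_0 k). assert (NS : INR (S k) <> 0) by (apply not_0_INR; lia).
  assert (Q1 : poch 2 k = INR (S k) * INR (fact k)).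
  { rewrite <- mult_INR, <- fact_simpl, <- poch_1, poch_S_l. replace (1 + 1) with 2 by ring. ring. }
  assert (Q2 : poch (2 - nu) k <> 0).
  { apply poch_neq0. intros j. replace (2 - nu + INR j) with (- nu + 1 + INR (S j)) by (rewrite S_INR; ring). now apply plus_1_INR_neq0, nonint_opp. }
  assert (Q3 : poch (2 + nu) k <> 0).
  { apply poch_neq0. intros j. replace (2 + nu + INR j) with (nu + 1 + INR (S j)) by (rewrite S_INR; ring). now apply plus_1_INR_neq0. }
  assert (Q0 : poch 2 k <> 0) by (rewrite Q1; now apply Rmult_integral_contrapositive_currified).
  rewrite <- RtoC_div by (repeat apply Rmult_integral_contrapositive_currified; lra).
  unfold Cdiv. rewrite <- RtoC_inv by assumption.
  transitivity (RtoC (/ (1 - nu ^ 2) * (poch 1 k * (poch 1 k * (poch (3 / 2) k * 1)) / (poch 2 k * (poch 2 k * (poch (2 - nu) k * (poch (2 + nu) k * 1)))) * (-4) ^ k * / INR (fact k))) * hsq z ^ k)%C.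
  - rewrite !RtoC_mult. ring.
  - f_equal. f_equal. unfold qcoef. rewrite Dcoef_eq by assumption. rewrite !poch_S_l, Q1, poch_1.
    replace (1 - nu + 1) with (2 - nu) by ring. replace (1 + nu + 1) with (2 + nu) by ring. replace (1 / 2 + 1) with (3 / 2) by field.
    rewrite fact_simpl, mult_INR. simpl pow. replace (nu * (nu * 1)) with (nu ^ 2) by ring.
    replace (1 - nu ^ 2) with ((1 - nu) * (1 + nu)) by ring.
    field. repeat split; assumption.
Qed.

(** The logarithm of 2 / z appears as the opposite of that of z / 2, so that all multivalued terms
    depend on the single function Clog(z / 2). *)
Definition bracket (nu : R) (z : C) : C :=
  (RtoC (digamma nu + / (2 * nu)) - Clog (z / RtoC 2)
   + RtoC (PI * (cos (PI * nu) / sin (PI * nu)) / (2 * Gamma (nu + 1) ^ 2)) *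
     (Cexp (RtoC (2 * nu) * Clog (z / RtoC 2)) * CPS (pcoef nu) (hsq z))
   + CPS (qcoef nu) (hsq z))%C.

Definition Phi (nu : R) (z : C) : C := (RtoC (- / (PI * nu)) * bracket nu z)%C.

Lemma half_eq (z : C) : (z / RtoC 2)%C = (RtoC (/ 2) * z)%C.
Proof. rewrite RtoC_inv by lra. unfold Cdiv. ring. Qed.

Lemma slit_half (z : C) : slit z -> slit (z / RtoC 2)%C.
Proof. intros H. rewrite half_eq. apply slit_scal; [lra|assumption]. Qed.

Lemma Phi_eq (nu : R) (z : C) : 0 < nu -> (forall m : Z, nu <> IZR m) -> slit z ->
  (- (1 / (PI * nu)) *
        (Clog (2 / z) + digamma nu + 1 / (2 * nu)
         + PI * (cos (PI * nu) / sin (PI * nu)) * Cpower (z / 2) (2 * nu)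
             / (2 * (Gamma (nu + 1)%R) ^ 2)
           * pFq [RtoC nu; nu + 1 / 2]
                 [nu + 1; nu + 1; 2 * nu + 1] (- z ^ 2)
         + z ^ 2 / (4 * (1 - nu ^ 2))
           * pFq [RtoC 1; RtoC 1; 3 / 2]
                 [RtoC 2; RtoC 2; 2 - nu; 2 + nu] (- z ^ 2)))%C = Phi nu z.
Proof.
  intros Hnu Hz Hs. rewrite pFq_2F3, pFq_3F4 by assumption.
  assert (HP := PI_RGT_0). assert (Hsin := sin_PI_neq0 nu Hz).
  assert (HG : Gamma (nu + 1) <> 0) by (apply Rgt_not_eq, Gamma_pos; lra).
  replace (RtoC 2 / z)%C with (/ (z / RtoC 2))%C.
  2: { field. apply slit_neq0, Hs. }
  rewrite Clog_inv by now apply slit_half.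
  unfold Phi, bracket, Cpower. rewrite !RtoC_opp, !RtoC_inv, !RtoC_plus, !RtoC_inv, !RtoC_div, !RtoC_mult, !RtoC_div, !RtoC_pow by (try apply pow_nonzero; try apply Rmult_integral_contrapositive_currified; try apply pow_nonzero; lra || assumption).
  field. repeat split; apply RtoC_neq0; lra || assumption.
Qed.

Lemma pcoef_ode_C (nu : R) (w : C) : 0 < nu ->
  (RtoC nu * CPS (pcoef nu) w + w * CPS (PS_derive (pcoef nu)) w)%C = (RtoC nu * (CPS (jcoef nu) w * CPS (jcoef nu) w))%C.
Proof.
  intros Hnu. assert (Hj := entire_jcoef nu (plus_1_INR_neq0_pos nu Hnu)). assert (Hp := entire_pcoef nu Hnu).
  rewrite CPS_mult_w, <- (CPS_PS_mult (jcoef nu) (jcoef nu)), <- !CPS_scal, <- CPS_plus; try assumption.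
  - apply CPS_ext. intros k. change (PS_mult (jcoef nu) (jcoef nu) k) with (Acoef nu k). unfold pcoef. field.
    generalize (pos_INR k). lra.
  - apply entire_le with (pcoef nu) (Rabs nu); [|assumption]. intros k. rewrite Rabs_mult. lra.
  - now apply entire_INR_mult.
Qed.

Lemma qcoef_ode_C (nu : R) (w : C) : (forall m : Z, nu <> IZR m) ->
  (RtoC 2 * (w * CPS (PS_derive (qcoef nu)) w))%C = (RtoC 1 - CPS (jcoef nu) w * CPS (jcoef (- nu)) w)%C.
Proof.
  intros Hnu. assert (Hj := entire_jcoef nu (plus_1_INR_neq0 nu Hnu)). assert (Hj' := entire_jcoef _ (plus_1_INR_neq0 _ (nonint_opp nu Hnu))).
  assert (Hq := entire_qcoef nu Hnu). assert (HD := entire_Dcoef nu Hnu).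
  rewrite CPS_mult_w, <- (CPS_PS_mult (jcoef nu) (jcoef (- nu))), <- CPS_scal by assumption.
  change (PS_mult (jcoef nu) (jcoef (- nu))) with (Dcoef nu).
  assert (E : (CPS (fun k => 2 * (INR k * qcoef nu k))%R w + CPS (Dcoef nu) w)%C = RtoC 1).
  { rewrite <- CPS_plus.
    - rewrite CPS_const.
      + f_equal. unfold Dcoef, PS_mult, jcoef. simpl. field.
      + intros k. unfold qcoef. field. apply not_0_INR. lia.
    - apply entire_le with (fun k => INR k * qcoef nu k) 2; [|now apply entire_INR_mult].
      intros k. rewrite (Rabs_mult 2), (Rabs_pos_eq 2) by lra. lra.
    - assumption. }
  rewrite <- E. ring.
Qed.

Lemma is_derive_C_half (g : R -> C) (t : R) (l : C) : is_derive_C g t l -> is_derive_C (fun s => (g s / RtoC 2)%C) t (l / RtoC 2)%C.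
Proof.
  intros H. rewrite half_eq. apply is_derive_C_ext with (fun s => (RtoC (/ 2) * g s)%C); [intros s; now rewrite half_eq|].
  now apply is_derive_C_scal.
Qed.

Lemma is_derive_C_hsq (g : R -> C) (t : R) (l : C) : is_derive_C g t l -> is_derive_C (fun s => hsq (g s)) t (g t / RtoC 2 * l)%C.
Proof.
  intros H. apply is_derive_C_ext with (fun s => (g s / RtoC 2 * (g s / RtoC 2))%C); [intros s; unfold hsq; simpl; ring|].
  eapply is_derive_C_replace; [apply is_derive_C_mult; apply is_derive_C_half, H|]. cbv beta. field.
Qed.

Lemma is_derive_C_Clog_half (g : R -> C) (t : R) (l : C) : slit (g t) -> is_derive_C g t l ->
  is_derive_C (fun s => Clog (g s / RtoC 2)) t (l / g t)%C.
Proof.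
  intros Hs H. eapply is_derive_C_replace; [apply is_derive_C_Clog; [now apply slit_half|apply is_derive_C_half, H]|].
  cbv beta. field. now apply slit_neq0.
Qed.

Lemma is_derive_C_Cpower_half (a : R) (g : R -> C) (t : R) (l : C) : slit (g t) -> is_derive_C g t l ->
  is_derive_C (fun s => Cexp (RtoC a * Clog (g s / RtoC 2))) t (Cexp (RtoC a * Clog (g t / RtoC 2)) * (RtoC a * (l / g t)))%C.
Proof. intros Hs H. apply is_derive_C_Cexp, is_derive_C_scal, is_derive_C_Clog_half; assumption. Qed.

Lemma is_derive_C_CPS_hsq (a : nat -> R) (g : R -> C) (t : R) (l : C) : entire a -> is_derive_C g t l ->
  is_derive_C (fun s => CPS a (hsq (g s))) t (CPS (PS_derive a) (hsq (g t)) * (g t / RtoC 2 * l))%C.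
Proof. intros Ha H. apply is_derive_C_CPS; [assumption|now apply is_derive_C_hsq]. Qed.

Definition integrand (nu : R) (z : C) : C := (BesselJ nu z * BesselY nu z / z)%C.

(** In J_nu J_{-nu} the powers of z / 2 cancel, and the reflection formula turns 1 / (Gamma(1 + nu)
    Gamma(1 - nu) sin(PI nu)) into 1 / (PI nu). *)
Lemma integrand_eq (nu : R) (z : C) : 0 < nu -> (forall m : Z, nu <> IZR m) -> slit z ->
  integrand nu z = ((RtoC (cos (PI * nu) / sin (PI * nu) / Gamma (nu + 1) ^ 2) *
     (Cexp (RtoC (2 * nu) * Clog (z / RtoC 2)) * (CPS (jcoef nu) (hsq z) * CPS (jcoef nu) (hsq z)))
     + RtoC (- / (PI * nu)) * (CPS (jcoef nu) (hsq z) * CPS (jcoef (- nu)) (hsq z))) * / z)%C.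
Proof.
  intros Hnu Hz Hs. assert (HP := PI_RGT_0). assert (Hsin := sin_PI_neq0 nu Hz).
  assert (HG : Gamma (nu + 1) <> 0) by (apply Rgt_not_eq, Gamma_pos; lra).
  assert (HR := Gamma_reflection nu Hz).
  assert (HG' : Gamma (- nu + 1) = PI * nu / sin (PI * nu) / Gamma (nu + 1)).
  { rewrite <- HR. replace (1 + nu) with (nu + 1) by ring. replace (1 - nu) with (- nu + 1) by ring. field. assumption. }
  unfold integrand, BesselY.
  rewrite (BesselJ_CPS nu) by now apply plus_1_INR_neq0.
  rewrite (BesselJ_CPS (- nu)) by now apply plus_1_INR_neq0, nonint_opp.
  rewrite HG'. set (L := Clog (z / RtoC 2)).
  assert (E1 : Cexp (RtoC (2 * nu) * L) = (Cexp (RtoC nu * L) * Cexp (RtoC nu * L))%C).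
  { rewrite <- Cexp_plus. f_equal. rewrite RtoC_mult. ring. }
  assert (E2 : (Cexp (RtoC nu * L) * Cexp (RtoC (- nu) * L))%C = RtoC 1).
  { rewrite <- Cexp_plus, <- Cexp_0. f_equal. rewrite RtoC_opp. ring. }
  rewrite E1. set (e1 := Cexp (RtoC nu * L)) in *. set (e2 := Cexp (RtoC (- nu) * L)) in *.
  set (s1 := CPS (jcoef nu) (hsq z)). set (s2 := CPS (jcoef (- nu)) (hsq z)).
  assert (Hz0 := slit_neq0 z Hs).
  assert (C1 : (RtoC (cos (PI * nu) / sin (PI * nu) / Gamma (nu + 1) ^ 2) * RtoC (sin (PI * nu)))%C = (RtoC (/ Gamma (nu + 1)) * RtoC (/ Gamma (nu + 1)) * RtoC (cos (PI * nu)))%C).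
  { rewrite <- !RtoC_mult. f_equal. field. split; assumption. }
  assert (C2 : (RtoC (/ Gamma (nu + 1)) * RtoC (/ (PI * nu / sin (PI * nu) / Gamma (nu + 1))))%C = (RtoC (/ (PI * nu)) * RtoC (sin (PI * nu)))%C).
  { rewrite <- !RtoC_mult. f_equal. field. repeat split; try assumption; lra. }
  assert (Hsc : RtoC (sin (PI * nu)) <> RtoC 0) by now apply RtoC_neq0.
  set (k1 := RtoC (cos (PI * nu) / sin (PI * nu) / Gamma (nu + 1) ^ 2)) in *. set (S := RtoC (sin (PI * nu))) in *.
  set (i1 := RtoC (/ Gamma (nu + 1))) in *. set (i2 := RtoC (/ (PI * nu / sin (PI * nu) / Gamma (nu + 1)))) in *.
  set (co := RtoC (cos (PI * nu))) in *. rewrite RtoC_opp. set (p := RtoC (/ (PI * nu))) in *.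
  transitivity ((e1 * e1 * (i1 * i1 * co) * (s1 * s1) - (e1 * e2) * (i1 * i2) * (s1 * s2)) / S / z)%C; [field; split; assumption|].
  rewrite <- C1, C2, E2. field. split; assumption.
Qed.

(** The two coefficient identities convert the derivatives of the series into products of Bessel
    series; the derivative of the logarithm cancels the constant 1 of [qcoef_ode_C]. *)
Lemma is_derive_C_Phi (nu : R) (g : R -> C) (t : R) (l : C) : 0 < nu -> (forall m : Z, nu <> IZR m) -> slit (g t) -> is_derive_C g t l ->
  is_derive_C (fun s => Phi nu (g s)) t (- (integrand nu (g t) * l))%C.
Proof.
  intros Hnu Hz Hs H. assert (HP := PI_RGT_0). assert (Hsin := sin_PI_neq0 nu Hz).
  assert (HG : Gamma (nu + 1) <> 0) by (apply Rgt_not_eq, Gamma_pos; lra).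
  assert (Hz0 := slit_neq0 _ Hs).
  set (c0 := RtoC (digamma nu + / (2 * nu))).
  set (c1 := RtoC (PI * (cos (PI * nu) / sin (PI * nu)) / (2 * Gamma (nu + 1) ^ 2))).
  unfold Phi, bracket. fold c0 c1.
  apply is_derive_C_ext with (fun s => (RtoC (- / (PI * nu)) * (c0 + (RtoC (-1) * Clog (g s / RtoC 2) +
    (c1 * (Cexp (RtoC (2 * nu) * Clog (g s / RtoC 2)) * CPS (pcoef nu) (hsq (g s))) + CPS (qcoef nu) (hsq (g s))))))%C).
  { intros s. ring. }
  eapply is_derive_C_replace.
  - apply is_derive_C_scal. apply is_derive_C_plus; [apply is_derive_C_const|]. apply is_derive_C_plus; [apply is_derive_C_scal, is_derive_C_Clog_half; eassumption|].
    apply is_derive_C_plus.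
    + apply is_derive_C_scal, is_derive_C_mult; [apply is_derive_C_Cpower_half; eassumption|apply is_derive_C_CPS_hsq; [now apply entire_pcoef|eassumption]].
    + apply is_derive_C_CPS_hsq; [now apply entire_qcoef|eassumption].
  - cbv beta. rewrite integrand_eq by assumption.
    set (z := g t) in *. set (W := hsq z). assert (HW : (z * (z / RtoC 2) = RtoC 2 * W)%C) by (unfold W, hsq; simpl; field).
    assert (O1 := pcoef_ode_C nu W Hnu). assert (O2 := qcoef_ode_C nu W Hz).
    set (e := Cexp (RtoC (2 * nu) * Clog (z / RtoC 2))).
    set (pp := CPS (pcoef nu) W) in *. set (pd := CPS (PS_derive (pcoef nu)) W) in *. set (qd := CPS (PS_derive (qcoef nu)) W) in *.
    set (s1 := CPS (jcoef nu) W) in *. set (s2 := CPS (jcoef (- nu)) W) in *.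
    (* The factor 2 nu, from differentiating the power (z/2)^(2 nu), turns the constant of the 2F3
       term into that of J_nu^2 in the integrand. *)
    assert (K1 : (RtoC (- / (PI * nu)) * (c1 * (RtoC 2 * RtoC nu)))%C = (- RtoC (cos (PI * nu) / sin (PI * nu) / Gamma (nu + 1) ^ 2))%C).
    { unfold c1. rewrite <- !RtoC_mult, <- RtoC_opp. f_equal. field. repeat split; try assumption; lra. }
    set (k1 := RtoC (cos (PI * nu) / sin (PI * nu) / Gamma (nu + 1) ^ 2)) in *. rewrite (RtoC_mult 2 nu). set (p := RtoC (- / (PI * nu))) in *.
    transitivity ((p * (RtoC (-1) + c1 * RtoC 2 * e * (RtoC nu * pp) + c1 * e * pd * (z * (z / RtoC 2)) + qd * (z * (z / RtoC 2)))) * (l / z))%C.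
    { field. assumption. }
    rewrite HW.
    transitivity ((p * (RtoC (-1) + c1 * RtoC 2 * e * (RtoC nu * pp + W * pd) + RtoC 2 * (W * qd))) * (l / z))%C; [ring|].
    rewrite O1, O2.
    transitivity ((p * (c1 * (RtoC 2 * RtoC nu)) * (e * (s1 * s1)) - p * (s1 * s2) + p * (RtoC (-1) + RtoC 1)) * (l / z))%C; [ring|].
    rewrite K1, <- RtoC_plus. replace (-1 + 1) with 0 by ring. unfold Cdiv. ring.
Qed.

Lemma continuous_C_ext (f g : R -> C) (t : R) : locally t (fun s => f s = g s) -> continuous_C f t -> continuous_C g t.
Proof.
  intros H [H1 H2]. split.
  - apply continuous_ext_loc with (2 := H1). revert H. apply filter_imp. intros s ->. reflexivity.
  - apply continuous_ext_loc with (2 := H2). revert H. apply filter_imp. intros s ->. reflexivity.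
Qed.

Lemma continuous_C_integrand (nu : R) (g : R -> C) (t : R) (l : C) : 0 < nu -> (forall m : Z, nu <> IZR m) -> slit (g t) -> is_derive_C g t l ->
  continuous_C (fun s => integrand nu (g s)) t.
Proof.
  intros Hnu Hz Hs H.
  assert (Hj1 := entire_jcoef nu (plus_1_INR_neq0_pos nu Hnu)). assert (Hj2 := entire_jcoef _ (plus_1_INR_neq0 _ (nonint_opp nu Hz))).
  eapply continuous_C_ext.
  { generalize (slit_locally g t (is_derive_C_continuous _ _ _ H) Hs). apply filter_imp. intros s Hss. symmetry. now apply integrand_eq. }
  assert (S1 : continuous_C (fun s => CPS (jcoef nu) (hsq (g s))) t) by (eapply is_derive_C_continuous, is_derive_C_CPS_hsq; eassumption).
  assert (S2 : continuous_C (fun s => CPS (jcoef (- nu)) (hsq (g s))) t) by (eapply is_derive_C_continuous, is_derive_C_CPS_hsq; eassumption).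
  apply continuous_C_mult.
  - apply continuous_C_plus; apply continuous_C_mult; try apply continuous_C_const.
    + apply continuous_C_mult; [eapply is_derive_C_continuous, is_derive_C_Cpower_half; eassumption|now apply continuous_C_mult].
    + now apply continuous_C_mult.
  - apply continuous_C_inv; [eapply is_derive_C_continuous; eassumption|now apply slit_neq0].
Qed.

Lemma is_RInt_C1_path (nu : R) (g : R -> C) (a b : R) : 0 < nu -> (forall m : Z, nu <> IZR m) -> Defs.C1 g -> a <= b ->
  (forall t, a <= t <= b -> slit (g t)) ->
  is_RInt (V := C_R_NormedModule) (fun t => (integrand nu (g t) * path_derive g t)%C) a b (Phi nu (g a) - Phi nu (g b))%C.
Proof.
  intros Hnu Hz Hg Hab Hs.
  assert (HD : forall t, is_derive_C g t (path_derive g t)).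
  { intros t. destruct (Hg t) as [D1 [D2 _]]. split; now apply Derive_correct. }
  assert (HC : forall t, a <= t <= b -> continuous_C (fun s => (integrand nu (g s) * path_derive g s)%C) t).
  { intros t Ht. apply continuous_C_mult; [eapply continuous_C_integrand; eauto|]. destruct (Hg t) as [_ [_ [D3 D4]]]. split; assumption. }
  assert (HPhi : forall t, a <= t <= b -> is_derive_C (fun s => (RtoC (-1) * Phi nu (g s))%C) t (integrand nu (g t) * path_derive g t)%C).
  { intros t Ht. eapply is_derive_C_replace; [apply is_derive_C_scal, is_derive_C_Phi; eauto|]. ring. }
  assert (E : (Phi nu (g a) - Phi nu (g b))%C = (RtoC (-1) * Phi nu (g b) - RtoC (-1) * Phi nu (g a))%C) by ring.
  rewrite E.
  apply (is_RInt_fct_extend_pair (U := R_NormedModule) (V := R_NormedModule) (fun t => (integrand nu (g t) * path_derive g t)%C) a b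
    (Re (RtoC (-1) * Phi nu (g b)) - Re (RtoC (-1) * Phi nu (g a))) (Im (RtoC (-1) * Phi nu (g b)) - Im (RtoC (-1) * Phi nu (g a)))).
  - apply (is_RInt_derive (V := R_CompleteNormedModule) (fun t => Re (RtoC (-1) * Phi nu (g t)))).
    + intros t Ht. rewrite Rmin_left, Rmax_right in Ht by assumption. apply (HPhi t Ht).
    + intros t Ht. rewrite Rmin_left, Rmax_right in Ht by assumption. apply (HC t Ht).
  - apply (is_RInt_derive (V := R_CompleteNormedModule) (fun t => Im (RtoC (-1) * Phi nu (g t)))).
    + intros t Ht. rewrite Rmin_left, Rmax_right in Ht by assumption. apply (HPhi t Ht).
    + intros t Ht. rewrite Rmin_left, Rmax_right in Ht by assumption. apply (HC t Ht).
Qed.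

Lemma is_RInt_path (nu : R) (gamma : R -> C) (T : R) : 0 < nu -> (forall m : Z, nu <> IZR m) ->
  piecewise_C1 gamma -> (forall t, 0 <= t -> slit (gamma t)) -> 0 <= T ->
  is_RInt (V := C_R_NormedModule) (fun t => (integrand nu (gamma t) * path_derive gamma t)%C) 0 T (Phi nu (gamma 0) - Phi nu (gamma T))%C.
Proof.
  intros Hnu Hz [sigma [Hs0 [Hsi [Hsl Hg]]]] Hslit HT.
  assert (Hmono : forall i j, (i <= j)%nat -> sigma i <= sigma j).
  { intros i j Hij. induction Hij as [|j Hij IH]; [lra|]. generalize (Hsi j). lra. }
  assert (Hge : forall i, 0 <= sigma i) by (intros i; rewrite <- Hs0; apply Hmono; lia).
  assert (Hpiece : forall i a b, sigma i <= a -> a <= b -> b <= sigma (S i) ->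
    is_RInt (V := C_R_NormedModule) (fun t => (integrand nu (gamma t) * path_derive gamma t)%C) a b (Phi nu (gamma a) - Phi nu (gamma b))%C).
  { intros i a b Ha Hab Hb. destruct (Hg i) as [g [Hg1 Hgeq]].
    rewrite (Hgeq a), (Hgeq b) by lra.
    apply is_RInt_ext with (fun t => (integrand nu (g t) * path_derive g t)%C).
    - intros t Ht. rewrite Rmin_left, Rmax_right in Ht by assumption. rewrite (Hgeq t) by lra.
      match goal with |- ?x = ?y => change (@eq C x y) end. f_equal.
      (* Equality of derivatives requires agreement in a neighbourhood, which holds strictly inside
         a piece; [is_RInt_ext] only asks for interior points, so corners do not interfere. *)
      assert (Hloc : locally t (fun s => g s = gamma s)).
      { assert (Hd : 0 < Rmin (t - a) (b - t)) by (apply Rmin_glb_lt; lra).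
        exists (mkposreal _ Hd). intros s Hs. change (Rabs (s - t) < Rmin (t - a) (b - t)) in Hs.
        assert (Hs1 := Rlt_le_trans _ _ _ Hs (Rmin_l _ _)). assert (Hs2 := Rlt_le_trans _ _ _ Hs (Rmin_r _ _)).
        apply Rabs_lt_between in Hs1. apply Rabs_lt_between in Hs2. symmetry. apply Hgeq. lra. }
      unfold path_derive. f_equal; apply Derive_ext_loc; revert Hloc; apply filter_imp; intros s ->; reflexivity.
    - apply is_RInt_C1_path; try assumption. intros t Ht. rewrite <- Hgeq by lra. apply Hslit. generalize (Hge i). lra. }
  assert (Hstep : forall i, is_RInt (V := C_R_NormedModule) (fun t => (integrand nu (gamma t) * path_derive gamma t)%C) 0 (sigma i) (Phi nu (gamma 0) - Phi nu (gamma (sigma i)))%C).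
  { induction i as [|i IH].
    - rewrite Hs0. replace (Phi nu (gamma 0) - Phi nu (gamma 0))%C with (zero : C_R_NormedModule); [apply is_RInt_point|].
      change (RtoC 0 = (Phi nu (gamma 0) - Phi nu (gamma 0))%C). ring.
    - assert (H := is_RInt_Chasles (V := C_R_NormedModule) _ _ _ _ _ _ IH (Hpiece i (sigma i) (sigma (S i)) (Rle_refl _) (Rlt_le _ _ (Hsi i)) (Rle_refl _))).
      replace (Phi nu (gamma 0) - Phi nu (gamma (sigma (S i))))%C with
        (Phi nu (gamma 0) - Phi nu (gamma (sigma i)) + (Phi nu (gamma (sigma i)) - Phi nu (gamma (sigma (S i)))))%C by ring.
      exact H. }
  (* Some breakpoint exceeds T; descending from it finds the piece that contains T. *)
  assert (Hi : exists i, sigma i <= T <= sigma (S i)).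
  { assert (Hl := proj2 (is_lim_seq_spec _ _) Hsl T).
    destruct Hl as [N HN]. specialize (HN N (le_n N)). clear - HN HT Hs0.
    induction N as [|N IH]; [exists 0%nat; lra|].
    destruct (Rle_dec (sigma N) T) as [H|H]; [exists N; lra|]. apply IH. lra. }
  destruct Hi as [i Hi].
  assert (H := is_RInt_Chasles (V := C_R_NormedModule) _ _ _ _ _ _ (Hstep i) (Hpiece i (sigma i) T (Rle_refl _) (proj1 Hi) (proj2 Hi))).
  replace (Phi nu (gamma 0) - Phi nu (gamma T))%C with
    (Phi nu (gamma 0) - Phi nu (gamma (sigma i)) + (Phi nu (gamma (sigma i)) - Phi nu (gamma T)))%C by ring.
  exact H.
Qed.

Lemma Phi_real (nu x : R) : 0 < nu -> 0 < x -> Phi nu (RtoC x) = RtoC (- / (PI * nu) * bracket_real nu (x ^ 2 / 4)).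
Proof.
  intros Hnu Hx.
  assert (Hh : (RtoC x / RtoC 2)%C = RtoC (x / 2)) by (rewrite RtoC_div by lra; reflexivity).
  assert (HL : Clog (RtoC x / RtoC 2) = RtoC (ln (x / 2))).
  { rewrite Hh. unfold Clog. rewrite Carg_atan.
    - rewrite Cmod_R, Rabs_pos_eq by lra. simpl. unfold Rdiv at 2. rewrite Rmult_0_l, atan_0, Rmult_0_r. reflexivity.
    - intros [_ H]. simpl in H. lra. }
  assert (HW : hsq (RtoC x) = RtoC (x ^ 2 / 4)).
  { unfold hsq. rewrite Hh, <- RtoC_pow. f_equal. field. }
  unfold Phi, bracket. rewrite HL, HW, !CPS_RtoC.
  assert (HE : Cexp (RtoC (2 * nu) * RtoC (ln (x / 2))) = RtoC (pw nu (x ^ 2 / 4))).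
  { rewrite <- RtoC_mult. unfold Cexp. simpl. rewrite cos_0, sin_0. apply C_eq; simpl; [|ring].
    replace (x * (x * 1) / 4) with (x / 2 * (x / 2)) by field. rewrite pw_mult, pw_pos by lra. unfold Rpower. rewrite <- exp_plus, Rmult_1_r.
    f_equal. ring. }
  rewrite HE, <- !RtoC_mult, <- RtoC_minus, <- !RtoC_plus, <- RtoC_mult. f_equal. f_equal.
  unfold bracket_real. replace (4 * (x ^ 2 / 4)) with (x * x) by field.
  replace (ln (x / 2)) with (ln x - ln 2) by (unfold Rdiv; rewrite ln_mult, ln_Rinv by lra; ring).
  rewrite ln_mult by lra. replace (/ 2 * (ln x + ln x)) with (ln x) by field. unfold Rdiv. ring.
Qed.

Theorem theorem1 :
  forall (z : C) (nu : R),
    z <> RtoC 0 -> Rabs (Carg z) < PI ->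
    0 < nu -> (forall m : Z, nu <> IZR m) ->
    forall gamma : R -> C, path_to_infinity z gamma ->
    is_path_integral (fun t => (BesselJ nu t * BesselY nu t / t)%C) gamma
      (- (1 / (PI * nu)) *
        (Clog (2 / z) + digamma nu + 1 / (2 * nu)
         + PI * (cos (PI * nu) / sin (PI * nu)) * Cpower (z / 2) (2 * nu)
             / (2 * (Gamma (nu + 1)%R) ^ 2)
           * pFq [RtoC nu; nu + 1 / 2]
                 [nu + 1; nu + 1; 2 * nu + 1] (- z ^ 2)
         + z ^ 2 / (4 * (1 - nu ^ 2))
           * pFq [RtoC 1; RtoC 1; 3 / 2]
                 [RtoC 2; RtoC 2; 2 - nu; 2 + nu] (- z ^ 2)))%C.
Proof.
  intros z nu _ _ Hnu Hz gamma [Hg0 [Hpw [Hslit [[T0 HT0] Hinf]]]].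
  assert (Hs : forall t, 0 <= t -> slit (gamma t)) by exact Hslit.
  rewrite Phi_eq by (try assumption; rewrite <- Hg0; apply Hs, Rle_refl).
  unfold is_path_integral. intros P HP.
  (* From [T0] on the path is real and so is [Phi] along it: the imaginary part of the integral is
     exact there, and only the real part has to converge. *)
  assert (HP' : exists d : posreal, forall y : C, Rabs (Re y - Re (Phi nu z)) < d -> Im y = Im (Phi nu z) -> P y).
  { destruct HP as [d Hd]. exists d. intros y H1 H2. apply Hd. split; [exact H1|].
    change (Rabs (Im y - Im (Phi nu z)) < d). rewrite H2, Rminus_diag, Rabs_R0. apply d. }
  destruct HP' as [d Hd].
  assert (HG : is_lim (fun x => - / (PI * nu) * bracket_real nu (x ^ 2 / 4)) p_infty 0).
  { replace (Finite 0) with (Rbar_mult (- / (PI * nu)) 0) by (simpl; f_equal; ring).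
    apply is_lim_scal_l. apply (is_lim_comp (bracket_real nu) (fun x => x ^ 2 / 4) p_infty 0 p_infty); [now apply bracket_real_lim| |exists 0; intros; discriminate].
    apply is_lim_spec. intros M. exists (Rmax 4 M). intros x Hx.
    assert (4 < x /\ M < x) by (split; eapply Rle_lt_trans; try exact Hx; [apply Rmax_l|apply Rmax_r]). nra. }
  apply is_lim_spec in HG. destruct (HG d) as [X HX].
  apply is_lim_spec in Hinf. destruct (Hinf (Rmax 0 X)) as [T1 HT1].
  (* Beyond [T0] the path is on the real axis; beyond [T1] it has passed both 0 and the point [X]
     from which [Phi] is within [d] of 0. *)
  apply (Filter_prod _ _ _ (fun a => a = 0) (fun b => Rmax 0 (Rmax T0 T1) < b)).
  - reflexivity.
  - exists (Rmax 0 (Rmax T0 T1)). intros b Hb. exact Hb.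
  - intros a b -> Hb. simpl.
    assert (Hb0 : 0 < b) by (eapply Rle_lt_trans; [apply Rmax_l|exact Hb]).
    assert (Hb1 : T0 <= b).
    { left. eapply Rle_lt_trans; [|exact Hb]. eapply Rle_trans; [apply Rmax_l|apply Rmax_r]. }
    assert (Hb2 : T1 < b).
    { eapply Rle_lt_trans; [|exact Hb]. eapply Rle_trans; [apply (Rmax_r T0)|apply Rmax_r]. }
    exists (Phi nu (gamma 0) - Phi nu (gamma b))%C. split.
    + apply (is_RInt_path nu gamma b); try assumption. lra.
    + rewrite Hg0.
      assert (Hx : Rmax 0 X < Re (gamma b)) by now apply HT1.
      assert (E : gamma b = RtoC (Re (gamma b))) by (apply C_eq; [reflexivity|apply HT0, Hb1]).
      assert (Hx0 : 0 < Re (gamma b)) by (eapply Rle_lt_trans; [apply Rmax_l|exact Hx]).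
      assert (HxX : X < Re (gamma b)) by (eapply Rle_lt_trans; [apply Rmax_r|exact Hx]).
      specialize (HX _ HxX). rewrite Rminus_0_r in HX.
      rewrite E, Phi_real by assumption. apply Hd.
      * set (v := - / (PI * nu) * bracket_real nu (Re (gamma b) ^ 2 / 4)) in *.
        change (Rabs (Re (Phi nu z) - v - Re (Phi nu z)) < d).
        replace (Re (Phi nu z) - v - Re (Phi nu z)) with (- v) by ring. rewrite Rabs_Ropp. exact HX.
      * change (Im (Phi nu z) - 0 = Im (Phi nu z)). ring.
Qed.
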